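(* Let $F,G\in K[x_1,\dots,x_n]$ be nonconstant coprime polynomials, and let $g_1,\dots,g_n\in K^*$, not all in $\mathbf{k}$. Let $S\subset C(\mathbf{k})$ be the (finite) set of zeros and poles of $g_1,\dots,g_n$. For any $\epsilon>0$ there exist an integer $m$ and constants $c_1,c_2$, depending only on $\epsilon$ (for the given $n,F,G$), such that for each positive integer $$\ell>c_1(\tilde h(F)+\tilde h(G))+c_2\bigl(\mathfrak g+n\max_{1\le i\le n}h(g_i)\bigr),$$ either $g_1^{m_1}\cdots g_n^{m_n}\in\mathbf{k}$ for some integers $m_1,\dots,m_n$, not all zero, with $\sum|m_i|\le2m$, or both of the following hold: (a) $N_{S,\gcd}(F(g_1^\ell,\dots,g_n^\ell),G(g_1^\ell,\dots,g_n^\ell))\le\epsilon\max_i h(g_i^\ell)$; (b) if moreover not both $F$ and $G$ vanish at $(0,\dots,0)$, then $h_{\gcd}(F(g_1^\ell,\dots,g_n^\ell),G(g_1^\ell,\dots,g_n^\ell))\le\epsilon\max_i h(g_i^\ell)$.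
   Context: $\mathbf{k}$ is an algebraically closed field of characteristic zero, $C$ a smooth projective curve over $\mathbf{k}$ of genus $\mathfrak g$, $K=\mathbf{k}(C)$; $v_{\mathfrak p}$ is the order-of-vanishing valuation at $\mathfrak p\in C(\mathbf{k})$. For $f\in K^*$: $v^0_{\mathfrak p}(f)=\max\{0,v_{\mathfrak p}(f)\}$, $h(f)=\sum_{\mathfrak p}\max\{0,-v_{\mathfrak p}(f)\}$. For $f,g\in K$: $N_{S,\gcd}(f,g)=\sum_{\mathfrak p\notin S}\min\{v^0_{\mathfrak p}(f),v^0_{\mathfrak p}(g)\}$, $h_{\gcd}(f,g)=\sum_{\mathfrak p\in C}\min\{v^0_{\mathfrak p}(f),v^0_{\mathfrak p}(g)\}$. For nonzero $F=\sum a_{\mathbf i}\mathbf{x}^{\mathbf i}$, $v_{\mathfrak p}(F)=\min_{a_{\mathbf i}\neq0}v_{\mathfrak p}(a_{\mathbf i})$ and $\tilde h(F)=-\sum_{\mathfrak p}\min\{0,v_{\mathfrak p}(F)\}$. *)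

(* Defs.v *)
From HB Require Import structures.
From mathcomp Require Import all_boot all_order all_algebra.
From mathcomp Require Import boolp classical_sets cardinality fsbigop reals.
From mathcomp Require Import mpoly.
Set Implicit Arguments. Unset Strict Implicit. Unset Printing Implicit Defensive.
Import Order.TTheory GRing.Theory Num.Theory.
Local Open Scope ring_scope.

(* Setting: k an (algebraically closed, char 0) field embedded in K via iota;
   K is modelled as a function field of one variable over k, and the points of
   the smooth projective curve C with k(C) = K are modelled as the places of K/k,
   i.e. the normalized discrete valuations of K trivial on k. *)
Section FunctionField.
Variables (k K : fieldType) (iota : {rmorphism k -> K}).

Definition is_const (x : K) : Prop := exists c : k, x = iota c.

Definition kev (N : nat) (P : {mpoly k[N]}) (s : 'I_N -> K) : K :=
  (map_mpoly iota P).@[s].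

Definition function_field_one_var : Prop :=
  (exists (N : nat) (s : 'I_N -> K), forall z : K,
      exists A B : {mpoly k[N]}, kev B s != 0 /\ z = kev A s / kev B s)
  /\ (exists t : K,
      (forall p : {poly k}, p != 0 -> ~~ root (map_poly iota p) t)
      /\ forall z : K, exists P : {mpoly k[2]},
           P != 0 /\ kev P (fun i : 'I_2 => if val i == 0%N then t else z) = 0).

(* normalized discrete valuation of K, trivial on k (value at 0 fixed to 0) *)
Definition is_place (v : K -> int) : Prop :=
  [/\ v 0 = 0,
      forall x y, x != 0 -> y != 0 -> v (x * y) = v x + v y,
      forall x y, x != 0 -> y != 0 -> x + y != 0 ->
        Num.min (v x) (v y) <= v (x + y),
      forall c : k, c != 0 -> v (iota c) = 0
    & exists x, v x = 1].

Definition place : Type := {classic {v : K -> int | is_place v}}.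

Definition ord (p : place) (x : K) : int := proj1_sig p x.

(* finitely supported sum over a set of points (0 if support infinite) *)
Definition psum (A : set place) (phi : place -> int) : int :=
  \sum_(p \in A) phi p.

Definition vpos (x : int) : int := Num.max 0 x.

Definition height (f : K) : int := psum setT (fun p => vpos (- ord p f)).

(* htilde(F) = - sum_p min(0, v_p(F)), v_p(F) = min over nonzero coefficients *)
Definition htilde (n : nat) (F : {mpoly K[n]}) : int :=
  psum setT (fun p => \big[Num.max/0]_(m <- msupp F) vpos (- ord p F@_m)).

(* min(v^0_p(f), v^0_p(g)), with v^0_p(0) = +oo (not both f, g zero) *)
Definition mingcd (p : place) (f g : K) : int :=
  if f == 0 then vpos (ord p g)
  else if g == 0 then vpos (ord p f)
  else Num.min (vpos (ord p f)) (vpos (ord p g)).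

(* N_{S,gcd}(f,g) <= X ; when f = g = 0 the left side is +oo *)
Definition NSgcd_le (R : realType) (S : set place) (f g : K) (X : R) : Prop :=
  ~ (f = 0 /\ g = 0) /\ (psum (~` S) (fun p => mingcd p f g))%:~R <= X.

Definition hgcd_le (R : realType) (f g : K) (X : R) : Prop :=
  ~ (f = 0 /\ g = 0) /\ (psum setT (fun p => mingcd p f g))%:~R <= X.

Definition divisor (D : place -> int) : Prop := finite_set [set p | D p != 0].
Definition deg (D : place -> int) : int := psum setT D.
Definition in_LD (D : place -> int) (f : K) : Prop :=
  f = 0 \/ forall p, 0 <= ord p f + D p.
Definition ldim_ge (D : place -> int) (N : nat) : Prop :=
  exists s : 'I_N -> K, (forall i, in_LD D (s i)) /\
    forall c : 'I_N -> k, \sum_i iota (c i) * s i = 0 -> forall i, c i = 0.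
Definition ldim (D : place -> int) (N : nat) : Prop :=
  ldim_ge D N /\ ~ ldim_ge D N.+1.
(* genus = max_D (deg D - l(D) + 1)  (Riemann's theorem) *)
Definition is_genus (g : nat) : Prop :=
  (forall D N, divisor D -> ldim D N -> deg D - N%:Z + 1 <= g%:Z)
  /\ (exists D N, [/\ divisor D, ldim D N & deg D - N%:Z + 1 = g%:Z]).

End FunctionField.

Section Polys.
Variables (K : fieldType) (n : nat).
Definition mconst (F : {mpoly K[n]}) : Prop := exists c : K, F = c%:MP.
Definition mcoprime (F G : {mpoly K[n]}) : Prop :=
  forall H : {mpoly K[n]}, (exists Q, F = H * Q) -> (exists Q, G = H * Q) -> mconst H.
End Polys.

(* Main.v *)
(** Put [u_i = g_i^l].  The zeros and poles of the [u_i] lie in [S], and for large [l] the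
    cardinality of [S] is negligible compared with the heights of the [u_i].

    Choose a large degree [N] and, in the ideal [(F, G)], a family of polynomials of degree at
    most [N] that is independent over [K] and misses only [O(N^(n-2))] dimensions; multiply it
    by a basis of a Riemann--Roch space [L(E)] (Steinmetz's device for moving targets).  Let
    [W] be the Wronskian of the values of these [M] functions at [u].  Outside [S] the order of
    [W] is at least [M] times the minimum of the orders of [F(u)] and [G(u)].  On [S], by
    Cauchy--Binet, it is at least the sum of the orders of all the functions [e' u^m], where
    [e'] runs over a basis of a slightly larger space [L(E')], up to the few omitted ones.  As
    [W] and the [e' u^m] have as many zeros as poles, the gcd sum is bounded by the contribution
    of the omitted functions, which is small because the codimension is.

    The Wronskian vanishes only if the [e' u^m] are dependent over [k].  Then a minimal
    relation, again through Wronskians, bounds the height of the ratio of two of its terms with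
    distinct exponents, and for large [l] this forces a monomial in the [g_i] to be constant.

    On [S] itself, when [F(0) <> 0], the zeros of [F(u)] are counted by the Wronskian of the
    terms of [F(u)], in which the constant term may be replaced by [F(u)].

    The product formula and the finiteness of zeros and poles come from the definition of the
    genus: Riemann's inequality, which it asserts, is an equality above some divisor. *)

(* Why the codimension must drop by two powers of [N]: on [S] each omitted function may have order
   about [N] times that of the [u_i], so the gcd sum costs N codim / M heights. The multiples of one
   polynomial would leave a codimension of order N^(n-1) and a ratio not tending to 0; for two
   coprime ones the ratio is of order 1/N.

   The coefficients of [F] and [G] lie in [K], while Wronskians are linear only over [k]. After
   multiplication by L(E), these coefficients become [k]-combinations of a basis of L(E'). The two
   dimensions differ by a fixed number, so their ratio tends to 1; hence [N] is chosen from [eps]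
   first, and the dimension of L(E) afterwards.

   A derivation may create poles. The places outside [S] are infinite in number, so the loss there
   must be carried by a fixed divisor, [lam]. On [S] a loss of 1 + [lam] per derivation is
   affordable: [S] has at most 2n max h(g_i) points, a bound free of [l]. This is the source of the
   threshold on [l]. *)
Require Import Defs.
From HB Require Import structures.
From mathcomp Require Import all_boot all_order all_fingroup all_algebra.
From mathcomp Require Import finmap boolp classical_sets cardinality fsbigop reals.
From mathcomp Require Import mpoly zify ring lra.
Set Implicit Arguments. Unset Strict Implicit. Unset Printing Implicit Defensive.
Import Order.TTheory GRing.Theory Num.Theory.
Local Open Scope classical_set_scope.
Local Open Scope ring_scope.

(** * Valuations *)

Section Valuations.
Variables (k : closedFieldType) (K : fieldType) (iota : {rmorphism k -> K}).
Local Notation place := (place iota).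
Implicit Types (p : place) (x y : K) (r : int).

Lemma ord_0 p : ord p 0 = 0.
Proof. by rewrite /ord; case: (proj2_sig p). Qed.

Lemma ordM p x y : x != 0 -> y != 0 -> ord p (x * y) = ord p x + ord p y.
Proof. by rewrite /ord; case: (proj2_sig p) => _ + _ _ _; apply. Qed.

Lemma ordC p c : ord p (iota c) = 0.
Proof.
have [->|c0] := eqVneq c 0; first by rewrite rmorph0 ord_0.
by rewrite /ord; case: (proj2_sig p) => _ _ _ + _; apply.
Qed.

Lemma ordD_min p x y : x != 0 -> y != 0 -> x + y != 0 ->
  Num.min (ord p x) (ord p y) <= ord p (x + y).
Proof. by rewrite /ord; case: (proj2_sig p) => _ _ + _ _; apply. Qed.

Lemma ord_unif p : exists x, ord p x = 1.
Proof. by rewrite /ord; case: (proj2_sig p). Qed.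

Lemma ord_1 p : ord p 1 = 0.
Proof. by rewrite -(rmorph1 iota) ordC. Qed.

Lemma ordN p x : ord p (- x) = ord p x.
Proof.
have [->|x0] := eqVneq x 0; first by rewrite oppr0.
rewrite -mulN1r ordM ?oppr_eq0 ?oner_eq0 //.
by rewrite -(rmorph1 iota) -rmorphN ordC add0r.
Qed.

Lemma ordV p x : ord p x^-1 = - ord p x.
Proof.
have [->|x0] := eqVneq x 0; first by rewrite invr0 ord_0.
have xV0 : x^-1 != 0 by rewrite invr_eq0.
by apply/eqP; rewrite -addr_eq0 -ordM // mulVf // ord_1.
Qed.

Lemma ordX p x n : ord p (x ^+ n) = ord p x *+ n.
Proof.
have [->|x0] := eqVneq x 0.
  by rewrite expr0n ord_0 mul0rn; case: n => [|n] /=; rewrite ?ord_1 ?ord_0.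
elim: n => [|n IHn]; first by rewrite expr0 ord_1.
by rewrite exprS ordM ?expf_neq0 // IHn mulrS.
Qed.

Lemma ordXz p x (n : int) : ord p (x ^ n) = ord p x * n.
Proof.
case: n => n; first by rewrite -exprnP ordX -mulr_natr natz.
by rewrite NegzE -exprnN ordV ordX mulrN -mulr_natr natz.
Qed.

Lemma ord_prod p (I : Type) (s : seq I) (P : pred I) (F : I -> K) :
  (forall i, F i != 0) ->
  ord p (\prod_(i <- s | P i) F i) = \sum_(i <- s | P i) ord p (F i).
Proof.
move=> F0.
suff [] : \prod_(i <- s | P i) F i != 0 /\
  ord p (\prod_(i <- s | P i) F i) = \sum_(i <- s | P i) ord p (F i) by [].
apply: (big_rec2 (fun x z => x != 0 /\ ord p x = z)).
  by rewrite oner_eq0 ord_1.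
by move=> i x z _ [x0 <-]; rewrite mulf_neq0 // ordM.
Qed.

(* The condition that [x] lies in the [r]-th power of the maximal ideal at [p];
   it absorbs the junk value [ord p 0 = 0]. *)
Definition vge p x r : Prop := x = 0 \/ r <= ord p x.

Lemma vge0 p r : vge p 0 r. Proof. by left. Qed.

Lemma vge_ord p x : vge p x (ord p x). Proof. by right. Qed.

Lemma vgeP p x r : x != 0 -> vge p x r -> r <= ord p x.
Proof. by move=> /eqP x0 [|]. Qed.

Lemma vgeW p x r r' : r' <= r -> vge p x r -> vge p x r'.
Proof. by move=> le [->|h]; [left | right; apply: le_trans le h]. Qed.

Lemma vgeN p x r : vge p x r -> vge p (- x) r.
Proof. by move=> [->|h]; [rewrite oppr0; left | right; rewrite ordN]. Qed.

Lemma vgeD p x y r : vge p x r -> vge p y r -> vge p (x + y) r.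
Proof.
have [->|x0] := eqVneq x 0; first by rewrite add0r.
have [->|y0] := eqVneq y 0; first by rewrite addr0.
have [->|s0] := eqVneq (x + y) 0; first by left.
move=> /(vgeP x0) hx /(vgeP y0) hy; right.
have : Num.min (ord p x) (ord p y) <= ord p (x + y).
  exact: ordD_min.
by apply: le_trans; rewrite le_min hx hy.
Qed.

Lemma vgeB p x y r : vge p x r -> vge p y r -> vge p (x - y) r.
Proof. by move=> hx /vgeN hy; apply: vgeD. Qed.

Lemma vgeM p x y r s : vge p x r -> vge p y s -> vge p (x * y) (r + s).
Proof.
have [->|x0] := eqVneq x 0; first by rewrite mul0r; left.
have [->|y0] := eqVneq y 0; first by rewrite mulr0; left.
by move=> /(vgeP x0) hx /(vgeP y0) hy; right; rewrite ordM // lerD.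
Qed.

Lemma vgeC p c : vge p (iota c) 0.
Proof. by right; rewrite ordC. Qed.

Lemma vge1 p : vge p 1 0.
Proof. by right; rewrite ord_1. Qed.

Lemma vgeMl p x y r : vge p x 0 -> vge p y r -> vge p (x * y) r.
Proof. by move=> hx hy; rewrite -[r]add0r; apply: vgeM. Qed.

Lemma vgeMr p x y r : vge p x r -> vge p y 0 -> vge p (x * y) r.
Proof. by move=> hx hy; rewrite -[r]addr0; apply: vgeM. Qed.

Lemma vge_sum p (I : Type) (s : seq I) (P : pred I) (F : I -> K) r :
  (forall i, P i -> vge p (F i) r) -> vge p (\sum_(i <- s | P i) F i) r.
Proof.
move=> h; apply: (big_ind (fun x => vge p x r)) => //; first exact: vge0.
by move=> x y; apply: vgeD.
Qed.

Lemma vge_prod p (I : Type) (s : seq I) (P : pred I) (F : I -> K) (r : I -> int) :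
  (forall i, P i -> vge p (F i) (r i)) ->
  vge p (\prod_(i <- s | P i) F i) (\sum_(i <- s | P i) r i).
Proof.
move=> h; apply: (big_ind2 (fun x z => vge p x z)) => //; first exact: vge1.
by move=> x1 x2 y1 y2; apply: vgeM.
Qed.

Lemma vge_det p n (A : 'M[K]_n) (r : 'I_n -> 'I_n -> int) (b : int) :
  (forall i j, vge p (A i j) (r i j)) ->
  (forall s : 'S_n, b <= \sum_i r i (s i)) ->
  vge p (\det A) b.
Proof.
move=> hA hb; apply: vge_sum => s _; apply: vgeMl.
  by rewrite -(rmorph1 iota) -rmorphN -rmorphXn; apply: vgeC.
by apply: (vgeW (hb s)); apply: vge_prod.
Qed.

(** The nonzero term of least order cannot be cancelled: the other terms all lie in the next power
    of the maximal ideal. *)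
Lemma sum_neq0_distinct_ord p (I : finType) (x : I -> K) :
  (exists i, x i != 0) ->
  (forall i j, x i != 0 -> x j != 0 -> ord p (x i) = ord p (x j) -> i = j) ->
  \sum_i x i != 0.
Proof.
move=> [i0 xi0] dist.
pose i1 := [arg min_(i < i0 | x i != 0) ord p (x i)]%O.
have [xi1 i1min] : x i1 != 0 /\ forall j, x j != 0 -> ord p (x i1) <= ord p (x j).
  by rewrite /i1; case: (@arg_minP _ _ I i0 (fun i => x i != 0) (fun i => ord p (x i)) xi0) => i ? h; split.
apply/negP; rewrite (bigD1 i1) //= addr_eq0 => /eqP e.
have : vge p (x i1) (ord p (x i1) + 1).
  rewrite e; apply: vgeN; apply: vge_sum => j ji.
  have [->|xj] := eqVneq (x j) 0; first by left.
  right; rewrite -e lezD1 lt_neqAle i1min // andbT.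
  by apply/eqP => /(dist _ _ xi1 xj) ij; rewrite ij eqxx in ji.
by move/(vgeP xi1); rewrite -[X in _ <= X]addr0 lerD2l.
Qed.

Definition pev (q : {poly k}) x : K := (map_poly iota q).[x].

Lemma pevE q x : pev q x = \sum_(i < size q) iota q`_i * x ^+ i.
Proof.
rewrite /pev (@horner_coef_wide _ (size q)) ?size_map_poly //.
by apply: eq_bigr => i _; rewrite coef_map.
Qed.

(* Polynomial relations between two elements, as polynomials in the second
   variable with coefficients in [k[X]]. *)
Definition ev2 (Q : {poly {poly k}}) x y : K := \sum_(i < size Q) pev Q`_i x * y ^+ i.

Lemma ev2_hornerE (Q : {poly {poly k}}) x y :
  ev2 Q x y = (map_poly (horner_morph (fun z => mulrC x (iota z))) Q).[y].
Proof.
rewrite (@horner_coef_wide _ (size Q)) ?size_poly //.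
by apply: eq_bigr => i _; rewrite coef_map.
Qed.

(** The indices [a] and [b] select the main variable, so that one bivariate relation can be read as
    an equation for either of the two elements over the other. *)
Lemma ev2_of_kev (a b : 'I_2) (P : {mpoly k[2]}) (s : 'I_2 -> K) :
  a != b -> P != 0 -> kev iota P s = 0 ->
  exists2 Q : {poly {poly k}}, Q != 0 & ev2 Q (s a) (s b) = 0.
Proof.
move=> ab P0 e.
pose Q := \sum_(m <- msupp P) (P@_m *: 'X^(m a))%:P * 'X^(m b) : {poly {poly k}}.
have coefQ i j : Q`_j`_i = \sum_(m <- msupp P) (if (m a == i) && (m b == j) then P@_m else 0).
  rewrite !coef_sum; apply: eq_bigr => m _.
  rewrite coefCM coefXn eq_sym; case: (m b == j); last by rewrite mulr0 coef0 andbF.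
  rewrite mulr1 coefZ coefXn eq_sym andbT.
  by case: (m a == i); rewrite ?mulr1 ?mulr0.
have univ i : i = a \/ i = b.
  case: i a b ab {Q coefQ} => [[|[|?]] // ?] [[|[|?]] // ?] [[|[|?]] // ?] // _;
  by [left; apply/val_inj | right; apply/val_inj].
have hP : P = \sum_(m <- msupp P) P@_m *: 'X_[m] by exact: mpolyE.
exists Q.
  have [m Pm] : exists m, m \in msupp P.
    case ms: (msupp P) => [|m l]; last by exists m; rewrite inE eqxx.
    by case/eqP: P0; apply/eqP; rewrite -msupp_eq0 ms.
  apply/eqP => Q0; have := coefQ (m a) (m b).
  rewrite Q0 !coef0 (bigD1_seq m) //= ?msupp_uniq // !eqxx big1 ?addr0.
    by move=> /esym /eqP; rewrite mcoeff_eq0 Pm.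
  move=> m' ne; case: ifP => // /andP[/eqP ea /eqP eb].
  case/eqP: ne; apply/mnmP => i; case: (univ i) => ->; [exact: ea| exact: eb].
have kevE : kev iota P s =
    \sum_(m <- msupp P) iota P@_m * (s a ^+ m a * s b ^+ m b).
  rewrite /kev {1}hP (raddf_sum (map_mpoly iota)) raddf_sum.
  apply: eq_bigr => m _.
  transitivity (map_mpoly iota (P@_m *: 'X_[m])).@[s]; first by [].
  rewrite map_mpolyZ map_mpolyX mevalZ mevalX; congr (_ * _).
  rewrite (bigD1 a) //= (bigD1 b) /=; last by rewrite eq_sym.
  rewrite big1 ?mulr1 // => i /andP[ia ib]; case: (univ i) => ei.
    by rewrite ei eqxx in ia.
  by rewrite ei eqxx in ib.
rewrite ev2_hornerE /Q rmorph_sum horner_sum -[RHS]e kevE.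
apply: eq_bigr => m _; rewrite rmorphM /= map_polyC map_polyXn hornerM hornerC hornerXn /=.
by rewrite /horner_morph -mul_polyC rmorphM /= map_polyC map_polyXn hornerM hornerC hornerXn -mulrA.
Qed.

End Valuations.

(** * Residue fields of places are equal to [k] *)

Section Residues.
Variables (k : closedFieldType) (K : fieldType) (iota : {rmorphism k -> K}).
Local Notation place := (place iota).

(** Over the algebraically closed [k] a polynomial splits into factors x - c, each of order 0 by
    hypothesis. *)
Lemma ord_pev (p : place) x :
  (forall c, x - iota c != 0 /\ ord p (x - iota c) = 0) ->
  forall q, q != 0 -> pev iota q x != 0 /\ ord p (pev iota q x) = 0.
Proof.
move=> hx q q0; have [r ->] := closed_field_poly_normal q.
rewrite /pev map_polyZ hornerZ rmorph_prod horner_prod.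
have lc0 : iota (lead_coef q) != 0 by rewrite fmorph_eq0 lead_coef_eq0.
have h c : (map_poly iota ('X - c%:P)).[x] = x - iota c.
  by rewrite rmorphB /= map_polyX map_polyC hornerXsubC.
under eq_bigr do rewrite h.
have p0 : \prod_(c <- r) (x - iota c) != 0.
  by rewrite prodf_seq_neq0; apply/allP => c _; case: (hx c).
split; first by rewrite mulf_neq0.
rewrite ordM // ordC add0r ord_prod; last by move=> c; case: (hx c).
by rewrite big1 // => c _; case: (hx c).
Qed.

(** The nonzero terms have orders [i * ord p y], pairwise distinct because [ord p y] is nonzero. *)
Lemma ev2_neq0 (p : place) (Q : {poly {poly k}}) x y :
  Q != 0 -> (forall c, x - iota c != 0 /\ ord p (x - iota c) = 0) ->
  ord p y != 0 -> ev2 iota Q x y != 0.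
Proof.
move=> Q0 hx hy; have h := ord_pev hx.
have y0 : y != 0 by apply: contraNneq hy => ->; rewrite ord_0.
apply: (sum_neq0_distinct_ord (p := p)).
  have s0 : ((size Q).-1 < size Q)%N by rewrite prednK // lt0n size_poly_eq0.
  exists (Ordinal s0); rewrite mulf_neq0 ?expf_neq0 //.
  by case: (h (lead_coef Q)) => //; rewrite lead_coef_eq0.
have ordE (i : 'I_(size Q)) : pev iota Q`_i x * y ^+ i != 0 ->
    ord p (pev iota Q`_i x * y ^+ i) = ord p y *+ i.
  rewrite mulf_eq0 negb_or => /andP[a0 b0].
  rewrite ordM // ordX; case: (h Q`_i); last by move=> _ ->; rewrite add0r.
  by apply: contraNneq a0 => ->; rewrite /pev rmorph0 horner0.
move=> i j /ordE-> /ordE->.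
rewrite -[_ *+ i]mulr_natr -[_ *+ j]mulr_natr !natz => /(mulfI hy) [] ij.
exact: val_inj.
Qed.

(* Otherwise every nonzero polynomial in [u] would have order 0 at [p], so [u] could satisfy
   no polynomial relation with an element of nonzero order; but [t], [t - c] or, when [p] is
   trivial on [k(t)], a uniformizer provides such a relation. *)
Lemma residue (HK : function_field_one_var iota) (p : place) u :
  vge p u 0 -> exists c, vge p (u - iota c) 1.
Proof.
move=> hu; apply: contrapT => /forallNP no.
have unit_shift x : vge p x 0 -> (forall c, ~ vge p (x - iota c) 1) ->
    forall c, x - iota c != 0 /\ ord p (x - iota c) = 0.
  move=> hx n c; have := vgeB hx (vgeC p c).
  have [e|xc0] := eqVneq (x - iota c) 0; first by case: (n c); left.
  move=> /(vgeP xc0) ge0; split => //; apply/eqP; rewrite eq_le ge0 andbT.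
  by rewrite leNgt; apply/negP => gt0; apply: (n c); right.
have hu' := unit_shift _ hu no.
case: HK => _ [t [ttr tz]].
have rel z : exists2 Q : {poly {poly k}}, Q != 0 & ev2 iota Q t z = 0.
  have [P [P0 e]] := tz z.
  by have [//|Q Q0 eQ] := ev2_of_kev (a := ord0) (b := ord_max) _ P0 e; exists Q.
have relu : exists2 Q : {poly {poly k}}, Q != 0 & ev2 iota Q u t = 0.
  have [P [P0 e]] := tz u.
  by have [//|Q Q0 eQ] := ev2_of_kev (a := ord_max) (b := ord0) _ P0 e; exists Q.
case: relu => Q Q0 eQ.
have [tneg|tpos] := ltP (ord p t) 0.
  by have := ev2_neq0 Q0 hu' (ltr0_neq0 tneg); rewrite eQ eqxx.
have [[c hc]|/forallNP hn] := pselect (exists c, vge p (t - iota c) 1).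
  (* [R] expresses the same relation in terms of [t - iota c], an element of nonzero order at
     [p]. *)
  pose R := Q \Po ('X + c%:P%:P).
  have R0 : R != 0.
    by rewrite -size_poly_eq0 size_comp_poly2 ?size_poly_eq0 // size_XaddC.
  have eR : ev2 iota R u (t - iota c) = 0.
    rewrite ev2_hornerE /R map_comp_poly horner_comp rmorphD /= map_polyX map_polyC /=.
    rewrite hornerD hornerX hornerC /horner_morph map_polyC hornerC subrK.
    by rewrite -[RHS]eQ ev2_hornerE.
  have tc0 : t - iota c != 0.
    apply/negP => /eqP e; have := ttr ('X - c%:P); rewrite polyXsubC_eq0 => /(_ isT).
    by rewrite rmorphB /= map_polyX map_polyC root_XsubC -subr_eq0 e eqxx.
  have ot : ord p (t - iota c) != 0 by have := vgeP tc0 hc; lia.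
  by have := ev2_neq0 R0 hu' ot; rewrite eR eqxx.
have [pi hpi] := ord_unif p.
have [S S0 eS] := rel pi.
have opi : ord p pi != 0 by rewrite hpi.
by have := ev2_neq0 S0 (unit_shift t (or_intror tpos) hn) opi; rewrite eS eqxx.
Qed.

End Residues.

(** * Riemann's theorem and the product formula *)

Section RiemannRoch.
Variables (k : closedFieldType) (K : fieldType) (iota : {rmorphism k -> K}).
Local Notation place := (place iota).
Implicit Types (p q : place) (D E : place -> int).

Definition kfree (I : finType) (w : I -> K) : Prop :=
  forall c : I -> k, \sum_i iota (c i) * w i = 0 -> forall i, c i = 0.

Lemma kfree_neq0 (I : finType) (w : I -> K) i : kfree w -> w i != 0.
Proof.
move=> fw; apply/eqP => e; have /eqP : (1 : k) = 0; last by rewrite oner_eq0.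
rewrite -[1]/((true : nat)%:R) -(eqxx i); apply: (fw (fun j => (j == i)%:R) _ i).
rewrite (bigD1 i) //= e mulr0 big1 ?addr0 // => j /negPf ->.
by rewrite rmorph0 mul0r.
Qed.

Definition supp_in (T : seq place) (phi : place -> int) : Prop :=
  forall p, p \notin T -> phi p = 0.

Lemma psumE (A : set place) (T : seq place) phi : uniq T -> supp_in T phi ->
  psum A phi = \sum_(p <- T | p \in A) phi p.
Proof.
move=> uT h; rewrite /psum (@bigfs _ _ _ _ T (fun p => p \in A)) //.
  by congr (\big[_/_]_(_ \in _) _); rewrite set_mem_set.
by move=> p _; apply: h.
Qed.

Lemma psumTE (T : seq place) phi : uniq T -> supp_in T phi ->
  psum setT phi = \sum_(p <- T) phi p.
Proof.
move=> uT h; rewrite (psumE setT uT h).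
by apply: eq_bigl => p; rewrite in_setT.
Qed.

Lemma divisor_supp D : divisor D -> exists2 T : seq place, uniq T & supp_in T D.
Proof.
move=> /finite_seqP[s es]; exists (undup s); first exact: undup_uniq.
move=> p; rewrite mem_undup => ps; apply: contrapT => /eqP Dp.
have : [set` s] p by rewrite -es.
by rewrite /= (negPf ps).
Qed.

Lemma supp_divisor (T : seq place) D : supp_in T D -> divisor D.
Proof.
move=> h; apply: (sub_finite_set (B := [set` T])); last exact: finite_seq.
by move=> p /= Dp; apply: contraNT Dp => /h ->.
Qed.

Lemma supp_inW (T T' : seq place) D : {subset T <= T'} -> supp_in T D -> supp_in T' D.
Proof. by move=> s h p pT; apply: h; apply: contra pT; apply: s. Qed.

Lemma common_supp D E : divisor D -> divisor E ->
  exists T : seq place, [/\ uniq T, supp_in T D & supp_in T E].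
Proof.
move=> /divisor_supp[T _ hD] /divisor_supp[T' _ hE].
exists (undup (T ++ T')); split; first exact: undup_uniq.
  by apply: supp_inW hD => p; rewrite mem_undup mem_cat => ->.
by apply: supp_inW hE => p; rewrite mem_undup mem_cat => ->; rewrite orbT.
Qed.

Lemma divisor_op (f : int -> int -> int) D E : f 0 0 = 0 ->
  divisor D -> divisor E -> divisor (fun p => f (D p) (E p)).
Proof.
move=> f0 hD hE; have [T [_ h1 h2]] := common_supp hD hE.
by apply: (@supp_divisor T) => p pT; rewrite h1 // h2.
Qed.

Lemma degD D E : divisor D -> divisor E -> deg (fun p => D p + E p) = deg D + deg E.
Proof.
move=> hD hE; have [T [uT h1 h2]] := common_supp hD hE.
rewrite /deg !(psumTE uT) // ?big_split //.
by move=> p pT; rewrite h1 // h2.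
Qed.

Lemma degN D : divisor D -> deg (fun p => - D p) = - deg D.
Proof.
move=> /divisor_supp[T uT hT]; rewrite /deg !(psumTE uT) // ?sumrN //.
by move=> p pT; rewrite hT // oppr0.
Qed.

Lemma deg_le D E : divisor D -> divisor E -> (forall p, D p <= E p) -> deg D <= deg E.
Proof.
move=> hD hE le; have [T [uT h1 h2]] := common_supp hD hE.
by rewrite /deg !(psumTE uT) //; apply: ler_sum => p _.
Qed.

Definition dseq (s : seq place) : place -> int := fun p => (count_mem p s)%:Z.

Lemma dseq_divisor s : divisor (dseq s).
Proof.
apply: (@supp_divisor s) => p ps; apply/eqP; rewrite eqz_nat.
by apply/eqP/count_memPn.
Qed.

Lemma deg_dseq s : deg (dseq s) = (size s)%:Z.
Proof.
have h : supp_in (undup s) (dseq s).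
  move=> p; rewrite mem_undup => ps; apply/eqP; rewrite eqz_nat.
  by apply/eqP/count_memPn.
rewrite /deg (psumTE (undup_uniq s) h) /dseq.
rewrite -(big_morph Posz PoszD (erefl (Posz 0))); congr Posz.
rewrite -[RHS](perm_size (perm_count_undup s)) size_flatten /shape -map_comp.
by rewrite sumnE big_map; apply: eq_bigr => p _; rewrite /= size_nseq.
Qed.

(** As a list of points, an effective divisor can be removed one point at a time in dimension
    estimates. *)
Lemma effective_dseq E : divisor E -> (forall p, 0 <= E p) ->
  exists2 s, E = dseq s & deg E = (size s)%:Z.
Proof.
move=> /divisor_supp[T uT hT] pos.
pose s := flatten [seq nseq (absz (E p)) p | p <- T].
have es : E = dseq s.
  apply/funext => p; rewrite /dseq /s count_flatten -map_comp sumnE big_map.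
  rewrite -[LHS]gez0_abs //; congr Posz.
  have [pT|pT] := boolP (p \in T).
    rewrite (bigD1_seq p) //= count_nseq /= eqxx mul1n big1 ?addn0 // => q qp.
    by rewrite /= count_nseq /= (negPf qp).
  rewrite hT // big1_seq // => q /andP[_ qT] /=.
  by rewrite count_nseq /=; case: eqP => // e; rewrite -e qT in pT.
by exists s => //; rewrite es deg_dseq.
Qed.

Lemma in_LDP D f : in_LD D f <-> forall p, vge p f (- D p).
Proof.
split=> [[->|h] p|h]; first by left.
  by right; have := h p; lia.
have [->|f0] := eqVneq f 0; first by left.
by right=> p; have := vgeP f0 (h p); lia.
Qed.

Lemma kfree_inj (I J : finType) (w : I -> K) (f : J -> I) :
  injective f -> kfree w -> kfree (w \o f).
Proof.
move=> finj fw c e j0.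
pose c' i := \sum_(j | f j == i) c j.
have c'f j : c' (f j) = c j.
  by rewrite /c' (big_pred1 j) // => j'; rewrite (inj_eq finj).
rewrite -c'f; apply: fw; rewrite -[RHS]e [RHS](partition_big f xpredT) //=.
apply: eq_bigr => i _; rewrite /c' rmorph_sum mulr_suml.
by apply: eq_bigr => j /eqP ->.
Qed.

Lemma ldim_geW D N N' : (N' <= N)%N -> ldim_ge D N -> ldim_ge D N'.
Proof.
move=> le [s [hs fs]]; exists (s \o widen_ord le); split=> [i|]; first exact: hs.
apply: (@kfree_inj _ _ s (widen_ord le)) => // i j /(congr1 val) /= e.
exact: val_inj.
Qed.

Lemma ldim_ge_mono D E N : (forall p, D p <= E p) -> ldim_ge D N -> ldim_ge E N.
Proof.
move=> le [s [hs fs]]; exists s; split=> // i; apply/in_LDP => p.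
by move/in_LDP: (hs i) => /(_ p); apply: vgeW; rewrite lerN2.
Qed.

Lemma ldim_ge0 D : ldim_ge D 0.
Proof. by exists (fun=> 0); split=> [[]|c _ []]. Qed.

Lemma ldim_exists D N : ~ ldim_ge D N -> exists N', ldim D N'.
Proof.
elim: N => [|N IHN] h; first by case: h; apply: ldim_ge0.
have [h'|] := pselect (ldim_ge D N); last exact: IHN.
by exists N; split.
Qed.

Lemma ldim_ge_mul D (h : K) N : h != 0 -> ldim_ge D N ->
  ldim_ge (fun p => D p - ord p h) N.
Proof.
move=> h0 [s [hs fs]]; exists (fun i => h * s i); split=> [i|c e i].
  apply/in_LDP => p; rewrite opprB addrC.
  rewrite addrC; apply: vgeM; first exact: vge_ord.
  by move/in_LDP: (hs i); apply.
apply: fs; apply: (mulfI h0); rewrite mulr0 -[RHS]e mulr_sumr.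
by apply: eq_bigr => j _; rewrite mulrCA.
Qed.

Section FunctionField.
Hypothesis HK : function_field_one_var iota.

(** If some [s i0] really has the extra pole at [p], then by [residue] the leading coefficients of
    the others, relative to it, are constants of [k]. Subtracting constant multiples of [s i0]
    brings them back into L(D), at the cost of one dimension. *)
Lemma ldim_ge_step D p N :
  ldim_ge (fun q => D q + (p == q)%:Z) N.+1 -> ldim_ge D N.
Proof.
move=> [s [/(_ _)/in_LDP hs fs]].
have off i q : p != q -> vge q (s i) (- D q).
  by move=> /negPf pq; have := hs i q; rewrite pq addr0.
have [[i0 hi0]|/forallNP all] := pselect (exists i, ~ vge p (s i) (- D p)); last first.
  exists (s \o lift ord0); split=> [i|]; last exact: kfree_inj (@lift_inj _ _) fs.
  apply/in_LDP => q; have [<-|/off h] := eqVneq p q; last exact: h.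
  by apply: contrapT; apply: all.
have s0 : s i0 != 0 by apply/eqP => e; apply: hi0; left.
have os0 : ord p (s i0) = - D p - 1.
  have := vgeP s0 (hs i0 p); rewrite eqxx => h1.
  have h2 : ~ (- D p <= ord p (s i0)) by move=> h; apply: hi0; right.
  lia.
have /choice[c hc] i : exists c, vge p (s i / s i0 - iota c) 1.
  apply: (residue HK).
  have -> : 0 = ord p (s i0) + ord p (s i0)^-1 by rewrite ordV subrr.
  apply: vgeM; last exact: vge_ord.
  by apply: vgeW (hs i p); rewrite os0 eqxx; lia.
exists (fun j => s (lift i0 j) - iota (c (lift i0 j)) * s i0); split=> [j|a e j].
  apply/in_LDP => q; have [<-|pq] := eqVneq p q; last first.
    by apply: vgeB; [apply: off | apply: vgeMl; [apply: vgeC | apply: off]].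
  have -> : s (lift i0 j) - iota (c (lift i0 j)) * s i0 =
      (s (lift i0 j) / s i0 - iota (c (lift i0 j))) * s i0.
    by rewrite mulrBl divfK.
  have -> : - D p = 1 + ord p (s i0) by rewrite os0; lia.
  by apply: vgeM; [apply: hc | apply: vge_ord].
pose a' i := if unlift i0 i is Some j then a j else - \sum_j a j * c (lift i0 j).
suff : a' (lift i0 j) = 0 by rewrite /a' liftK.
apply: fs; rewrite (bigD1_ord i0) //= /a' unlift_none rmorphN rmorph_sum mulNr.
under [X in _ + X]eq_bigr do rewrite liftK.
rewrite addrC mulr_suml -sumrB -[RHS]e; apply: eq_bigr => i _.
by rewrite rmorphM mulrBr mulrA.
Qed.

Lemma ldim_ge_dseq D s N :
  ldim_ge (fun q => D q + dseq s q) (N + size s) -> ldim_ge D N.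
Proof.
elim: s D N => [|p s IHs] D N /=.
  by rewrite addn0; apply: ldim_ge_mono => q; rewrite /dseq /= addr0.
rewrite addnS => h; apply: (IHs D N); apply: (ldim_ge_step (p := p)).
by apply: ldim_ge_mono h => q; rewrite /dseq /=; lia.
Qed.

Variables (genus : nat).
Hypothesis Hgenus : is_genus iota genus.

(** L(D) embeds into L(D0 + s), where [D0] attains the genus, and so has a finite dimension, and
    each point of [s] adds at most one. *)
Lemma ldim_finite D : divisor D -> exists N, ldim D N.
Proof.
move=> hD; have [_ [D0 [N0 [hD0 [_ n0] _]]]] := Hgenus.
have hE : divisor (fun p => Num.max 0 (D p - D0 p)).
  by apply: (divisor_op (f := fun x y => Num.max 0 (x - y))).
have [|s es _] := effective_dseq hE; first by move=> p; rewrite le_max lexx.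
apply: (@ldim_exists _ (N0.+1 + size s)) => h; apply: n0.
apply: (@ldim_ge_dseq _ s); apply: ldim_ge_mono h => p; rewrite -es.
by rewrite -lerBlDl le_max lexx orbT.
Qed.

(** [is_genus] speaks only of exact dimensions, so [ldim_finite] has to provide one first. *)
Lemma riemann D N : divisor D -> N%:Z <= deg D + 1 - genus%:Z -> ldim_ge D N.
Proof.
move=> hD le; have [N' hN'] := ldim_finite hD.
have [/(_ D N' hD hN') h _] := Hgenus.
by apply: ldim_geW (proj1 hN'); lia.
Qed.

(* [D0] is a divisor attaining the maximum in the definition of the genus. *)
Lemma riemann_eq : exists2 D0 : place -> int, divisor D0 &
  forall D, divisor D -> (forall p, D0 p <= D p) ->
    0 <= deg D + 1 - genus%:Z /\
    forall N, ldim_ge D N -> N%:Z <= deg D + 1 - genus%:Z.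
Proof.
have [_ [D0 [N0 [hD0 [h0 n0] e]]]] := Hgenus.
exists D0 => // D hD le.
have hE : divisor (fun p => D p - D0 p).
  by apply: (divisor_op (f := fun x y => x - y) _ hD hD0); rewrite subrr.
have [|s es degs] := effective_dseq hE; first by move=> p; rewrite subr_ge0.
have degE : deg D = deg D0 + (size s)%:Z.
  have -> : D = fun p => D0 p + dseq s p.
    by apply/funext => p; rewrite -es; lia.
  by rewrite degD ?deg_dseq //; apply: dseq_divisor.
have eN : deg D + 1 - genus%:Z = (N0 + size s)%:Z by lia.
rewrite eN; split=> // N hN; rewrite leNgt; apply/negP => lt; apply: n0.
apply: (@ldim_ge_dseq _ s); apply: ldim_ge_mono (ldim_geW (N' := N0.+1 + size s) _ hN).
  by move=> p; rewrite -es; lia.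
by lia.
Qed.

(* Multiplication by [h] embeds L(D0 + D^-) into L(D0 + D^+), two spaces of known dimension. *)
Lemma deg_ge0 D (h : K) : divisor D -> h != 0 -> in_LD D h -> 0 <= deg D.
Proof.
move=> hD h0 /in_LDP hh; have [D0 hD0 eq0] := riemann_eq.
pose Dm p := Num.max 0 (- D p).
pose Dp p := Num.max 0 (D p).
have hDm : divisor Dm by apply: (divisor_op (f := fun x y => Num.max 0 (- x)) _ hD hD).
have hDp : divisor Dp by apply: (divisor_op (f := fun x y => Num.max 0 x) _ hD hD).
have hA : divisor (fun p => D0 p + Dm p) by apply: divisor_op.
have hB : divisor (fun p => D0 p + Dp p) by apply: divisor_op.
have [|posA _] := eq0 _ hA; first by move=> p; rewrite /Dm; lia.
have [|_ leB] := eq0 _ hB; first by move=> p; rewrite /Dp; lia.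
have eN := gez0_abs posA.
have := riemann (N := absz (deg (fun p => D0 p + Dm p) + 1 - genus%:Z)%R) hA.
rewrite eN => /(_ (lexx _)) /(ldim_ge_mul h0) hl.
have /leB : ldim_ge (fun p => D0 p + Dp p)
    (absz (deg (fun p => D0 p + Dm p) + 1 - genus%:Z)%R).
  apply: ldim_ge_mono hl => p; have := vgeP h0 (hh p); rewrite /Dm /Dp.
  by lia.
rewrite eN !degD //.
have -> : D = fun p => Dp p - Dm p by apply/funext => p; rewrite /Dp /Dm; lia.
rewrite degD ?degN //; first by lia.
by apply: (divisor_op (f := fun x y => - x) _ hDm hDm).
Qed.

End FunctionField.
End RiemannRoch.

(** * Finiteness of zeros and poles, and the product formula *)

Section ProductFormula.
Variables (k : closedFieldType) (K : fieldType) (iota : {rmorphism k -> K}).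
Local Notation place := (place iota).
Implicit Types (p : place) (D E : place -> int).

Lemma pev_neq0 x q : ~ is_const iota x -> q != 0 -> pev iota q x != 0.
Proof.
move=> nx q0; have [r ->] := closed_field_poly_normal q.
rewrite /pev map_polyZ hornerZ rmorph_prod horner_prod.
rewrite mulf_neq0 ?fmorph_eq0 ?lead_coef_eq0 // prodf_seq_neq0.
apply/allP => c _ /=.
rewrite rmorphB /= map_polyX map_polyC hornerXsubC subr_eq0.
by apply/eqP => e; apply: nx; exists c.
Qed.

Hypothesis HK : function_field_one_var iota.
Variables (genus : nat).
Hypothesis Hgenus : is_genus iota genus.

(** A place is an abstract valuation, so finiteness of the set of poles has to be proved. The
    elements with this property form a subring, which [finpoles] shows to be all of [K]. *)
Definition finpole (x : K) : Prop := finite_set [set p : place | ord p x < 0].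

Lemma finpoleP x : finpole x <-> exists s : seq place, forall p, p \notin s -> vge p x 0.
Proof.
split=> [/finite_seqP[s es]|[s hs]].
  exists s => p ps; right; rewrite leNgt; apply/negP => neg.
  by have : [set p : place | ord p x < 0] p by []; rewrite es /= (negPf ps).
apply: (sub_finite_set (B := [set` s])); last exact: finite_seq.
move=> p /= neg; rewrite -[is_true _]/(is_true (p \in s)); apply: contraTT neg => /hs.
by rewrite -leNgt => -[->|//]; rewrite ord_0.
Qed.

Lemma finpole0 : finpole 0.
Proof. by apply/finpoleP; exists [::] => p _; left. Qed.

Lemma finpoleC c : finpole (iota c).
Proof. by apply/finpoleP; exists [::] => p _; apply: vgeC. Qed.

Lemma finpoleD x y : finpole x -> finpole y -> finpole (x + y).
Proof.
move=> /finpoleP[s hs] /finpoleP[s' hs']; apply/finpoleP; exists (s ++ s') => p.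
by rewrite mem_cat negb_or => /andP[/hs h1 /hs' h2]; apply: vgeD.
Qed.

Lemma finpoleM x y : finpole x -> finpole y -> finpole (x * y).
Proof.
move=> /finpoleP[s hs] /finpoleP[s' hs']; apply/finpoleP; exists (s ++ s') => p.
by rewrite mem_cat negb_or => /andP[/hs h1 /hs' h2]; apply: vgeMl.
Qed.

Lemma finpole_sum (I : Type) (s : seq I) (F : I -> K) :
  (forall i, finpole (F i)) -> finpole (\sum_(i <- s) F i).
Proof.
move=> h; apply: (big_ind finpole) => //; first exact: finpole0.
exact: finpoleD.
Qed.

Lemma finpoleX x n : finpole x -> finpole (x ^+ n).
Proof.
move=> h; elim: n => [|n IHn]; first by rewrite expr0 -(rmorph1 iota); apply: finpoleC.
by rewrite exprS; apply: finpoleM.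
Qed.

Lemma finpole_pev q x : finpole x -> finpole (pev iota q x).
Proof.
move=> h; rewrite pevE; apply: finpole_sum => i.
by apply: finpoleM; [apply: finpoleC | apply: finpoleX].
Qed.

(* Subtracting sufficiently many zeros of [x] from its polar divisor makes the degree negative. *)
Lemma finpoleV x : finpole x -> finpole x^-1.
Proof.
have [->|x0] := eqVneq x 0; first by rewrite invr0.
move=> /finpoleP[s hs].
pose D p := Num.max 0 (- ord p x).
have hD : divisor D.
  apply: (@supp_divisor _ _ _ s) => p /hs/(vgeP x0); rewrite /D; lia.
apply: contrapT => inf.
have [B subB leB] := infinite_set_fset (absz (deg D)).+1 inf.
pose E p := if p \in B then -1 else 0 : int.
have hE : divisor (fun p => - E p).
  by apply: (@supp_divisor _ _ _ (enum_fset B)) => p; rewrite /E => /negPf; rewrite -[_ \in _]/(p \in B) => ->.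
have hE' : divisor E.
  by apply: (@supp_divisor _ _ _ (enum_fset B)) => p; rewrite /E => /negPf; rewrite -[_ \in _]/(p \in B) => ->.
have degE : deg E = - (#|` B|)%:Z.
  have sE : supp_in (enum_fset B) E.
    by move=> p; rewrite /E => /negPf; rewrite -[_ \in _]/(p \in B) => ->.
  rewrite /deg (psumTE (fset_uniq B) sE) (eq_big_seq (fun=> -1)).
    by rewrite big_const_seq count_predT iter_addr_0 mulNrn natz.
  by move=> p; rewrite -[_ \in _]/(p \in B) /E => ->.
have hDE : divisor (fun p => D p + E p) by apply: divisor_op.
have hin : in_LD (fun p => D p + E p) x.
  apply/in_LDP => p; right; rewrite /D /E.
  case: ifP => pB; last by lia.
  by have := subB p pB; rewrite /= ordV; lia.
have := deg_ge0 HK Hgenus hDE x0 hin.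
by rewrite degD // degE; lia.
Qed.

(** Away from the poles of the coefficients divided by the leading one, [y] is integral over the
    valuation ring and so has no pole. *)
Lemma finpole_root (Q : {poly K}) y :
  Q != 0 -> (forall i, finpole Q`_i) -> root Q y -> finpole y.
Proof.
move=> Q0 hQ ry.
have lc0 : lead_coef Q != 0 by rewrite lead_coef_eq0.
have hb i : finpole (Q`_i / lead_coef Q) by apply: finpoleM; [|apply: finpoleV]; apply: hQ.
have /choice[s hs] (i : nat) : exists s : seq place,
    forall p, p \notin s -> vge p (Q`_i / lead_coef Q) 0 by exact/finpoleP.
apply/finpoleP; exists (flatten [seq s i | i <- seq.iota 0 (size Q)]) => p ps.
have hp i : (i < size Q)%N -> vge p (Q`_i / lead_coef Q) 0.
  move=> lt; apply: hs; apply: contra ps => h; apply/flattenP; exists (s i) => //.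
  by apply/mapP; exists i => //; rewrite mem_iota.
have [->|y0] := eqVneq y 0; first by left.
right; rewrite leNgt; apply/negP => neg.
have [n szQ] : exists n, size Q = n.+2.
  have : (1 < size Q)%N by apply: root_size_gt1 ry.
  by case: (size Q) => [|[|n]] // _; exists n.
have e : y ^+ n.+1 = - \sum_(i < n.+1) (Q`_i / lead_coef Q) * y ^+ i.
  apply/eqP; rewrite -addr_eq0 addrC; apply/eqP.
  have : Q.[y] / lead_coef Q = 0 by rewrite (rootP ry) mul0r.
  rewrite horner_coef mulr_suml szQ big_ord_recr /= => h; rewrite -[RHS]h.
  congr (_ + _); first by apply: eq_bigr => i _; rewrite mulrAC.
  by rewrite mulrAC lead_coefE szQ divff ?mul1r // -[n.+1]/(n.+2.-1) -szQ -lead_coefE.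
(* At a pole of [y] the lower terms have order at least [n] times that of [y], which is more than
   the order of [y ^+ n.+1]. *)
have : vge p (y ^+ n.+1) (ord p y *+ n).
  rewrite e; apply: vgeN; apply: vge_sum => i _; apply: vgeMl.
    by apply: hp; rewrite szQ ltnS ltnW.
  right; rewrite ordX -[_ *+ i]mulr_natr -[_ *+ n]mulr_natr !natz.
  by rewrite ler_nM2l // lez_nat -ltnS.
move/(vgeP (expf_neq0 _ y0)); rewrite ordX mulrS; lia.
Qed.

(** By Riemann's inequality L((genus + 1) p) has dimension at least 2, so not all its elements are
    constants; their only possible pole is [p]. *)
Lemma exists_nonconst_finpole p : exists2 x, finpole x & ~ is_const iota x.
Proof.
pose D := dseq (nseq genus.+1 p).
have hD : divisor D := dseq_divisor _.
have [|s [hs fs]] := riemann HK Hgenus (N := 2) hD.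
  by rewrite deg_dseq size_nseq; lia.
have fin i : finpole (s i).
  have /in_LDP h := hs i; apply/finpoleP; exists [:: p] => q; rewrite inE => qp.
  apply: vgeW (h q); rewrite /D /dseq count_nseq /= eq_sym (negPf qp); lia.
have [|/contrapT[a ea]] := pselect (~ is_const iota (s ord0)); first by exists (s ord0).
have [|/contrapT[b eb]] := pselect (~ is_const iota (s ord_max)); first by exists (s ord_max).
pose c (i : 'I_2) := if i == ord0 then b else - a.
have c0 : forall i, c i = 0.
  apply: fs; rewrite big_ord_recl big_ord1 /c /=.
  have -> : lift ord0 ord0 = ord_max :> 'I_2 by apply: val_inj.
  by rewrite ea eb rmorphN -!rmorphM mulNr -rmorphM -rmorphB mulrC subrr rmorph0.
have a0 : a = 0 by apply/eqP; rewrite -oppr_eq0; apply/eqP; exact: (c0 ord_max).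
have : (1 : k) = 0.
  pose c1 (i : 'I_2) := if i == ord0 then 1 else 0 : k.
  apply: (fs c1 _ ord0); rewrite big_ord_recl big_ord1 /c1 /= ea a0.
  by rewrite rmorph0 mulr0 mul0r addr0.
by move/eqP; rewrite oner_eq0.
Qed.

(** From a nonconstant [x] with finitely many poles the property passes to [t], algebraic over k(x),
    and then to [z], algebraic over k(t), each time by [finpole_root]. *)
Lemma finpoles z : finpole z.
Proof.
have [[p0 _]|np] := pselect (exists p : place, True); last first.
  by apply/finpoleP; exists [::] => p _; case: np; exists p.
have [x fx nx] := exists_nonconst_finpole p0.
have [_ [t [ttr tz]]] := HK.
have step u v (Q : {poly {poly k}}) : Q != 0 -> (forall i, finpole (pev iota Q`_i u)) ->
    (forall q, q != 0 -> pev iota q u != 0) -> ev2 iota Q u v = 0 -> finpole v.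
  move=> Q0 hu nz e; pose R := \poly_(i < size Q) pev iota Q`_i u.
  have szR : size R = size Q.
    by rewrite size_poly_eq // nz // -/(lead_coef Q) lead_coef_eq0.
  apply: (@finpole_root R).
  - by rewrite -size_poly_eq0 szR size_poly_eq0.
  - by move=> i; rewrite coef_poly; case: ifP => _; [apply: hu | apply: finpole0].
  - apply/rootP; rewrite horner_coef szR -[RHS]e; apply: eq_bigr => i _.
    by rewrite coef_poly ltn_ord.
have ft : finpole t.
  have [P [P0 e]] := tz x.
  have [//|Q Q0 eQ] := ev2_of_kev (a := ord_max) (b := ord0) _ P0 e.
  by apply: (step x t Q Q0 _ _ eQ) => [i|q]; [apply: finpole_pev | apply: pev_neq0].
have [P [P0 e]] := tz z.
have [//|Q Q0 eQ] := ev2_of_kev (a := ord0) (b := ord_max) _ P0 e.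
apply: (step t z Q Q0 _ _ eQ) => [i|q]; first exact: finpole_pev.
by move/ttr; rewrite /root /pev.
Qed.

Lemma divisor_ord x : divisor (fun p : place => ord p x).
Proof.
have [s hs] := (finpoleP x).1 (finpoles x).
have [s' hs'] := (finpoleP x^-1).1 (finpoles x^-1).
have [->|x0] := eqVneq x 0.
  by apply: (@supp_divisor _ _ _ [::]) => p _; rewrite ord_0.
have xV0 : x^-1 != 0 by rewrite invr_eq0.
apply: (@supp_divisor _ _ _ (s ++ s')) => p; rewrite mem_cat negb_or.
by move=> /andP[/hs/(vgeP x0) h1 /hs'/(vgeP xV0)]; rewrite ordV; lia.
Qed.

(** [x^-1] lies in L(div x) and [x] in L(- div x), so by [deg_ge0] neither degree is negative. *)
Lemma deg_ord x : deg (fun p : place => ord p x) = 0.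
Proof.
have [->|x0] := eqVneq x 0.
  rewrite /deg (@psumTE _ _ _ [::]) ?big_nil // => p _; exact: ord_0.
have xV0 : x^-1 != 0 by rewrite invr_eq0.
have h1 : 0 <= deg (fun p : place => ord p x).
  have -> : (fun p : place => ord p x) = (fun p => - ord p x^-1).
    by apply/funext => p; rewrite ordV opprK.
  apply: (deg_ge0 HK Hgenus _ xV0).
    by apply: (divisor_op (f := fun a b => - a) _ (divisor_ord x^-1) (divisor_ord x)).
  by apply/in_LDP => p; rewrite opprK; apply: vge_ord.
have h2 : 0 <= deg (fun p : place => - ord p x).
  apply: (deg_ge0 HK Hgenus _ x0).
    by apply: (divisor_op (f := fun a b => - a) _ (divisor_ord x) (divisor_ord x)).
  by apply/in_LDP => p; rewrite opprK; apply: vge_ord.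
by move: h2; rewrite degN ?oppr_ge0; [move=> h2; apply/eqP; rewrite eq_le h1 h2 | apply: divisor_ord].
Qed.

(** Without places every function would lie in L(0), which has finite dimension, whereas the powers
    of the transcendental [t] are independent. *)
Lemma place_exists : exists p : place, True.
Proof.
apply: contrapT => np; have noP (p : place) : False by apply: np; exists p.
have h0 : divisor (fun _ : place => 0 : int) by apply: (@supp_divisor _ _ iota [::]) => p.
have [N [_]] := ldim_finite HK Hgenus h0; apply.
have [_ [t [ttr _]]] := HK.
exists (fun i => t ^+ i); split=> [i|c e i]; first by right => p; case: (noP p).
pose q := \poly_(i < N.+1) oapp c 0 (insub i).
have : pev iota q t = 0.
  rewrite /pev (@horner_coef_wide _ N.+1); last by rewrite size_map_poly size_poly.
  rewrite -[RHS]e; apply: eq_bigr => j _; rewrite coef_map /= coef_poly ltn_ord.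
  by rewrite valK.
move=> e0; have q0 : q = 0.
  by apply/eqP; apply: contraTT isT => /ttr; rewrite /root -/(pev iota q t) e0 eqxx.
have : q`_i = 0 by rewrite q0 coef0.
by rewrite coef_poly ltn_ord valK.
Qed.

(** Subtracting the residue at one place gives a function with a zero and no poles; by [deg_ge0] it
    must be 0. *)
Lemma ord_ge0_const x : (forall p : place, 0 <= ord p x) -> is_const iota x.
Proof.
move=> hx; have [p _] := place_exists.
have [c hc] := residue HK (or_intror (hx p) : vge p x 0).
have [/eqP|x0] := eqVneq (x - iota c) 0; first by rewrite subr_eq0 => /eqP ->; exists c.
have hD : divisor (fun q => - dseq [:: p] q).
  by apply: (divisor_op (f := fun a b => - a) _ (dseq_divisor _) (dseq_divisor [::])).
have hin : in_LD (fun q => - dseq [:: p] q) (x - iota c).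
  apply/in_LDP => q; rewrite opprK /dseq /= addn0.
  have [<-|_] := eqVneq p q; first by [].
  by apply: vgeB; [right; apply: hx | apply: vgeC].
have := deg_ge0 HK Hgenus hD x0 hin.
by rewrite degN ?deg_dseq //; apply: dseq_divisor.
Qed.

End ProductFormula.

(** * Degrees of divisors and heights *)

Section Heights.
Variables (k : closedFieldType) (K : fieldType) (iota : {rmorphism k -> K}).
Local Notation place := (place iota).
Implicit Types (p : place) (D E : place -> int).

Lemma divisorD D E : divisor D -> divisor E -> divisor (fun p => D p + E p).
Proof. by apply: divisor_op. Qed.

Lemma divisor_comp (f : int -> int) D : f 0 = 0 -> divisor D -> divisor (fun p => f (D p)).
Proof. by move=> f0 h; apply: (divisor_op (f := fun a _ => f a) f0 h h). Qed.

Lemma divisorN D : divisor D -> divisor (fun p => - D p).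
Proof. exact: divisor_comp. Qed.

Lemma divisorZ n D : divisor D -> divisor (fun p => n * D p).
Proof. by apply: divisor_comp; rewrite mulr0. Qed.

Lemma divisor0 : divisor (fun _ : place => 0).
Proof. by apply: (@supp_divisor _ _ _ [::]) => p. Qed.

Lemma divisor_sum (I : Type) (s : seq I) (F : I -> place -> int) :
  (forall i, divisor (F i)) -> divisor (fun p => \sum_(i <- s) F i p).
Proof.
move=> h; elim: s => [|i s IHs].
  have -> : (fun p => \sum_(i <- [::]) F i p) = fun=> 0.
    by apply/funext => p; rewrite big_nil.
  exact: divisor0.
have -> : (fun p => \sum_(j <- i :: s) F j p) = fun p => F i p + \sum_(j <- s) F j p.
  by apply/funext => p; rewrite big_cons.
exact: divisorD.
Qed.

Lemma degZ n D : divisor D -> deg (fun p => n * D p) = n * deg D.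
Proof.
move=> /divisor_supp[T uT hT]; rewrite /deg !(psumTE uT) ?mulr_sumr //.
by move=> p pT; rewrite hT ?mulr0.
Qed.

Lemma deg0 : deg (fun _ : place => 0) = 0.
Proof. by rewrite /deg (@psumTE _ _ _ [::]) ?big_nil. Qed.

Lemma degB D E : divisor D -> divisor E -> deg (fun p => D p - E p) = deg D - deg E.
Proof. by move=> hD hE; rewrite degD ?degN //; apply: divisorN. Qed.

Lemma deg_sum (I : Type) (s : seq I) (F : I -> place -> int) :
  (forall i, divisor (F i)) -> deg (fun p => \sum_(i <- s) F i p) = \sum_(i <- s) deg (F i).
Proof.
move=> h; elim: s => [|i s IHs].
  rewrite big_nil -[RHS]deg0; congr deg.
  by apply/funext => p; rewrite big_nil.
rewrite big_cons -IHs -degD //; last exact: divisor_sum.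
by congr deg; apply/funext => p; rewrite big_cons.
Qed.

Lemma deg_nneg D : divisor D -> (forall p, 0 <= D p) -> 0 <= deg D.
Proof. by move=> hD pos; rewrite -deg0; apply: deg_le => //; apply: divisor0. Qed.

Lemma vpos_ge0 a : 0 <= vpos a. Proof. by rewrite /vpos; lia. Qed.

Lemma divisor_vpos D : divisor D -> divisor (fun p => vpos (D p)).
Proof. exact: divisor_comp. Qed.

Hypothesis HK : function_field_one_var iota.
Variables (genus : nat).
Hypothesis Hgenus : is_genus iota genus.
Local Notation divisor_ord := (divisor_ord HK Hgenus).

Lemma divisor_pole x : divisor (fun p => vpos (- ord p x)).
Proof. by apply: divisor_vpos; apply: divisorN; apply: divisor_ord. Qed.

Lemma height_ge0 x : 0 <= height iota x.
Proof. by apply: deg_nneg (divisor_pole x) _ => p; apply: vpos_ge0. Qed.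

Lemma height_zeros x : deg (fun p : place => vpos (ord p x)) = height iota x.
Proof.
apply/eqP; rewrite -subr_eq0 -degB; last exact: divisor_pole.
  rewrite -[X in _ == X](deg_ord HK Hgenus x); apply/eqP; congr deg.
  by apply/funext => p; rewrite /vpos; lia.
by apply: divisor_vpos; apply: divisor_ord.
Qed.

Lemma heightX x n : height iota (x ^+ n) = n%:Z * height iota x.
Proof.
rewrite -[RHS]degZ; last exact: divisor_pole.
congr deg; apply/funext => p; rewrite ordX -mulr_natl natz /vpos.
by rewrite maxr_pMr // mulr0 mulrN.
Qed.

Lemma heightM x y : x != 0 -> y != 0 -> height iota (x * y) <= height iota x + height iota y.
Proof.
move=> x0 y0; rewrite -degD; try exact: divisor_pole.
apply: deg_le => [||p]; first exact: divisor_pole.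
  by apply: divisorD; apply: divisor_pole.
by rewrite ordM // /vpos; lia.
Qed.

Lemma height_lt1 x : height iota x < 1 -> is_const iota x.
Proof.
move=> h; have h0 : height iota x = 0 by have := height_ge0 x; lia.
apply: (ord_ge0_const HK Hgenus) => p; rewrite leNgt; apply/negP => neg.
have : deg (dseq [:: p]) <= height iota x.
  apply: deg_le => [||q]; first exact: dseq_divisor.
    exact: divisor_pole.
  by rewrite /dseq /= /vpos; have [<-|_] := eqVneq p q; lia.
by rewrite deg_dseq h0.
Qed.

End Heights.

(** * Derivations *)

Section Derivations.
Variables (k : closedFieldType) (Hk : [pchar k] =i pred0).
Variables (K : fieldType) (iota : {rmorphism k -> K}).

Lemma natrK_neq0 n : n.+1%:R != 0 :> K.
Proof.
rewrite -(rmorph_nat iota) fmorph_eq0.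
by have /pcharf0P -> := Hk.
Qed.

Lemma size_deriv_char0 (R : idomainType) (p : {poly R}) :
  (forall n, n.+1%:R != 0 :> R) -> size p^`() = (size p).-1.
Proof.
move=> h0; rewrite /deriv; case sp: (size p).-1 => [|n].
  by rewrite /deriv poly_def big_ord0 size_poly0.
rewrite size_poly_eq // -mulr_natr mulf_neq0 ?h0 //.
by rewrite -sp -lead_coefE lead_coef_eq0 -size_poly_eq0; case: (size p) sp.
Qed.

(** Subfields are predicates on [K], so that a derivation can be extended one generator at a time
    without changing the ambient field. *)
Definition subfield (S : K -> Prop) : Prop :=
  [/\ S 1, forall x y, S x -> S y -> S (x - y),
      forall x y, S x -> S y -> S (x * y) & forall x, S x -> S x^-1].

Definition der_on (S : K -> Prop) (D : K -> K) : Prop :=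
  [/\ forall c, S (iota c) /\ D (iota c) = 0,
      forall x y, S x -> S y -> D (x + y) = D x + D y
    & forall x y, S x -> S y -> D (x * y) = D x * y + x * D y].

Section Extension.
Variables (S : K -> Prop) (D : K -> K).
Hypotheses (hS : subfield S) (hD : der_on S D).

Let S1 : S 1. Proof. by case: hS. Qed.
Let SB x y : S x -> S y -> S (x - y). Proof. by case: hS => _ + _ _; apply. Qed.
Let SM x y : S x -> S y -> S (x * y). Proof. by case: hS => _ _ + _; apply. Qed.
Let SV x : S x -> S x^-1. Proof. by case: hS => _ _ _; apply. Qed.
Let S0 : S 0. Proof. by rewrite -(subrr 1); apply: SB. Qed.
Let SN x : S x -> S (- x). Proof. by rewrite -sub0r; apply: SB. Qed.
Let SD x y : S x -> S y -> S (x + y).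
Proof. by move=> hx hy; rewrite -[y]opprK; apply: SB => //; apply: SN. Qed.
Let Ssum (I : Type) (s : seq I) (F : I -> K) : (forall i, S (F i)) -> S (\sum_(i <- s) F i).
Proof. by move=> h; apply: big_ind. Qed.
Let DD x y : S x -> S y -> D (x + y) = D x + D y. Proof. by case: hD => _ + _; apply. Qed.
Let DM x y : S x -> S y -> D (x * y) = D x * y + x * D y. Proof. by case: hD => _ _; apply. Qed.
Let D0 : D 0 = 0. Proof. by case: hD => /(_ 0) + _ _; rewrite rmorph0 => -[]. Qed.
Let D1 : D 1 = 0. Proof. by case: hD => /(_ 1) + _ _; rewrite rmorph1 => -[]. Qed.
Let DN x : S x -> D (- x) = - D x.
Proof.
move=> h; apply/eqP; rewrite -addr_eq0 -DD //; last exact: SN.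
by rewrite addNr D0.
Qed.
Let Dsum (I : Type) (s : seq I) (F : I -> K) : (forall i, S (F i)) ->
  D (\sum_(i <- s) F i) = \sum_(i <- s) D (F i).
Proof.
move=> h; elim: s => [|i s IHs]; first by rewrite !big_nil.
by rewrite !big_cons DD ?IHs //; apply: Ssum.
Qed.

Definition poly_on (q : {poly K}) : Prop := forall i, S q`_i.

Let pC c : S c -> poly_on c%:P.
Proof. by move=> h i; rewrite coefC; case: ifP. Qed.
Let pX : poly_on 'X.
Proof. by move=> i; rewrite coefX; case: (_ == _). Qed.
Let pB q r : poly_on q -> poly_on r -> poly_on (q - r).
Proof. by move=> hq hr i; rewrite coefB; apply: SB. Qed.
Let pM q r : poly_on q -> poly_on r -> poly_on (q * r).
Proof. by move=> hq hr i; rewrite coefM; apply: Ssum => j; apply: SM. Qed.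
Let pN q : poly_on q -> poly_on (- q).
Proof. by move=> hq i; rewrite coefN; apply: SN. Qed.
Let pD q r : poly_on q -> poly_on r -> poly_on (q + r).
Proof. by move=> hq hr i; rewrite coefD; apply: SD. Qed.
Let p1 : poly_on 1. Proof. exact: pC. Qed.
Let pXn n : poly_on 'X^n.
Proof. by move=> i; rewrite coefXn; case: (_ == _). Qed.

Variables (y delta : K).

(* The value forced on the derivative of [q.[y]] by that of [y] being [delta]. *)
Definition der_ev (q : {poly K}) : K := (map_poly D q).[y] + q^`().[y] * delta.

Let dD q r : poly_on q -> poly_on r -> der_ev (q + r) = der_ev q + der_ev r.
Proof.
move=> hq hr; rewrite /der_ev derivD hornerD.
have -> : map_poly D (q + r) = map_poly D q + map_poly D r.
  by apply/polyP => i; rewrite coefD !coef_map_id0 // coefD DD.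
by rewrite hornerD; ring.
Qed.

Let dM q r : poly_on q -> poly_on r ->
  der_ev (q * r) = der_ev q * r.[y] + q.[y] * der_ev r.
Proof.
move=> hq hr; rewrite /der_ev derivM !hornerE.
have -> : map_poly D (q * r) = map_poly D q * r + q * map_poly D r.
  apply/polyP => i; rewrite coefD coef_map_id0 // !coefM Dsum; last by move=> j; apply: SM.
  by rewrite -big_split; apply: eq_bigr => j _ /=; rewrite !coef_map_id0 // DM.
by rewrite !hornerE; ring.
Qed.

Let dC c : der_ev c%:P = D c.
Proof.
rewrite /der_ev derivC horner0 mul0r addr0.
have -> : map_poly D c%:P = (D c)%:P.
  by apply/polyP => i; rewrite coef_map_id0 // !coefC; case: ifP.
by rewrite hornerC.
Qed.

Let dN q : poly_on q -> der_ev (- q) = - der_ev q.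
Proof.
move=> hq; rewrite -mulN1r -polyC1 -polyCN dM //; last by apply: pC; apply: SN.
by rewrite dC DN // D1 oppr0 mul0r add0r hornerC mulN1r.
Qed.

Let dX : der_ev 'X = delta.
Proof.
rewrite /der_ev derivX hornerC mul1r.
have -> : map_poly D 'X = 0.
  by apply/polyP => i; rewrite coef_map_id0 // coefX coef0; case: (_ == _); rewrite ?D1 ?D0.
by rewrite horner0 add0r.
Qed.

(** On [q.[y] / r.[y]] the derivation is dictated by the quotient rule. Two representations of the
    same element give a polynomial combination vanishing at [y], and the hypothesis says exactly
    that such a polynomial forces no contradiction. *)
Lemma der_extend : (forall q, poly_on q -> q.[y] = 0 -> der_ev q = 0) ->
  exists (S' : K -> Prop) (D' : K -> K),
    [/\ subfield S', der_on S' D', forall x, S x -> S' x, S' y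
      & (forall x, S x -> D' x = D x) /\ D' y = delta].
Proof.
move=> W.
pose rep z q r := [/\ poly_on q, poly_on r, r.[y] != 0 & z = q.[y] / r.[y]].
pose S' z := exists q r, rep z q r.
have /choice[D' hD'] z : exists w, forall q r, rep z q r ->
    w = (der_ev q - z * der_ev r) / r.[y].
  have [[q1 [r1 [hq1 hr1 n1 e1]]]|no] := pselect (S' z); last first.
    by exists 0 => q r h; case: no; exists q, r.
  exists ((der_ev q1 - z * der_ev r1) / r1.[y]) => q r [hq hr n e].
  have eq1 : q1.[y] = z * r1.[y] by rewrite e1 divfK.
  have eq : q.[y] = z * r.[y] by rewrite e divfK.
  have : der_ev (q1 * r - q * r1) = 0.
    by apply: W; [apply: pB; apply: pM | rewrite !hornerE eq eq1; ring].
  rewrite dD ?dN ?dM //; try (by apply: pM); last by apply: pN; apply: pM.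
  rewrite eq eq1 => h; apply/eqP; rewrite eqr_div // -subr_eq0; apply/eqP.
  rewrite -[RHS]h; ring.
exists S', D'; split.
- split.
  + by exists 1, 1; split=> //; rewrite hornerC ?oner_eq0 ?divr1.
  + move=> _ _ [q [r [hq hr n ->]]] [q' [r' [hq' hr' n' ->]]].
    exists (q * r' - q' * r), (r * r'); split.
    * by apply: pB; apply: pM.
    * exact: pM.
    * by rewrite hornerM mulf_neq0.
    * by rewrite !hornerE; field; rewrite n n'.
  + move=> _ _ [q [r [hq hr n ->]]] [q' [r' [hq' hr' n' ->]]].
    exists (q * q'), (r * r'); split; try exact: pM.
    * by rewrite hornerM mulf_neq0.
    * by rewrite !hornerM mulf_div.
  + move=> _ [q [r [hq hr n ->]]]; have [e|qn] := eqVneq q.[y] 0.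
      exists 0, 1; split=> //; first exact: pC.
        by rewrite hornerC oner_eq0.
      by rewrite e mul0r invr0 horner0 mul0r.
    by exists r, q; split=> //; rewrite invf_div.
- split.
  + move=> c; have [Sc Dc] : S (iota c) /\ D (iota c) = 0 by case: hD => /(_ c).
    have h : rep (iota c) (iota c)%:P 1.
      by split=> //; [apply: pC | rewrite hornerC oner_eq0 | rewrite !hornerC divr1].
    split; first by exists (iota c)%:P, 1.
    by rewrite (hD' _ _ _ h) !dC Dc D1 mulr0 subrr mul0r.
  + move=> x z [q [r h]] [q' [r' h']].
    rewrite (hD' _ _ _ h) (hD' _ _ _ h').
    case: h h' => hq hr n e [hq' hr' n' e'].
    rewrite (hD' _ (q * r' + q' * r) (r * r')).
      rewrite dD ?dM //; try exact: pM.
      by rewrite hornerM e e'; field; rewrite n n'.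
    split; [by apply: pD; apply: pM | exact: pM | by rewrite hornerM mulf_neq0 |].
    by rewrite e e' !hornerE; field; rewrite n n'.
  + move=> x z [q [r h]] [q' [r' h']].
    rewrite (hD' _ _ _ h) (hD' _ _ _ h').
    case: h h' => hq hr n e [hq' hr' n' e'].
    rewrite (hD' _ (q * q') (r * r')).
      rewrite ?dM //.
      by rewrite hornerM e e'; field; rewrite n n'.
    split; [exact: pM | exact: pM | by rewrite hornerM mulf_neq0 |].
    by rewrite e e' !hornerM mulf_div.
- move=> x hx; exists x%:P, 1.
  by split=> //; [apply: pC | rewrite hornerC oner_eq0 | rewrite !hornerC divr1].
- by exists 'X, 1; split=> //; [rewrite hornerC oner_eq0 | rewrite hornerX hornerC divr1].
split=> [x hx|].
  rewrite (hD' _ x%:P 1); first by rewrite !dC D1 mulr0 subr0 hornerC divr1.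
  by split=> //; [apply: pC | rewrite hornerC oner_eq0 | rewrite !hornerC divr1].
rewrite (hD' _ 'X 1); first by rewrite dX dC D1 mulr0 subr0 hornerC divr1.
by split=> //; [rewrite hornerC oner_eq0 | rewrite hornerX hornerC divr1].
Qed.

(** Induction on the degree by pseudo-division: subtracting a multiple of [p] changes [der_ev] by 0,
    since both [p.[y]] and [der_ev p] vanish. *)
Lemma der_ev_root_min p : poly_on p -> p != 0 -> p.[y] = 0 -> der_ev p = 0 ->
  (forall q, poly_on q -> q != 0 -> q.[y] = 0 -> (size p <= size q)%N) ->
  forall q, poly_on q -> q.[y] = 0 -> der_ev q = 0.
Proof.
move=> hp p0 py dp pmin q; have [n] := ubnP (size q); elim: n q => // n IHn q lt hq qy.
have [->|q0] := eqVneq q 0; first by rewrite -polyC0 dC D0.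
have le := pmin q hq q0 qy.
pose e := (size q - size p)%N.
pose q1 := (lead_coef p)%:P * q - (lead_coef q)%:P * 'X^e * p.
have hcq : poly_on (lead_coef q)%:P by apply: pC; exact: hq.
have hlq : poly_on ((lead_coef q)%:P * 'X^e) by apply: pM; [apply: pC; exact: hq | exact: pXn].
have hlp : poly_on (lead_coef p)%:P by apply: pC; exact: hp.
have hq1 : poly_on q1 by apply: pB; apply: pM.
have q1y : q1.[y] = 0 by rewrite /q1 !hornerE qy py; ring.
have lt1 : (size q1 < size q)%N.
  have sq : (0 < size q)%N by rewrite lt0n size_poly_eq0.
  have sp : (0 < size p)%N by rewrite lt0n size_poly_eq0.
  rewrite -(prednK sq) ltnS; apply/leq_sizeP => j; rewrite leq_eqVlt.
  rewrite /q1 coefB coefCM -mulrA coefCM coefXnM.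
  case/orP => [/eqP <-|lt'].
    have -> : ((size q).-1 < e)%N = false by rewrite /e; lia.
    have -> : ((size q).-1 - e)%N = (size p).-1 by rewrite /e; lia.
    by rewrite -!lead_coefE mulrC subrr.
  have qj : q`_j = 0 by apply: nth_default; rewrite -(prednK sq).
  have pj : p`_(j - e) = 0.
    apply: nth_default; move: lt'; rewrite -ltnS (prednK sq) /e.
    by move: (size q) (size p) le; lia.
  by rewrite qj pj mulr0 if_same mulr0 subrr.
have := IHn q1 (leq_trans lt1 lt) hq1 q1y.
rewrite dD ?dN ?dM //; try exact: pM; last by apply: pN; apply: pM.
rewrite dp qy py !mulr0 add0r addr0 hornerC subr0 => /eqP.
by rewrite mulf_eq0 lead_coef_eq0 (negPf p0) /= => /eqP.
Qed.

End Extension.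

(** If [y] is transcendental over [S], any value of its derivative is consistent. Otherwise the
    value is forced by a polynomial of least degree vanishing at [y]; in characteristic 0 its formal
    derivative is nonzero of smaller degree, hence does not vanish at [y] and can be divided by. *)
Lemma der_extend_any S D y : subfield S -> der_on S D ->
  exists (S' : K -> Prop) (D' : K -> K),
    [/\ subfield S', der_on S' D', forall x, S x -> S' x, S' y
      & forall x, S x -> D' x = D x].
Proof.
move=> hS hD.
suff [delta W] : exists delta, forall q, poly_on S q -> q.[y] = 0 -> der_ev D y delta q = 0.
  by have [S' [D' [? ? ? ? []]]] := der_extend hS hD W; exists S', D'.
have D0 : D 0 = 0 by case: hD => /(_ 0) + _ _; rewrite rmorph0 => -[].
pose ann n := `[< exists q, [/\ poly_on S q, q != 0, q.[y] = 0 & size q = n] >].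
have [ex|no] := pselect (exists n, ann n); last first.
  exists 0 => q hq qy; have [->|q0] := eqVneq q 0.
    by rewrite /der_ev map_poly0 deriv0 horner0 mul0r addr0.
  by case: no; exists (size q); apply/asboolP; exists q.
case: (ex_minnP ex) => m /asboolP[p [hp p0 py szp]] pmin.
have {}pmin q : poly_on S q -> q != 0 -> q.[y] = 0 -> (size p <= size q)%N.
  by move=> hq q0 qy; rewrite szp; apply: pmin; apply/asboolP; exists q.
have hp' : poly_on S p^`().
  case: hS => S1 SB _ _ i; have S0 : S 0 by rewrite -(subrr 1); apply: (SB).
  rewrite coef_deriv; move: (hp i.+1); move: (p`_i.+1) => a Sa.
  elim: (i.+1) => [|j IHj]; first by rewrite mulr0n.
  by rewrite mulrSr -[X in _ + X]opprK; apply: (SB) => //; rewrite -sub0r; apply: (SB).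
have szp1 : (1 < size p)%N by apply: (root_size_gt1 (a := y)); rewrite // /root py.
have szp' := size_deriv_char0 p natrK_neq0.
have p'y : p^`().[y] != 0.
  have p'0 : p^`() != 0.
    by rewrite -size_poly_eq0 szp'; case: (size p) szp1 => [|[]].
  apply/eqP => e; have := pmin p^`() hp' p'0 e.
  by rewrite szp'; case: (size p) szp1 => // n _; rewrite ltnn.
exists (- (map_poly D p).[y] / p^`().[y]).
apply: (der_ev_root_min hS hD hp p0 py) => //.
by rewrite /der_ev [_ * (_ / _)]mulrC divfK // addrN.
Qed.

Lemma der_extend_seq S D (s : seq K) : subfield S -> der_on S D ->
  exists (S' : K -> Prop) (D' : K -> K),
    [/\ subfield S', der_on S' D', forall x, S x -> S' x, forall y, y \in s -> S' y
      & forall x, S x -> D' x = D x].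
Proof.
elim: s S D => [|y s IHs] S D hS hD; first by exists S, D.
have [S1 [D1 [hS1 hD1 s1 y1 e1]]] := der_extend_any y hS hD.
have [S2 [D2 [hS2 hD2 s2 y2 e2]]] := IHs _ _ hS1 hD1.
exists S2, D2; split=> // [x /s1 /s2 //|z|x hx].
  by rewrite inE => /orP[/eqP ->|]; [apply: s2 | apply: y2].
by rewrite e2 ?e1 //; apply: s1.
Qed.

Lemma subfield_kev S N (P : {mpoly k[N]}) (s : 'I_N -> K) :
  subfield S -> (forall c, S (iota c)) -> (forall i, S (s i)) -> S (kev iota P s).
Proof.
move=> [S1 SB SM _] Sc Ss; have S0 : S 0 by rewrite -(subrr 1); apply: (SB).
have SD x y : S x -> S y -> S (x + y).
  by move=> hx hy; rewrite -[y]opprK; apply: (SB) => //; rewrite -sub0r; apply: (SB).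
rewrite /kev mevalE; apply: big_ind => // m _; apply: (SM).
  by rewrite mcoeff_map_mpoly; apply: Sc.
apply: big_ind => // i _; elim: (m i) => [|j IHj]; first by rewrite expr0.
by rewrite exprS; apply: (SM).
Qed.

(** The derivation is d/dt on k(t), extended through the finitely many generators of [K]. *)
Lemma derivation_exists : function_field_one_var iota ->
  exists D : K -> K,
    [/\ forall x y, D (x + y) = D x + D y,
        forall x y, D (x * y) = D x * y + x * D y,
        forall c, D (iota c) = 0
      & forall z, D z = 0 -> is_const iota z].
Proof.
move=> HK; have [[N [s hs]] [t [ttr tz]]] := HK.
have hS0 : subfield (is_const iota).
  split; first by exists 1; rewrite rmorph1.
  - by move=> _ _ [a ->] [b ->]; exists (a - b); rewrite rmorphB.
  - by move=> _ _ [a ->] [b ->]; exists (a * b); rewrite rmorphM.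
  - by move=> _ [a ->]; exists a^-1; rewrite fmorphV.
have hD0 : der_on (is_const iota) (fun=> 0).
  split=> [c|x y _ _|x y _ _]; first by split=> //; exists c.
    by rewrite addr0.
  by rewrite mulr0 mul0r addr0.
have [|S1 [D1 [hS1 hD1 _ t1 [_ Dt]]]] := @der_extend _ _ hS0 hD0 t 1.
  move=> q hq qt; suff -> : q = 0 by rewrite /der_ev map_poly0 deriv0 horner0 mul0r addr0.
  have /choice[c hc] i : exists c, q`_i = iota c by apply: hq.
  pose r := \poly_(i < size q) c i.
  have er : map_poly iota r = q.
    apply/polyP => i; rewrite coef_map coef_poly /=; case: ltnP => // h.
    by rewrite rmorph0 nth_default.
  have [r0|/ttr] := eqVneq r 0; first by rewrite -er r0 map_poly0.
  by rewrite er /root qt eqxx.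
have [S [D [hS hD sub1 gen e1]]] := der_extend_seq [seq s i | i <- enum 'I_N] hS1 hD1.
have Sc c : S (iota c) by case: hD => /(_ c)[].
have Sall z : S z.
  have [A [B [_ ->]]] := hs z; have Ss i : S (s i) by apply: gen; apply: map_f; rewrite mem_enum.
  case: (hS) => _ _ SM SV; apply: (SM); last apply: (SV); exact: subfield_kev.
case: hD => hc hadd hmul.
have DM x y := hmul x y (Sall x) (Sall y).
have DD x y := hadd x y (Sall x) (Sall y).
have Dc c : D (iota c) = 0 by case: (hc c).
have Dt1 : D t = 1 by rewrite (e1 _ t1).
exists D; split=> // z Dz; apply: contrapT => nz.
have D0 : D 0 = 0 by have := Dc 0; rewrite rmorph0.
have Dsum (I : Type) (r : seq I) (F : I -> K) :
    D (\sum_(i <- r) F i) = \sum_(i <- r) D (F i).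
  by elim: r => [|i r IHr]; rewrite ?big_nil // !big_cons DD IHr.
have DX x n : D (x ^+ n.+1) = (x ^+ n * D x) *+ n.+1.
  elim: n => [|n IHn]; first by rewrite expr1 expr0 mul1r.
  rewrite exprS DM IHn [X in _ = X]mulrS exprS mulrC; congr (_ + _).
  by rewrite mulrnAr mulrA.
have Dpev q : D (pev iota q z) = 0.
  rewrite pevE Dsum big1 // => -[[|i] hi] _; rewrite DM Dc mul0r add0r /=.
    by rewrite expr0 -(rmorph1 iota) Dc mulr0.
  by rewrite DX Dz mulr0 mul0rn mulr0.
(* A nonconstant [z] with [D z = 0] would make [t] algebraic over k(z). Differentiating a shortest
   relation, whose coefficients [D] kills, gives a shorter one because [D t = 1]. *)
pose ann n := `[< exists Q : {poly {poly k}}, [/\ Q != 0, ev2 iota Q z t = 0 & size Q = n] >].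
have ex : exists n, ann n.
  have [P [P0 e]] := tz z.
  have [//|Q Q0 eQ] := ev2_of_kev (a := ord_max) (b := ord0) _ P0 e.
  by exists (size Q); apply/asboolP; exists Q.
case: (ex_minnP ex) => m /asboolP[Q [Q0 eQ szQ]] Qmin.
have nat0 n : n.+1%:R != 0 :> {poly k}.
  by rewrite -polyC_natr polyC_eq0; have /pcharf0P -> := Hk.
have szQ' := size_deriv_char0 Q nat0.
have [Q1|Q1] := leqP (size Q) 1.
  move: eQ; have [c eQ] : exists c, Q = c%:P by exists Q`_0; apply: size1_polyC.
  have c0 : c != 0 by rewrite -polyC_eq0 -eQ.
  rewrite eQ /ev2 size_polyC c0 big_ord1 coefC eqxx expr0 mulr1 => /eqP.
  by rewrite (negPf (pev_neq0 nz c0)).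
have : ann (size Q^`()).
  apply/asboolP; exists Q^`(); split=> //.
    by rewrite -size_poly_eq0 szQ'; case: (size Q) Q1 => [|[]].
  have := congr1 D eQ; rewrite D0 /ev2 Dsum szQ'.
  case: (size Q) Q1 => // n _; rewrite big_ord_recl /= DM Dpev mul0r add0r expr0.
  rewrite -(rmorph1 iota) Dc mulr0 add0r => h; rewrite -[RHS]h; apply: eq_bigr => i _.
  rewrite /bump /= add1n DM Dpev mul0r add0r DX Dt1 mulr1 coef_deriv /pev.
  by rewrite rmorphMn hornerMn mulrnAr mulrnAl.
by move/Qmin; rewrite szQ' -szQ; case: (size Q) Q1 => // n _; rewrite ltnn.
Qed.

End Derivations.

(** * Poles created by a derivation *)

Section LocalBounds.
Variables (k : closedFieldType) (K : fieldType) (iota : {rmorphism k -> K}).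
Local Notation place := (place iota).
Implicit Types (E : place -> int).
Hypothesis HK : function_field_one_var iota.
Variables (genus : nat).
Hypothesis Hgenus : is_genus iota genus.

(** If the degree of [E] is large, L(E - D0) contains a nonzero function; multiplication by its
    inverse moves [E], within its linear equivalence class, to a divisor above [D0], where
    [riemann_eq] applies. *)
Lemma riemann_large : exists m0 : nat, forall E, divisor E -> m0%:Z <= deg E ->
  forall N, ldim_ge E N -> N%:Z <= deg E + 1 - genus%:Z.
Proof.
have [D0 hD0 eq0] := riemann_eq HK Hgenus.
exists (absz (deg D0) + genus)%N => E hE le N hN.
have hE' : divisor (fun p => E p - D0 p) by apply: divisorD => //; apply: divisorN.
have [|s [hs fs]] := riemann HK Hgenus (N := 1) hE'.
  by rewrite degB //; lia.
have s0 : s ord0 != 0 by apply: kfree_neq0 fs.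
have hV : (s ord0)^-1 != 0 by rewrite invr_eq0.
have hdiv : divisor (fun p : place => - ord p (s ord0)^-1).
  by apply: divisorN; apply: divisor_ord HK _ Hgenus _.
have degE : deg (fun p : place => E p - ord p (s ord0)^-1) = deg E.
  by rewrite degD // degN ?(deg_ord HK Hgenus) ?oppr0 ?addr0 //; apply: divisor_ord HK _ Hgenus _.
rewrite -degE; apply: (proj2 (eq0 _ _ _)) (ldim_ge_mul hV hN).
  exact: divisorD.
move=> p; have /in_LDP/(_ p)/(vgeP s0) := hs ord0; rewrite ordV; lia.
Qed.

(** In large degree L(E - P) has smaller dimension than L(E), so some function of L(E) attains the
    allowed order at [P]. *)
Lemma exact_order : exists m1 : nat, forall E (P : place), divisor E -> m1%:Z <= deg E ->
  exists a : K, [/\ a != 0, in_LD E a & ord P a = - E P].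
Proof.
have [m0 hm0] := riemann_large; exists (m0 + genus).+1 => E P hE le.
have eN : (absz (deg E + 1 - genus%:Z)%R)%:Z = deg E + 1 - genus%:Z by lia.
have [|s [hs fs]] := riemann HK Hgenus (N := absz (deg E + 1 - genus%:Z)%R) hE.
  by rewrite eN.
have [[i hi]|/forallNP all] := pselect (exists i, ~ vge P (s i) (- E P + 1)).
  have s0 : s i != 0 by apply/eqP => e; apply: hi; left.
  exists (s i); split=> //; have /in_LDP/(_ P)/(vgeP s0) h := hs i.
  have : ~ (- E P + 1 <= ord P (s i)) by move=> h'; apply: hi; right.
  by lia.
have hd : divisor (fun p => E p - dseq [:: P] p).
  by apply: divisorD => //; apply: divisorN; apply: dseq_divisor.
have dE : deg (fun p => E p - dseq [:: P] p) = deg E - 1.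
  by rewrite degB ?deg_dseq //; apply: dseq_divisor.
have := hm0 _ hd; rewrite dE => /(_ _ (absz (deg E + 1 - genus%:Z)%R)).
rewrite eN => h; suff : deg E + 1 - genus%:Z <= deg E - 1 + 1 - genus%:Z by lia.
apply: h; first by lia.
exists s; split=> // i; apply/in_LDP => p; rewrite /dseq /= addn0.
have [<-|_] := eqVneq P p.
  by rewrite opprB addrC; apply: contrapT (all i).
by rewrite subr0; move/in_LDP: (hs i); apply.
Qed.

Lemma kspan_of_max N (s : 'I_N -> K) (f : K) : kfree iota s ->
  ~ kfree iota (fun i : 'I_N.+1 => if unlift ord0 i is Some j then s j else f) ->
  exists c : 'I_N -> k, f = \sum_i iota (c i) * s i.
Proof.
move=> fs nf; apply: contrapT => no; apply: nf => c e.
have e' : iota (c ord0) * f + \sum_i iota (c (lift ord0 i)) * s i = 0.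
  rewrite -[RHS]e big_ord_recl unlift_none; congr (_ + _).
  by apply: eq_bigr => i _; rewrite liftK.
have [c0|c0] := eqVneq (c ord0) 0.
  move: e'; rewrite c0 rmorph0 mul0r add0r => /fs h i.
  by case: (unliftP ord0 i) => [j ->|->].
case: no; exists (fun i => - c (lift ord0 i) / c ord0).
have ic0 : iota (c ord0) != 0 by rewrite fmorph_eq0.
apply: (mulfI ic0); rewrite mulr_sumr; apply/eqP; rewrite -subr_eq0; apply/eqP.
rewrite -[RHS]e'; congr (_ + _); rewrite -sumrN; apply: eq_bigr => i _.
by rewrite mulrA -rmorphM [c ord0 * _]mulrC divfK // rmorphN mulNr opprK.
Qed.

Lemma ldim_basis E N : ldim E N -> exists s : 'I_N -> K,
  [/\ forall i, in_LD E (s i), kfree iota s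
    & forall f, in_LD E f -> exists c : 'I_N -> k, f = \sum_i iota (c i) * s i].
Proof.
move=> [[s [hs fs]] mx]; exists s; split=> // f hf; apply: (kspan_of_max fs) => fr.
apply: mx; eexists; split; last exact: fr.
by move=> i /=; case: (unlift ord0 i) => [j|]; [apply: hs | apply: hf].
Qed.

Variable D : K -> K.
Hypothesis DD : forall x y, D (x + y) = D x + D y.
Hypothesis DM : forall x y, D (x * y) = D x * y + x * D y.
Hypothesis Dc : forall c, D (iota c) = 0.

Lemma der0 : D 0 = 0. Proof. by have := Dc 0; rewrite rmorph0. Qed.

Lemma der_sum (I : Type) (r : seq I) (F : I -> K) :
  D (\sum_(i <- r) F i) = \sum_(i <- r) D (F i).
Proof. by elim: r => [|i r IHr]; rewrite ?big_nil ?der0 // !big_cons DD IHr. Qed.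

Lemma derZ c x : D (iota c * x) = iota c * D x.
Proof. by rewrite DM Dc mul0r add0r. Qed.

Definition regular_off (P : place) (a : K) : Prop := forall q : place, q != P -> vge q a 0.

(* Induction on the order of the pole at [P]: beyond [2m] the leading term is that of [x * a'],
   with [x] of order [-m] fixed and [a'] of smaller pole order. *)
Lemma der_regular_off (P : place) : exists b : place -> int,
  [/\ divisor b, forall q, 0 <= b q
    & forall a q, regular_off P a -> q != P -> vge q (D a) (- b q)].
Proof.
have [m1 hm1] := exact_order; pose m := m1.+1.
have degP n : deg (dseq (nseq n P)) = n%:Z by rewrite deg_dseq size_nseq.
have ordP n : dseq (nseq n P) P = n%:Z by rewrite /dseq count_nseq /= eqxx mul1n.
have LP n a : in_LD (dseq (nseq n P)) a -> regular_off P a.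
  move=> /in_LDP h q qP; apply: vgeW (h q).
  by rewrite /dseq count_nseq /= eq_sym (negPf qP); lia.
have LP' n a : regular_off P a -> vge P a (- n%:Z) -> in_LD (dseq (nseq n P)) a.
  move=> h hP; apply/in_LDP => q; have [->|qP] := eqVneq q P; first by rewrite ordP.
  by apply: vgeW (h q qP); rewrite /dseq count_nseq /= eq_sym (negPf qP); lia.
have [|x [x0 /LP xA ox]] := hm1 (dseq (nseq m P)) P (dseq_divisor _).
  by rewrite degP /m; lia.
have [N hN] := ldim_finite HK Hgenus (dseq_divisor (nseq (m + m) P)).
have [s [_ _ spans]] := ldim_basis hN.
pose b (q : place) := vpos (- ord q (D x)) + \sum_(i < N) vpos (- ord q (D (s i))).
have vp z : 0 <= vpos z by exact: vpos_ge0.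
have b0 (q : place) : 0 <= b q by rewrite /b addr_ge0 // sumr_ge0.
exists b; split=> //.
  by apply: divisorD; [|apply: divisor_sum => i]; apply: divisor_pole HK _ Hgenus _.
have bx (q : place) : vge q (D x) (- b q).
  right; have : vpos (- ord q (D x)) <= b q by rewrite /b lerDl sumr_ge0.
  by rewrite /vpos; lia.
have bs (q : place) i : vge q (D (s i)) (- b q).
  right; have : vpos (- ord q (D (s i))) <= b q.
    rewrite /b (bigD1 i) //= addrCA lerDl addr_ge0 // sumr_ge0 //.
  by rewrite /vpos; lia.
suff H n a q : regular_off P a -> q != P -> vge P a (- n%:Z) -> vge q (D a) (- b q).
  move=> a q hA hq; apply: (H (absz (ord P a)) a q hA hq); right; lia.
elim: n a q => [|n IHn] a q hA hq hP.
  have [|c ->] := spans a.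
    by apply: LP' => //; apply: vgeW hP; lia.
  by rewrite der_sum; apply: vge_sum => i _; rewrite derZ; apply: vgeMl => //; apply: vgeC.
have [le|lt] := leqP n.+1 (m + m).
  have [|c ->] := spans a; first by apply: LP' => //; apply: vgeW hP; lia.
  by rewrite der_sum; apply: vge_sum => i _; rewrite derZ; apply: vgeMl => //; apply: vgeC.
have [|hn] := pselect (vge P a (- n%:Z)); first exact: IHn.
have a0 : a != 0 by apply/eqP => e; apply: hn; left.
have oa : ord P a = - n.+1%:Z.
  have := vgeP a0 hP; have : ~ (- n%:Z <= ord P a) by move=> h; apply: hn; right.
  by lia.
(* As n + 1 > 2m, the order n + 1 - m is large enough for [exact_order]; as m >= 1, it is at most
   [n], so the induction hypothesis covers [a']. *)
have [|a' [a'0 /LP a'A oa']] := hm1 (dseq (nseq (n.+1 - m) P)) P (dseq_divisor _).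
  by rewrite degP; move: lt; rewrite /m; lia.
rewrite ordP in oa'; rewrite ordP in ox.
have xa0 : x * a' != 0 by rewrite mulf_neq0.
have oxa : ord P (x * a') = - n.+1%:Z by rewrite ordM // ox oa'; move: lt; rewrite /m; lia.
have [c hc] : exists c, vge P (a / (x * a') - iota c) 1.
  apply: (residue HK); have -> : 0 = ord P a + ord P (x * a')^-1 by rewrite ordV oa oxa; lia.
  by apply: vgeM; apply: vge_ord.
have hr : regular_off P (a - iota c * (x * a')).
  move=> q' hq'; apply: vgeB; first exact: hA.
  by apply: vgeMl; [apply: vgeC | apply: vgeMl; [apply: xA | apply: a'A]].
have hrP : vge P (a - iota c * (x * a')) (- n%:Z).
  have -> : a - iota c * (x * a') = (a / (x * a') - iota c) * (x * a').
    by rewrite mulrBl divfK.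
  have -> : - n%:Z = 1 + ord P (x * a') by rewrite oxa; lia.
  by apply: vgeM => //; apply: vge_ord.
have -> : a = (a - iota c * (x * a')) + iota c * (x * a') by rewrite subrK.
rewrite DD derZ DM; apply: vgeD; first exact: IHn.
apply: vgeMl; first exact: vgeC.
apply: vgeD; first by apply: vgeMr => //; apply: a'A.
apply: vgeMl; first exact: xA.
apply: IHn => //; right; rewrite oa'; move: lt; rewrite /m; lia.
Qed.

(* [f] is a quotient of functions regular off [P] whose denominator does not vanish at [q]. *)
Lemma der_regular_at (P : place) : exists b : place -> int,
  [/\ divisor b, forall q, 0 <= b q
    & forall f q, q != P -> vge q f 0 -> vge q (D f) (- b q)].
Proof.
have [b [hb b0 hA]] := der_regular_off P; exists b; split=> // f q qP hf.
have [->|f0] := eqVneq f 0; first by rewrite der0; left.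
have [m1 hm1] := exact_order.
pose E (p : place) := if p == P then 0 else vpos (- ord p f).
have E0 p : 0 <= E p by rewrite /E; case: ifP => // _; apply: vpos_ge0.
have hE : divisor E.
  have [T _ hT] := divisor_supp (divisor_pole HK Hgenus f).
  by apply: (@supp_divisor _ _ _ T) => p pT; rewrite /E hT // if_same.
pose m := (m1 + absz (deg E))%N.
have hd : divisor (fun p => dseq (nseq m P) p - E p).
  by apply: divisorD; [apply: dseq_divisor | apply: divisorN].
have [|a [a0 /in_LDP ha oa]] := hm1 _ q hd.
  by rewrite degB ?deg_dseq ?size_nseq //; [rewrite /m; lia | apply: dseq_divisor].
have vE p : p != P -> vge p a (E p).
  move=> pP; apply: vgeW (ha p).
  by rewrite /dseq count_nseq /= eq_sym (negPf pP); lia.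
have aA : regular_off P a by move=> p pP; apply: vgeW (vE p pP).
have faA : regular_off P (f * a).
  move=> p pP; have -> : 0 = - E p + E p by rewrite addNr.
  by apply: vgeM; last exact: vE; right; rewrite /E (negPf pP) /vpos; lia.
have oa0 : ord q a = 0.
  rewrite oa /dseq count_nseq /= eq_sym (negPf qP) /E (negPf qP).
  by have := vgeP f0 hf; rewrite /vpos; lia.
have -> : D f = (D (f * a) - f * D a) * a^-1 by rewrite DM addrK mulfK.
apply: vgeMr; last by right; rewrite ordV oa0.
by apply: vgeB; [apply: hA | apply: vgeMl => //; apply: hA].
Qed.

(** [der_regular_at] is silent at its own base point, so two base points are combined. A second
    place exists because a function with a pole at [P1] must have a zero elsewhere. *)
Lemma der_local : exists b : place -> int,
  [/\ divisor b, forall q, 0 <= b q & forall f q, vge q f 0 -> vge q (D f) (- b q)].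
Proof.
have [P1 _] := place_exists HK Hgenus.
have [P2 P21] : exists P2, P2 != P1.
  have [m1 hm1] := exact_order.
  have [|x [x0 _ ox]] := hm1 (dseq (nseq m1.+1 P1)) P1 (dseq_divisor _).
    by rewrite deg_dseq size_nseq; lia.
  move: ox; rewrite /dseq count_nseq /= eqxx mul1n => ox.
  apply: contrapT => /forallNP only.
  have [|c ec] := @ord_ge0_const _ _ _ HK _ Hgenus x^-1.
    move=> p; rewrite ordV; have [->|/only//] := eqVneq p P1; rewrite ox; lia.
  by have := ordC P1 c; rewrite -ec ordV ox; lia.
have [b1 [hb1 b10 h1]] := der_regular_at P1.
have [b2 [hb2 b20 h2]] := der_regular_at P2.
exists (fun q => b1 q + b2 q); split=> [|q|f q hf]; first exact: divisorD.
  by rewrite addr_ge0.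
have [e|qP] := eqVneq q P1.
  have qP2 : q != P2 by rewrite e eq_sym.
  by apply: vgeW (h2 f q qP2 hf); have := b10 q; lia.
by apply: vgeW (h1 f q qP hf); have := b20 q; lia.
Qed.

Lemma derX x n : D (x ^+ n.+1) = n.+1%:R * x ^+ n * D x.
Proof.
elim: n => [|n IHn]; first by rewrite expr1 expr0 !mul1r.
by rewrite exprS DM IHn exprS -[in RHS]natr1; ring.
Qed.

Lemma der_iter_bound : exists b : place -> int, [/\ divisor b, forall q, 0 <= b q,
    forall f q i, vge q f 0 -> vge q (iter i D f) (- (i%:Z * b q))
  & forall f q r i, vge q f r -> vge q (iter i D f) (r - i%:Z * (1 + b q))].
Proof.
have [b [hb b0 h]] := der_local.
have hX q x n : ord q x = 1 -> vge q (D (x ^+ n)) (n%:Z - 1 - b q).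
  move=> ox; case: n => [|n].
    by rewrite expr0 -(rmorph1 iota) Dc; left.
  rewrite derX -mulrA; apply: vgeMl.
    by rewrite -(rmorph_nat iota); apply: vgeC.
  have -> : n.+1%:Z - 1 - b q = n%:Z + - b q by lia.
  apply: vgeM; first by right; rewrite ordX ox natz.
  by apply: h; right; rewrite ox.
(* Write [f] as a regular function times a power of a uniformizer: differentiating the former costs
   [b], differentiating the power costs 1 + [b]. *)
have step f q r : vge q f r -> vge q (D f) (r - (1 + b q)).
  move=> hf; have [x ox] := ord_unif q.
  have x0 : x != 0 by apply/eqP => e; move: ox; rewrite e ord_0.
  case: r hf => n hf.
    have hu : vge q (f / x ^+ n) 0.
      have -> : 0 = n%:Z + ord q (x ^+ n)^-1 by rewrite ordV ordX ox natz addrN.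
      by apply: vgeM => //; apply: vge_ord.
    have -> : f = f / x ^+ n * x ^+ n by rewrite divfK // expf_neq0.
    rewrite DM; apply: vgeD.
      have -> : n%:Z - (1 + b q) = - b q + n%:Z - 1 by lia.
      apply: vgeW (vgeM (h _ _ hu) (vge_ord q (x ^+ n))); rewrite ordX ox natz; lia.
    apply: vgeMl => //; apply: vgeW (hX q x n ox); lia.
  have xn0 : x ^+ n.+1 != 0 by rewrite expf_neq0.
  have oxn : ord q (x ^+ n.+1) = n.+1%:Z by rewrite ordX ox natz.
  have hu : vge q (f * x ^+ n.+1) 0.
    have -> : 0 = Negz n + ord q (x ^+ n.+1) by rewrite oxn NegzE addNr.
    by apply: vgeM => //; apply: vge_ord.
  have -> : D f = (D (f * x ^+ n.+1) - f * D (x ^+ n.+1)) * (x ^+ n.+1)^-1.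
    by rewrite DM addrK mulfK.
  have -> : Negz n - (1 + b q) = - (1 + b q) + ord q (x ^+ n.+1)^-1.
    by rewrite ordV oxn NegzE; lia.
  apply: vgeM; last exact: vge_ord.
  apply: vgeB; first by apply: vgeW (h _ _ hu); lia.
  by apply: vgeW (vgeM hf (hX q x n.+1 ox)); rewrite NegzE; lia.
have iter_step f q r i : vge q f r -> vge q (iter i D f) (r - i%:Z * (1 + b q)).
  move=> hf; elim: i => [|i IHi] /=; first by rewrite mul0r subr0.
  by apply: vgeW (step _ _ _ IHi); rewrite -[i.+1]add1n PoszD; lia.
(* Where [b] vanishes, all iterates of a regular function stay regular; elsewhere each application
   of [D] costs at most 1 + [b]. Setting the value to 0 in the first case keeps the support
   finite. *)
exists (fun q => if b q == 0 then 0 else 1 + b q); split.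
- have [T _ hT] := divisor_supp hb.
  by apply: (@supp_divisor _ _ _ T) => p pT; rewrite hT.
- by move=> q; case: ifP => // _; have := b0 q; lia.
- move=> f q i hf; case: ifP => [/eqP e|_]; last first.
    by rewrite -[- _]add0r; apply: iter_step.
  rewrite mulr0 oppr0; elim: i => [|i IHi] //=.
  by rewrite -[0]oppr0 -e; apply: h.
- move=> f q r i hf; apply: vgeW (iter_step f q r i hf).
  rewrite lerD2l lerN2 ler_wpM2l //; case: ifP => [/eqP ->//|_]; lia.
Qed.

End LocalBounds.

(** * Wronskians *)

Section Wronskian.
Variables (k : closedFieldType) (K : fieldType) (iota : {rmorphism k -> K}).
Local Notation place := (place iota).
Variable D : K -> K.
Hypothesis DD : forall x y, D (x + y) = D x + D y.
Hypothesis DM : forall x y, D (x * y) = D x * y + x * D y.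
Hypothesis Dc : forall c, D (iota c) = 0.

Let D0 : D 0 = 0. Proof. exact: der0 Dc. Qed.
Let Dsum (I : Type) (r : seq I) (F : I -> K) :
  D (\sum_(i <- r) F i) = \sum_(i <- r) D (F i).
Proof. exact: (der_sum DD Dc). Qed.

Lemma iter_der_sum (I : Type) (r : seq I) (F : I -> K) n :
  iter n D (\sum_(i <- r) F i) = \sum_(i <- r) iter n D (F i).
Proof. by elim: n => //= n ->; rewrite Dsum. Qed.

Lemma iter_derZ c x n : iter n D (iota c * x) = iota c * iter n D x.
Proof. by elim: n => //= n ->; rewrite (derZ DM Dc). Qed.

Definition wr_mx M (f : 'I_M -> K) : 'M[K]_M := \matrix_(j, i) iter i D (f j).
Definition wr M (f : 'I_M -> K) : K := \det (wr_mx f).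

(** By induction the functions other than the first have a nonzero Wronskian, so a null vector can
    be scaled to have first entry 1. Differentiating its relations and using that Wronskian again
    shows that its entries have derivative 0, hence are constants. *)
Lemma wr_neq0 M (f : 'I_M -> K) : (forall z, D z = 0 -> is_const iota z) ->
  kfree iota f -> wr f != 0.
Proof.
move=> ker; elim: M f => [|M IHM] f ff; first by rewrite /wr det_mx00 oner_eq0.
have fl : kfree iota (f \o lift ord0) := kfree_inj (@lift_inj _ ord0) ff.
have nosol (a : 'I_M -> K) : (forall i : 'I_M, \sum_j a j * iter i D (f (lift ord0 j)) = 0) ->
    forall j, a j = 0.
  move=> h j; have /det0P no := IHM _ fl.
  apply/eqP; apply: contraT => aj; case: no; exists (\row_j a j).
    by apply/eqP => /rowP/(_ j); rewrite !mxE => /eqP; rewrite (negPf aj).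
  apply/rowP => i; rewrite !mxE -[RHS](h i); apply: eq_bigr => l _.
  by rewrite !mxE.
apply/det0P => -[v v0 hv].
have {hv} rel (i : 'I_M.+1) : \sum_j v 0 j * iter i D (f j) = 0.
  have /rowP/(_ i) := hv; rewrite !mxE => h; rewrite -[RHS]h.
  by apply: eq_bigr => j _; rewrite !mxE.
have [v00|v00] := eqVneq (v 0 ord0) 0.
  case/eqP: v0; apply/rowP => j; rewrite !mxE.
  case: (unliftP ord0 j) => [j' ->|->//].
  apply: (nosol (fun j => v 0 (lift ord0 j))) => i.
  have := rel (widen_ord (leqnSn M) i).
  by rewrite big_ord_recl v00 mul0r add0r.
pose a j := v 0 j / v 0 ord0.
have a0 : a ord0 = 1 by rewrite /a divff.
have rela (i : 'I_M.+1) : \sum_j a j * iter i D (f j) = 0.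
  have := congr1 (fun x => (v 0 ord0)^-1 * x) (rel i); rewrite mulr0 mulr_sumr => h.
  by rewrite -[RHS]h; apply: eq_bigr => j _; rewrite /a mulrAC mulrC.
have Da j : D (a (lift ord0 j)) = 0.
  move: j; apply: nosol => i.
  have := congr1 D (rela (widen_ord (leqnSn M) i)); rewrite D0 Dsum.
  under eq_bigr do rewrite DM.
  rewrite big_split /=; have -> : \sum_j a j * D (iter i D (f j)) = 0.
    by rewrite -[RHS](rela (lift ord0 i)); apply: eq_bigr => j _.
  by rewrite addr0 big_ord_recl a0 -(rmorph1 iota) Dc mul0r add0r.
have /choice[c hc] j : exists c, a j = iota c.
  case: (unliftP ord0 j) => [j' ->|->]; first by case: (ker _ (Da j')) => c; exists c.
  by exists 1; rewrite a0 rmorph1.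
have c0 : c ord0 = 0.
  by apply: ff; rewrite -[RHS](rela ord0); apply: eq_bigr => j _; rewrite hc.
by move: (hc ord0); rewrite c0 a0 rmorph0 => /eqP; rewrite oner_eq0.
Qed.

Lemma wr_comb M (f f' : 'I_M -> K) (Q : 'M[k]_M) :
  (forall j, f' j = \sum_i iota (Q j i) * f i) -> wr f' = iota (\det Q) * wr f.
Proof.
move=> h; rewrite /wr -det_map_mx -det_mulmx; congr (\det _).
apply/matrixP => j i; rewrite !mxE h iter_der_sum; apply: eq_bigr => l _.
by rewrite !mxE iter_derZ.
Qed.

(** The determinant of the change of family is a nonzero constant, of order 0. This allows a member
    to be replaced by another element of the same span. *)
Lemma ord_wr_comb M (f f' : 'I_M -> K) (p : place) : wr f' != 0 ->
  (forall j, exists c : 'I_M -> k, f' j = \sum_i iota (c i) * f i) ->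
  wr f != 0 /\ ord p (wr f) = ord p (wr f').
Proof.
move=> w0 /choice[c hc]; pose Q : 'M[k]_M := \matrix_(j, i) c j i.
have e : wr f' = iota (\det Q) * wr f.
  by apply: wr_comb => j; rewrite hc; apply: eq_bigr => i _; rewrite mxE.
move: w0; rewrite e mulf_eq0 negb_or => /andP[d0 w0].
by rewrite ordM // ordC add0r.
Qed.

(** Multilinearity alone, with the sum over all maps; the maps that are not injective are discarded
    later by [wr_not_inj]. *)
Lemma wr_expand M (I : finType) (w : I -> K) (f : 'I_M -> K) (Q : 'I_M -> I -> k) :
  (forall j, f j = \sum_i iota (Q j i) * w i) ->
  wr f = \sum_(s : {ffun 'I_M -> I}) (\prod_j iota (Q j (s j))) * wr (w \o s).
Proof.
move=> h; rewrite /wr /determinant.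
under [RHS]eq_bigr do rewrite mulr_sumr.
rewrite exchange_big /=; apply: eq_bigr => t _.
transitivity ((-1) ^+ t * \prod_i \sum_j iota (Q i j) * iter (t i) D (w j)).
  congr (_ * _); apply: eq_bigr => i _; rewrite mxE h iter_der_sum.
  by apply: eq_bigr => j _; rewrite iter_derZ.
rewrite bigA_distr_bigA mulr_sumr; apply: eq_bigr => s _.
rewrite big_split /= mulrCA; congr (_ * (_ * _)).
by apply: eq_bigr => i _; rewrite mxE.
Qed.

Lemma wr_not_inj M (f : 'I_M -> K) i j : i != j -> f i = f j -> wr f = 0.
Proof.
by move=> ij e; apply: (determinant_alternate ij) => l; rewrite !mxE e.
Qed.

(* [leib c i l] is the coefficient of [iter l D x] in [iter i D (c * x)]. *)
Fixpoint leib (c : K) (i l : nat) : K :=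
  if i is i'.+1 then D (leib c i' l) + (if l is l'.+1 then leib c i' l' else 0)
  else if l is 0%N then c else 0.

Let leib_gt c i l : (i < l)%N -> leib c i l = 0.
Proof.
elim: i l => [|i IHi] [|l] //= h; rewrite !IHi ?D0 ?addr0 //.
exact: ltn_trans h.
Qed.

Let leib_diag c i : leib c i i = c.
Proof. by elim: i => //= i ->; rewrite leib_gt // D0 add0r. Qed.

Let leibE c x i M : (i < M)%N ->
  iter i D (c * x) = \sum_(l < M) leib c i l * iter l D x.
Proof.
elim: i M => [|i IHi] [|M] // lt.
  by rewrite big_ord_recl /= big1 ?addr0 // => l _; rewrite mul0r.
rewrite iterS (IHi M.+1); last exact: ltnW.
rewrite Dsum; under eq_bigr do rewrite DM.
under [RHS]eq_bigr do rewrite /= mulrDl.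
rewrite !big_split /=; congr (_ + _).
rewrite [RHS]big_ord_recl mul0r add0r big_ord_recr /= leib_gt // mul0r addr0.
by apply: eq_bigr.
Qed.

(** By Leibniz's rule multiplication by [c] acts on iterated derivatives through a triangular matrix
    with diagonal entries [c]. *)
Lemma wr_scale M (c : K) (f : 'I_M -> K) : wr (fun j => c * f j) = c ^+ M * wr f.
Proof.
pose U : 'M[K]_M := \matrix_(i, l) leib c i l.
have -> : c ^+ M = \det U^T.
  rewrite det_tr det_trig; last by apply/is_trig_mxP => i l il; rewrite mxE leib_gt.
  rewrite (eq_bigr (fun=> c)); last by move=> i _; rewrite mxE leib_diag.
  by rewrite prodr_const card_ord.
rewrite mulrC /wr -det_mulmx; congr (\det _); apply/matrixP => j i.
rewrite !mxE (leibE _ _ (ltn_ord i)); apply: eq_bigr => l _.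
by rewrite !mxE mulrC.
Qed.

(* [lam p] bounds the poles that one application of [D] creates at [p]. *)
Variable lam : place -> int.
Hypothesis lam0 : forall p, 0 <= lam p.
Hypothesis hreg : forall f p i, vge p f 0 -> vge p (iter i D f) (- (i%:Z * lam p)).
Hypothesis hder : forall f p r i, vge p f r -> vge p (iter i D f) (r - i%:Z * (1 + lam p)).

Lemma wr_vge_sum M (f : 'I_M -> K) p (r : 'I_M -> int) : (forall j, vge p (f j) (r j)) ->
  vge p (wr f) (\sum_j r j - (M * M)%:Z * (1 + lam p)).
Proof.
move=> h; apply: (vge_det (r := fun j i => r j - i%:Z * (1 + lam p))) => [j i|s].
  by rewrite mxE; apply: hder.
rewrite sumrB lerD2l lerN2.
have := lam0 p; move: (lam p) => a a0.
apply: (@le_trans _ _ (\sum_(i < M) M%:Z * (1 + a))).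
  apply: ler_sum => i _; rewrite ler_wpM2r //; first by lia.
  by rewrite lez_nat ltnW.
by rewrite sumr_const card_ord -mulr_natr natz PoszM; lia.
Qed.

(** Dividing by a power of a uniformizer reduces to regular functions, whose derivatives lose only
    [lam]. In contrast to [wr_vge_sum], nothing is lost outside the support of [lam], as is needed
    at the infinitely many places off [S]. *)
Lemma wr_vge_min M (f : 'I_M -> K) p (e : int) : (forall j, vge p (f j) e) ->
  vge p (wr f) (M%:Z * e - (M * M)%:Z * lam p).
Proof.
move=> h; have [x ox] := ord_unif p.
have x0 : x != 0 by apply/eqP => e0; move: ox; rewrite e0 ord_0.
pose c := x ^ e; have c0 : c != 0 by rewrite expfz_eq0 (negPf x0) andbF.
have oc : ord p c = e by rewrite ordXz ox mul1r.
have -> : wr f = wr (fun j => c * (f j / c)).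
  rewrite /wr; congr (\det _); apply/matrixP => j i; rewrite !mxE.
  by rewrite mulrCA divff // mulr1.
rewrite wr_scale; apply: vgeM.
  by right; rewrite ordX oc -mulr_natl natz.
apply: (vge_det (r := fun j i => - (i%:Z * lam p))) => [j i|s].
  rewrite mxE; apply: hreg; have -> : 0 = e + ord p c^-1 by rewrite ordV oc addrN.
  by apply: vgeM => //; apply: vge_ord.
rewrite sumrN lerN2.
have := lam0 p; move: (lam p) => a a0.
apply: (@le_trans _ _ (\sum_(i < M) M%:Z * a)).
  by apply: ler_sum => i _; rewrite ler_wpM2r // lez_nat ltnW.
by rewrite sumr_const card_ord -mulr_natr natz PoszM; lia.
Qed.

(* Cauchy--Binet: the Wronskian of combinations of the [w i] is a combination of
   Wronskians of [M]-element subfamilies of [w]; the order of each is controlled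
   by the total order of [w], up to the [#|I| - M] omitted members. *)
Lemma wr_vge_comb M (I : finType) (w : I -> K) (f : 'I_M -> K) (p : place) (mu : int) :
  (forall j, exists Q : I -> k, f j = \sum_i iota (Q i) * w i) ->
  (forall i, w i != 0) -> 0 <= mu -> (forall i, ord p (w i) <= mu) ->
  vge p (wr f) (\sum_i ord p (w i) - (#|I| - M)%:Z * mu - (M * M)%:Z * (1 + lam p)).
Proof.
move=> /choice[Q hQ] w0 mu0 hmu; rewrite (wr_expand hQ).
apply: vge_sum => s _; apply: vgeMl.
  by rewrite -rmorph_prod; apply: vgeC.
have [sinj|] := boolP (injectiveb s); last first.
  case/injectivePn => i [j ij e]; rewrite (@wr_not_inj _ _ i j) //; first by left.
  by rewrite /= e.
apply: vgeW (wr_vge_sum (fun j => vge_ord p (w (s j)))).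
rewrite lerD2r lerBlDr.
move/injectiveP: sinj => sinj; pose A := imset s (mem (fun _ : 'I_M => true)).
have cA : #|A| = M by rewrite /A card_imset // cardT size_enum_ord.
rewrite (bigID (fun i => i \in A)) /=.
have -> : \sum_(i in A) ord p (w i) = \sum_j ord p (w (s j)).
  by rewrite /A big_imset //= => i j _ _; apply: sinj.
rewrite lerD2l.
have -> : (#|I| - M)%N = #|[predC A]|.
  by rewrite -cA -(cardC A) addKn.
apply: (@le_trans _ _ (\sum_(i | i \notin A) mu)); first exact: ler_sum.
by rewrite sumr_const -mulr_natl natz.
Qed.

End Wronskian.

(** * Unique factorization and the ideal of two coprime polynomials *)

Section Factorization.

Definition divides (R : comNzRingType) (a b : R) : Prop := exists q, b = a * q.

Definition prime_elt (R : idomainType) (p : R) : Prop :=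
  [/\ p != 0, ~ divides p 1
    & forall a b, divides p (a * b) -> divides p a \/ divides p b].

Definition factors_into (R : idomainType) (s : seq R) (a : R) : Prop :=
  (forall p, p \in s -> prime_elt p) /\
  exists2 u, divides u 1 & a = u * \prod_(p <- s) p.

(** The factors are required to be prime and not merely irreducible, so that existence of a
    factorization already entails its uniqueness. *)
Definition factorial_ring (R : idomainType) : Prop :=
  forall a : R, a != 0 -> exists s, factors_into s a.

Section Generic.
Variable R : idomainType.
Implicit Types (a b c p u : R).

Lemma divides_refl a : divides a a. Proof. by exists 1; rewrite mulr1. Qed.

Lemma divides_trans a b c : divides a b -> divides b c -> divides a c.
Proof. by move=> [q ->] [r ->]; exists (q * r); rewrite mulrA. Qed.

Lemma divides_mulr a b c : divides a b -> divides a (b * c).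
Proof. by move=> h; apply: divides_trans h _; exists c. Qed.

Lemma divides_mull a b c : divides a b -> divides a (c * b).
Proof. by rewrite mulrC; apply: divides_mulr. Qed.

Lemma prime_dvd_prod p (s : seq R) : prime_elt p -> divides p (\prod_(x <- s) x) ->
  exists2 x, x \in s & divides p x.
Proof.
move=> [p0 nu pp]; elim: s => [|x s IHs]; first by rewrite big_nil.
rewrite big_cons => /pp[h|/IHs[y ys h]]; first by exists x; rewrite ?inE ?eqxx.
by exists y; rewrite // inE ys orbT.
Qed.

Lemma prime_dvd_unitl p u a : prime_elt p -> divides u 1 -> divides p (u * a) -> divides p a.
Proof.
move=> [p0 nu pp] hu /pp[h|//]; case: nu; exact: divides_trans hu.
Qed.

Lemma prime_dvd_prime p x : prime_elt p -> prime_elt x -> divides p x ->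
  exists v, p = x * v /\ divides v 1.
Proof.
move=> [p0 nup pp] [x0 nux px] [t e].
have hxt : divides x (p * t) by rewrite e; apply: divides_refl.
case: (px p t hxt) => [[v ev]|[t' et]].
  exists v; split=> //; exists t; apply: (mulfI x0).
  by rewrite mulr1 mulrA -ev -e.
case: nup; exists t'; apply: (mulfI x0); rewrite mulr1.
by rewrite mulrA [x * p]mulrC -mulrA -et -e.
Qed.

(** The decreasing number of prime factors is the measure by which [primitive_part] terminates. *)
Lemma factors_cancel s a p : factors_into s (p * a) -> prime_elt p -> a != 0 ->
  exists2 s', factors_into s' a & (size s' < size s)%N.
Proof.
move=> [hs [u hu e]] hp a0.
have : divides p (\prod_(x <- s) x).
  by apply: prime_dvd_unitl hp hu _; rewrite -e; exists a.
case/(prime_dvd_prod hp) => x xs px.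
have [v [ev hv]] := prime_dvd_prime hp (hs x xs) px.
have x0 : x != 0 by case: (hs x xs).
have v0 : v != 0.
  by apply/eqP => v0; case: hp; rewrite ev v0 mulr0 eqxx.
exists (rem x s).
  split; first by move=> y /mem_rem; apply: hs.
  have [t et] := hv; exists (u * t).
    by case: hu => w ew; exists (w * v); rewrite mulrACA -ew mul1r mulrC -et.
  apply: (mulfI x0); apply: (mulfI v0).
  have -> : v * (x * a) = p * a by rewrite ev; ring.
  rewrite e (perm_big _ (perm_to_rem xs)) big_cons /=.
  have -> : v * (x * (u * t * \prod_(j <- rem x s) j)) =
    (v * t) * (x * u * \prod_(j <- rem x s) j) by ring.
  by rewrite -et mul1r; ring.
by rewrite size_rem //; case: s xs {hs e}.
Qed.

(** The primes of [f] are removed one at a time: each divides [b] or [g], and coprimality excludes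
    [g]. *)
Lemma coprime_dvd_mul (f g b : R) : factorial_ring R -> f != 0 ->
  (forall h, divides h f -> divides h g -> divides h 1) ->
  divides f (b * g) -> divides f b.
Proof.
move=> ufd f0; have [s [hs [u hu e]]] := ufd f f0.
elim: s f b hs e f0 => [|p s IHs] f b hs e f0 cop hfb.
  apply: divides_trans (_ : divides f 1) _; last by exists b; rewrite mul1r.
  by rewrite e big_nil mulr1.
have hp : prime_elt p by apply: hs; rewrite inE eqxx.
have [p0 nup pp] := hp.
have [f1 def_f1] : exists f1, f1 = u * \prod_(x <- s) x by eexists.
have ef : f = p * f1 by rewrite e big_cons def_f1; ring.
have f10 : f1 != 0 by apply: contraNneq f0 => h; rewrite ef h mulr0.
have [b1 eb] : divides p b.
  have hpf : divides p f by rewrite ef; exists f1.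
  case: (pp b g (divides_trans hpf hfb)) => // hpg.
  by case: nup; apply: cop.
have : divides f1 b1.
  apply: (IHs f1) => //; first by move=> x xs; apply: hs; rewrite inE xs orbT.
    by move=> h hf; apply: cop; rewrite ef; apply: divides_mull.
  case: hfb => q eq; exists q; apply: (mulfI p0).
  by rewrite !mulrA -eb -ef.
by case=> q e1; exists q; rewrite eb e1 ef mulrA.
Qed.

End Generic.

Section Polynomials.
Variable R : idomainType.
Hypothesis ufd : factorial_ring R.
Implicit Types (f g h : {poly R}).

Lemma divides_polyC (c : R) f : divides c%:P f <-> forall i, divides c f`_i.
Proof.
split=> [[q ->] i|h]; first by rewrite coefCM; exists q`_i.
have /choice[d hd] : forall i, exists e, f`_i = c * e by [].
exists (\poly_(i < size f) d i); apply/polyP => i; rewrite coefCM coef_poly.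
by case: ltnP => // le; rewrite mulr0 nth_default.
Qed.

Lemma divides_sum (I : Type) (r : seq I) (P : pred I) (F : I -> R) c :
  (forall i, P i -> divides c (F i)) -> divides c (\sum_(i <- r | P i) F i).
Proof.
move=> h; apply: (big_ind (divides c)) => //; first by exists 0; rewrite mulr0.
by move=> x y [a ->] [b ->]; exists (a + b); rewrite mulrDr.
Qed.

Lemma first_not_dvd (c : R) f : ~ divides c%:P f -> exists i,
  ~ divides c f`_i /\ forall j, (j < i)%N -> divides c f`_j.
Proof.
move=> /divides_polyC/existsNP[i0 hi0].
pose P i := `[< ~ divides c f`_i >].
have ex : exists i, P i by exists i0; apply/asboolP.
case: (ex_minnP ex) => i /asboolP hi imin; exists i; split=> // j ji.
apply: contrapT => hj; have := imin j; rewrite leqNgt ji.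
by move=> /(_ (introT (asboolP _) hj)).
Qed.

(** Gauss's lemma: if [i] and [j] are the first indices of coefficients not divisible by [c], then
    coefficient i + j of the product is [f]_i * g[_j] modulo [c]. *)
Lemma prime_polyC (c : R) : prime_elt c -> prime_elt c%:P.
Proof.
move=> [c0 nu cp]; split; first by rewrite polyC_eq0.
  by move/divides_polyC => /(_ 0%N); rewrite coef1.
move=> f g hfg; apply: contrapT => /not_orP[nf ng].
have [i [hi imin]] := first_not_dvd nf.
have [j [hj jmin]] := first_not_dvd ng.
have := (divides_polyC _ _).1 hfg (i + j)%N; rewrite coefM.
have hi' : (i < (i + j).+1)%N by rewrite ltnS leq_addr.
rewrite (bigD1 (Ordinal hi')) //= addKn => -[q eq].
have : divides c (f`_i * g`_j).
  have [r er] : divides c (\sum_(l < (i + j).+1 | l != Ordinal hi') f`_l * g`_(i + j - l)).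
    apply: divides_sum => l li.
    have [lt|ge] := ltnP l i; first by apply: divides_mulr; apply: imin.
    apply: divides_mull; apply: jmin.
    have : (i < l)%N by rewrite ltn_neqAle ge andbT eq_sym; apply: contra li => /eqP e; apply/eqP/val_inj.
    have := ltn_ord l; lia.
  by exists (q - r); rewrite mulrBr -eq er addrK.
by case/cp.
Qed.

Definition primitive f : Prop := forall c : R, prime_elt c -> ~ divides c%:P f.

Lemma primitive_part f : f != 0 ->
  exists (c : R) f0, [/\ c != 0, primitive f0 & f = c%:P * f0].
Proof.
move=> f0; have lf0 : lead_coef f != 0 by rewrite lead_coef_eq0.
have [s hs] := ufd lf0; have [n] := ubnP (size s).
elim: n f f0 lf0 s hs => // n IHn f f0 lf0 s hs lt.
have [prim|] := pselect (primitive f); first by exists 1, f; rewrite oner_eq0 mul1r.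
move/existsNP=> [c /not_implyP[hc /contrapT[f1 ef]]].
have c0 : c != 0 by case: hc.
have f10 : f1 != 0 by apply: contraNneq f0 => h; rewrite ef h mulr0.
have elf : lead_coef f = c * lead_coef f1 by rewrite ef lead_coefM lead_coefC.
have lf10 : lead_coef f1 != 0 by rewrite lead_coef_eq0.
rewrite elf in hs; have [s' hs' lt'] := factors_cancel hs hc lf10.
have [|d [g [d0 pg eg]]] := IHn f1 f10 lf10 s' hs'.
  exact: leq_trans lt' lt.
exists (c * d), g; split=> //; first by rewrite mulf_neq0.
by rewrite ef eg polyCM mulrA.
Qed.

(** Each prime factor of [c] divides [f * q] but not the primitive [f], so it divides [q] and can be
    cancelled. *)
Lemma primitive_cancel (c : R) f g q : c != 0 -> primitive f ->
  c%:P * g = f * q -> divides f g.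
Proof.
move=> c0 pf; have [s [hs [u hu e]]] := ufd c0.
elim: s c q hs e c0 => [|p s IHs] c q hs e c0 h.
  case: hu => v ev; exists (v%:P * q); rewrite mulrCA -h mulrA -polyCM.
  by rewrite e big_nil mulr1 [v * u]mulrC -ev mul1r.
have hp : prime_elt p by apply: hs; rewrite inE eqxx.
have p0 : p != 0 by case: hp.
have [c1 def_c1] : exists c1, c1 = u * \prod_(x <- s) x by eexists.
have ec : c = p * c1 by rewrite e big_cons def_c1; ring.
have [_ _ pp] := prime_polyC hp.
have [||[q1 eq1]] := pp f q; first by exists (c1%:P * g); rewrite -h ec polyCM mulrA.
  by move=> hpf; case: (pf p hp).
apply: (IHs c1 q1) => //; first by move=> x xs; apply: hs; rewrite inE xs orbT.
  by apply: contraNneq c0 => h1; rewrite ec h1 mulr0.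
have pP0 : p%:P != 0 by rewrite polyC_eq0.
by apply: (mulfI pP0); rewrite mulrA -polyCM -ec h eq1; ring.
Qed.

(** If [f] is coprime to [a] over the fraction field, it divides a constant multiple of [b], hence
    [b]. Otherwise the primitive part of their gcd divides both; the cofactor in [f] is then a
    constant, and a unit as [f] is primitive, so [f] divides [a]. *)
Lemma primitive_irreducible_prime f : primitive f -> (1 < size f)%N ->
  (forall g h, f = g * h -> (size g <= 1)%N \/ (size h <= 1)%N) ->
  prime_elt f.
Proof.
move=> pf sf irr.
have f0 : f != 0 by rewrite -size_poly_eq0; case: (size f) sf.
split=> // [[q e]|a b [q e]].
  have q0 : q != 0 by apply/eqP => q0; move/eqP: e; rewrite q0 mulr0 oner_eq0.
  have := congr1 (fun p : {poly R} => size p) e; rewrite size_poly1 size_mul // => es.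
  have : (0 < size q)%N by rewrite lt0n size_poly_eq0.
  by move: es sf; case: (size f) => [|[|n]] //; case: (size q) => // m; rewrite addSn addnS.
have dvdT d g : primitive d -> (exists c : R, c != 0 /\ exists r, c%:P * g = d * r) -> divides d g.
  by move=> pd [c [c0 [r er]]]; apply: primitive_cancel c0 pd er.
have pdvd d g : Pdiv.Idomain.dvdp d g -> exists c : R, c != 0 /\ exists r, c%:P * g = d * r.
  move/Pdiv.Idomain.dvdpP => [[c r] /= c0 er]; exists c; split=> //; exists r.
  by rewrite mul_polyC er mulrC.
have [cop|ncop] := boolP (Pdiv.Idomain.coprimep f a).
  right; apply: dvdT => //; apply: pdvd.
  rewrite -(Pdiv.Idomain.Gauss_dvdpr _ cop) e.
  exact: Pdiv.Idomain.dvdp_mulr.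
left; pose d := Pdiv.Idomain.gcdp f a.
have d0 : d != 0.
  apply/eqP => h; have := Pdiv.Idomain.dvdp_gcdl f a; rewrite -/d h.
  by rewrite Pdiv.Idomain.dvd0p (negPf f0).
have sd : (1 < size d)%N.
  move: ncop; rewrite Pdiv.Idomain.coprimep_def -/d; have : (0 < size d)%N by rewrite lt0n size_poly_eq0.
  by case: (size d) => [|[|]].
have [c [g [c0 pg ed]]] := primitive_part d0.
have cP0 : c%:P != 0 by rewrite polyC_eq0.
have g0 : g != 0 by apply: contraNneq d0 => h; rewrite ed h mulr0.
have sg : (1 < size g)%N by move: sd; rewrite ed mul_polyC size_scale.
have [c1 [c10 [r er]]] := pdvd _ _ (Pdiv.Idomain.dvdp_gcdl f a).
have [r1 er1] : divides g f.
  by apply: dvdT => //; exists c1; split=> //; exists (c%:P * r); rewrite er -/d ed; ring.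
have [c2 [c20 [t et]]] := pdvd _ _ (Pdiv.Idomain.dvdp_gcdr f a).
have ga : divides g a.
  by apply: dvdT => //; exists c2; split=> //; exists (c%:P * t); rewrite et -/d ed; ring.
have [|] := irr _ _ er1; first by rewrite leqNgt sg.
move/size1_polyC => er1C.
have r10 : r1`_0 != 0 by apply: contraNneq f0 => h; rewrite er1 er1C h mulr0.
have [s [hs [u hu eu]]] := ufd r10.
case: s hs eu => [|p s] hs eu; last first.
  have hp : prime_elt p by apply: hs; rewrite inE eqxx.
  case: (pf p hp); exists (g * (u * \prod_(x <- s) x)%:P).
  by rewrite er1 er1C eu big_cons !polyCM; ring.
case: hu => v ev; apply: divides_trans ga.
exists v%:P; rewrite er1 er1C eu big_nil mulr1 -mulrA -polyCM -ev.
by rewrite polyC1 mulr1.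
Qed.

Lemma factors_polyC (c : R) : c != 0 -> exists s, factors_into s c%:P.
Proof.
move=> c0; have [s [hs [u [v ev] e]]] := ufd c0.
exists [seq p%:P | p <- s]; split.
  by move=> _ /mapP[p ps ->]; apply: prime_polyC; apply: hs.
exists u%:P; first by exists v%:P; rewrite -polyCM -ev polyC1.
by rewrite e polyCM big_map (big_morph _ (@polyCM R) (erefl _)).
Qed.

Lemma factors_mul (S : idomainType) (s s' : seq S) a b :
  factors_into s a -> factors_into s' b -> factors_into (s ++ s') (a * b).
Proof.
move=> [hs [u [v ev] ->]] [hs' [u' [v' ev'] ->]]; split.
  by move=> p; rewrite mem_cat => /orP[]; [apply: hs | apply: hs'].
exists (u * u'); first by exists (v * v'); rewrite mulrACA -ev -ev' mulr1.
by rewrite big_cat mulrACA.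
Qed.

Lemma factorial_poly : factorial_ring {poly R}.
Proof.
move=> f; have [n] := ubnP (size f); elim: n f => // n IHn f lt f0.
have [c [g [c0 pg e]]] := primitive_part f0.
have [sc hsc] := factors_polyC c0.
have g0 : g != 0 by apply: contraNneq f0 => h; rewrite e h mulr0.
have sg : size g = size f by rewrite e mul_polyC size_scale.
suff [s hs] : exists s, factors_into s g.
  by exists (sc ++ s); rewrite e; apply: factors_mul.
have [s1|s1] := leqP (size g) 1.
  have eg := size1_polyC s1; rewrite eg; apply: factors_polyC.
  by apply: contraNneq g0 => h; rewrite eg h.
have [irr|] := pselect (forall a b, g = a * b -> (size a <= 1)%N \/ (size b <= 1)%N).
  exists [:: g]; split.
    by move=> p; rewrite inE => /eqP ->; apply: primitive_irreducible_prime.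
  by exists 1; [exists 1; rewrite mulr1 | rewrite big_seq1 mul1r].
move/existsNP => [a /existsNP[b /not_implyP[eg /not_orP[/negP + /negP]]]].
rewrite -!ltnNge => sa sb.
have a0 : a != 0 by rewrite -size_poly_eq0; case: (size a) sa.
have b0 : b != 0 by rewrite -size_poly_eq0; case: (size b) sb.
have es : size f = (size a + size b).-1 by rewrite -sg eg size_mul.
have [|sa' ha] := IHn a _ a0; first by move: lt; rewrite es; case: (size b) sb (size a) => [|[|m]] // _ l; rewrite !addnS; lia.
have [|sb' hb] := IHn b _ b0; first by move: lt; rewrite es; case: (size a) sa (size b) => [|[|m]] // _ l; rewrite !addSn; lia.
by exists (sa' ++ sb'); rewrite eg; apply: factors_mul.
Qed.

End Polynomials.

Lemma factorial_iso (R S : idomainType) (f : {rmorphism R -> S}) (g : S -> R) :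
  cancel f g -> cancel g f -> factorial_ring S -> factorial_ring R.
Proof.
move=> fK gK ufd a a0.
have gM x y : g (x * y) = g x * g y by apply: (can_inj fK); rewrite rmorphM !gK.
have g1 : g 1 = 1 by apply: (can_inj fK); rewrite rmorph1 gK.
have dvdg x y : divides x y -> divides (g x) (g y) by move=> [q ->]; exists (g q).
have dvdf x y : divides x y -> divides (f x) (f y).
  by move=> [q ->]; exists (f q); rewrite rmorphM.
have fa0 : f a != 0 by rewrite -(rmorph0 f) (can_eq fK).
have [s [hs [u hu e]]] := ufd _ fa0.
exists [seq g p | p <- s]; split.
  move=> _ /mapP[p /hs [p0 nu pp] ->]; split.
  - by apply: contraNneq p0 => h; rewrite -[p]gK h rmorph0.
  - by move/dvdf; rewrite gK rmorph1.
  - move=> x y /dvdf; rewrite gK rmorphM => /pp[] /dvdg; rewrite fK; [left|right] => //.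
exists (g u); first by rewrite -g1; apply: dvdg.
by rewrite -[a]fK e gM big_map (big_morph g gM g1).
Qed.

End Factorization.

(** * Factoriality of polynomial rings in several variables *)

Section FactorialMpoly.
Variable F : fieldType.

Lemma muniX n (m : 'X_{1..n.+1}) : muni ('X_[m] : {mpoly F[n.+1]}) =
  'X_[[multinom (m (widen_ord (leqnSn n) i)) | i < n]] *: 'X^(m ord_max).
Proof. by rewrite muniE msuppX big_seq1 mcoeffX eqxx scale1r. Qed.

Definition muni_inv n (q : {poly {mpoly F[n]}}) : {mpoly F[n.+1]} :=
  (map_poly (@mwiden n F) q).['X_ord_max].

Lemma muniK n : cancel (@muni n F) (@muni_inv n).
Proof.
move=> p; rewrite [p in RHS]mpolyE {1}[p]mpolyE raddf_sum /muni_inv raddf_sum.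
rewrite /= horner_sum; apply: eq_bigr => m _.
rewrite muniZ muniX map_polyZ hornerZ /= map_polyZ hornerZ map_polyXn hornerXn.
rewrite mwidenC /= mwidenX mul_mpolyC; congr (_ *: _).
rewrite mpolyXn -mpolyXD; congr 'X_[_]; apply/mnmP => i.
rewrite mnmDE mulmnE mnm1E.
have [j ->|->] := unliftP ord_max i.
  have -> : lift ord_max j = widen_ord (leqnSn n) j.
    by apply: val_inj; rewrite /= /bump leqNgt ltn_ord.
  rewrite mnmwiden_widen mnmE (_ : (ord_max == _) = false) ?addn0 //.
  by apply/eqP => /(congr1 val) /= e; have := ltn_ord j; rewrite -e ltnn.
by rewrite mnmwiden_ordmax eqxx mul1n.
Qed.

Lemma muni_mwiden n (c : {mpoly F[n]}) : muni (mwiden c) = c%:P.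
Proof.
rewrite {1}[c]mpolyE [in RHS](mpolyE c) (raddf_sum (@mwiden n F)).
rewrite (raddf_sum (@muni n F)) (raddf_sum (@polyC _)) /=; apply: eq_bigr => m _.
rewrite mwidenZ mwidenX muniZ muniX mnmwiden_ordmax expr0 -!mul_polyC mulr1 -polyCM.
rewrite mul_mpolyC; congr (_ *: _)%:P; congr 'X_[_]; apply/mnmP => i.
by rewrite mnmE mnmwiden_widen.
Qed.

Lemma muni_invK n : cancel (@muni_inv n) (@muni n F).
Proof.
move=> q; have muniX1 : muni ('X_ord_max : {mpoly F[n.+1]}) = 'X.
  rewrite muniX mnm1E eqxx expr1 (_ : [multinom _ | i < n] = 0%MM) ?mpolyX0 ?scale1r //.
  apply/mnmP => i; rewrite mnmE mnm1E mnm0E; apply/eqP; rewrite eqb0.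
  by apply/eqP => /(congr1 val) /= e; have := ltn_ord i; rewrite -e ltnn.
rewrite /muni_inv (@horner_coef_wide _ (size q)) ?size_poly // raddf_sum /=.
rewrite -[RHS]coefK poly_def; apply: eq_bigr => i _.
by rewrite muniM rmorphXn /= muniX1 coef_map /= muni_mwiden mul_polyC.
Qed.

Lemma factorial_mpoly n : factorial_ring {mpoly F[n]}.
Proof.
elim: n => [|n IHn]; last exact: factorial_iso (@muniK n) (@muni_invK n) (factorial_poly IHn).
move=> a a0; exists [::]; split=> //; exists a; last by rewrite big_nil mulr1.
have ea : a = (a@_0%MM)%:MP.
  apply/mpolyP => m; rewrite mcoeffC (_ : m = 0%MM) ?eqxx ?mulr1 //.
  by apply/mnmP => -[].
have c0 : a@_0%MM != 0 by apply: contraNneq a0 => h; rewrite ea h mpolyC0.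
by exists (a@_0%MM)^-1%:MP; rewrite {1}ea -mpolyCM divff.
Qed.

Lemma mcoprime_divides n (A B C : {mpoly F[n]}) : mcoprime A B -> A != 0 ->
  divides A (C * B) -> divides A C.
Proof.
move=> cop A0; apply: (coprime_dvd_mul (@factorial_mpoly n) A0) => h [q eq] hB.
have [|c ec] := cop h _ hB; first by exists q.
have c0 : c != 0 by apply: contraNneq A0 => c0; rewrite eq ec c0 mpolyC0 mul0r.
by exists c^-1%:MP; rewrite ec -mpolyCM divff.
Qed.

End FactorialMpoly.

(** * Counting monomials *)

Section MonomialCount.

Lemma card_bmnm n N : #|{: 'X_{1..n < N.+1}}| = 'C(N + n, n).
Proof.
rewrite addnC -card_partial_ord_partitions.
pose f (m : 'X_{1..n < N.+1}) : n.-tuple 'I_N.+1 := [tuple inord (m i) | i < n].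
have fE m i : tnth (f m) i = m i :> nat.
  rewrite tnth_mktuple inordK // ltnS; have := bmdeg m; rewrite ltnS; apply: leq_trans.
  by rewrite mdegE (bigD1 i) //= leq_addr.
have finj : injective f.
  move=> m1 m2 e; apply: val_inj; apply/mnmP => i /=.
  by rewrite -!fE e.
rewrite -(card_imset _ finj); apply: eq_card => t; rewrite inE.
apply/imsetP/idP => [[m _ ->]|ht].
  rewrite big_tuple; under eq_bigr do rewrite fE.
  by rewrite -mdegE -ltnS; apply: bmdeg.
have ht' : (mdeg [multinom (tnth t i : nat) | i < n] < N.+1)%N.
  rewrite mdegE ltnS; under eq_bigr do rewrite mnmE.
  by rewrite -(big_tuple _ _ t xpredT (fun i : 'I_N.+1 => (i : nat))).
exists (BMultinom ht') => //; apply: eq_from_tnth => i.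
by apply: val_inj; rewrite /= fE /= mnmE.
Qed.

Definition simplex_count n N := 'C(N + n, n).

Lemma simplex_countS n N :
  simplex_count n.+1 N.+1 = (simplex_count n.+1 N + simplex_count n N.+1)%N.
Proof. by rewrite /simplex_count [(N.+1 + n.+1)%N]addSn binS addSnnS. Qed.

Lemma simplex_count_add n N p : simplex_count n.+1 (N + p) =
  (simplex_count n.+1 N + \sum_(i < p) simplex_count n (N + i).+1)%N.
Proof.
elim: p => [|p IHp]; first by rewrite addn0 big_ord0 addn0.
by rewrite addnS simplex_countS IHp big_ord_recr /= addnA.
Qed.

Lemma simplex_count_mono n N N' : (N <= N')%N -> (simplex_count n N <= simplex_count n N')%N.
Proof. by move=> le; rewrite /simplex_count leq_bin2l // leq_add2r. Qed.

(** Each difference lowers the number of variables by one, so the second difference is a sum of p q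
    counts in [n] variables. It is stated without subtraction to avoid truncation. *)
Lemma simplex_second_diff n N p q :
  (simplex_count n.+2 (N + p + q) + simplex_count n.+2 N <=
   simplex_count n.+2 (N + p) + simplex_count n.+2 (N + q)
   + p * q * simplex_count n (N + p + q))%N.
Proof.
rewrite [(N + p + q)%N]addnAC [X in (X + _ <= _)%N]simplex_count_add.
rewrite [simplex_count n.+2 (N + p)]simplex_count_add.
suff h : (\sum_(i < p) simplex_count n.+1 (N + q + i).+1 <=
   \sum_(i < p) simplex_count n.+1 (N + i).+1 + p * q * simplex_count n (N + q + p))%N.
  by lia.
have -> : (p * q * simplex_count n (N + q + p) =
    \sum_(i < p) q * simplex_count n (N + q + p))%N.
  by rewrite sum_nat_const card_ord mulnA.
rewrite -big_split /=; apply: leq_sum => i _.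
have -> : ((N + q + i).+1 = (N + i).+1 + q)%N by lia.
rewrite simplex_count_add leq_add2l.
have -> : (q * simplex_count n (N + q + p) = \sum_(j < q) simplex_count n (N + q + p))%N.
  by rewrite sum_nat_const card_ord.
apply: leq_sum => j _; apply: simplex_count_mono.
have := ltn_ord i; have := ltn_ord j; lia.
Qed.

(** Two more variables gain a factor of order N^2: this beats the weight [N] of the omitted
    functions. *)
Lemma simplex_growth n N : (simplex_count n N * N ^ 2 <= n.+2 ^ 2 * simplex_count n.+2 N)%N.
Proof.
have step m : (simplex_count m.+1 N * m.+1 = (N + m).+1 * simplex_count m N)%N.
  by rewrite /simplex_count addnS mulnC -mul_bin_diag.
have e : (n.+2 * n.+1 * simplex_count n.+2 N =
    (N + n.+1).+1 * (N + n).+1 * simplex_count n N)%N.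
  have := step n; have := step n.+1.
  set a := simplex_count n.+2 N; set b := simplex_count n.+1 N; set c := simplex_count n N.
  by move=> h1 h2; rewrite mulnAC [(n.+2 * a)%N]mulnC h1 -!mulnA; congr muln; rewrite h2.
apply: (@leq_trans (n.+2 * n.+1 * simplex_count n.+2 N)%N); last first.
  by rewrite leq_mul2r -mulnn leq_mul2l leqnSn !orbT.
rewrite e mulnC leq_mul2r -mulnn leq_mul ?orbT //; lia.
Qed.

(* For coprime polynomials of degrees [p] and [q], the subtracted expression is a lower bound
   for the dimension of their ideal in degree at most [N]: the codimension is a second
   difference of [simplex_count n]. *)
Lemma simplex_choice n p q C : (0 < C)%N -> exists N0, let N := (N0 + p + q)%N in
  (C * N * (simplex_count n N - (simplex_count n (N0 + q) + simplex_count n (N0 + p)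
     - simplex_count n N0)) <=
   simplex_count n (N0 + q) + simplex_count n (N0 + p) - simplex_count n N0)%N /\
  (0 < simplex_count n (N0 + q) + simplex_count n (N0 + p) - simplex_count n N0)%N.
Proof.
move=> C0; have pos m N : (0 < simplex_count m N)%N by rewrite /simplex_count bin_gt0 leq_addl.
have le m N0 r : (simplex_count m N0 <= simplex_count m (N0 + r))%N.
  by apply: simplex_count_mono; rewrite leq_addr.
(* With at most one variable the count is affine in the degree and the codimension is 0. *)
case: n => [|[|n]].
- by exists 0%N; rewrite /simplex_count !addn0 !bin0 /= muln0.
- exists 0%N; rewrite /simplex_count !bin1 /=.
  have -> : (0 + p + q + 1 - (0 + q + 1 + (0 + p + 1) - (0 + 1)) = 0)%N by lia.
  by rewrite muln0; split=> //; lia.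
(* Since [N0 <= N], [simplex_growth] gives (C + 1) N p q T <= B, with [T] and [B] the counts in n
   and n + 2 variables. The codimension, at most p q T, is then at most B / (C N + 1). *)
exists ((C + 1) * (p * q) * n.+2 ^ 2)%N => N.
set N0 := ((C + 1) * (p * q) * n.+2 ^ 2)%N in N *.
have d := simplex_second_diff n N0 p q; rewrite -/N in d.
have g := simplex_growth n N.
have l1 := le n.+2 N0 q.
have NE : (N0 <= N)%N by rewrite /N; lia.
have p1 := pos n.+2 N; have p2 := pos n.+2 (N0 + p)%N.
split; last by lia.
have [N00|N00] := posnP N0.
  have pq0 : (p * q = 0)%N.
    apply/eqP; rewrite -leqn0 leqNgt; apply/negP => h.
    have : (0 < N0)%N by rewrite /N0 muln_gt0 [X in X && _]muln_gt0 h addn1 expn_gt0.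
    by rewrite N00.
  move: d; rewrite pq0 mul0n => d.
  have -> : (simplex_count n.+2 N - (simplex_count n.+2 (N0 + q) +
    simplex_count n.+2 (N0 + p) - simplex_count n.+2 N0) = 0)%N by lia.
  by rewrite muln0.
have N1 : (0 < N)%N by lia.
set T := simplex_count n N in d g *; set B := simplex_count n.+2 N in d g p1 *.
set M := (_ + _ - _)%N.
have c0 : (B - M <= p * q * T)%N by rewrite /M; lia.
have key : ((C * N + 1) * (p * q * T) <= B)%N.
  have h : (n.+2 ^ 2 * ((C + 1) * N * (p * q * T)) <= n.+2 ^ 2 * B)%N.
    apply: leq_trans g.
    have -> : (n.+2 ^ 2 * ((C + 1) * N * (p * q * T)) = T * (N0 * N))%N.
      by rewrite /N0; ring.
    by rewrite -mulnn leq_mul2l leq_mul2r NE !orbT.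
  move: h; rewrite leq_pmul2l ?expn_gt0 //; apply: leq_trans.
  by rewrite leq_mul2r mulnDl mul1n leq_add2l N1 orbT.
have : ((C * N + 1) * (B - M) <= B)%N by apply: leq_trans key; rewrite leq_mul2l c0 orbT.
rewrite mulnDl mul1n; lia.
Qed.

End MonomialCount.

(** * A large independent family in the ideal of two coprime polynomials *)

Section IdealFamily.
Variables (F : fieldType) (n : nat).
Implicit Types (A B : {mpoly F[n]}).

Definition mfree (J : finType) (psi : J -> {mpoly F[n]}) : Prop :=
  forall a : J -> F, \sum_j a j *: psi j = 0 -> forall j, a j = 0.

Lemma mcoeff_mulX A (a m : 'X_{1..n}) : (A * 'X_[a])@_m != 0 ->
  exists m', (A * 'X_[a])@_m = A@_m'.
Proof.
rewrite -mcoeff_msupp (perm_mem (msuppMX _ _)) => /mapP[m' _ ->].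
by exists m'; rewrite mcoeffMX.
Qed.

Lemma msize_mulX A (a : 'X_{1..n}) (d N : nat) : (msize A <= d.+1)%N ->
  (mdeg a < (N - d).+1)%N -> (d <= N)%N -> (msize (A * 'X_[a]) <= N.+1)%N.
Proof.
move=> sA sa le; rewrite msizeE; apply/bigmax_leqP_seq => m.
rewrite (perm_mem (msuppMX _ _)) => /mapP[m' hm' ->] _.
have := msize_mdeg_lt hm'; rewrite mdegD; lia.
Qed.

(* Take the multiples of [A] and those of [B] by monomials not divisible by the leading
   monomial of [A]: in a relation, [A] would divide a polynomial whose leading monomial is not
   a multiple of that of [A]. *)
Lemma ideal_family A B (C : nat) : mcoprime A B -> A != 0 -> B != 0 -> (0 < C)%N ->
  exists (N : nat) (J : finType) (psi : J -> {mpoly F[n]}),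
  [/\ mfree psi, forall j, (msize (psi j) <= N.+1)%N,
      forall j, exists a, psi j = A * 'X_[a] \/ psi j = B * 'X_[a],
      (C * N * (#|{: 'X_{1..n < N.+1}}| - #|J|) <= #|J|)%N
    & (0 < #|J|)%N].
Proof.
move=> cop A0 B0 C0.
pose p := (msize A).-1; pose q := (msize B).-1.
have sA : msize A = p.+1 by rewrite prednK // lt0n msize_poly_eq0.
have sB : msize B = q.+1 by rewrite prednK // lt0n msize_poly_eq0.
have [N0 /= [hN pos]] := simplex_choice n p q C0.
set N := (N0 + p + q)%N in hN.
pose ok (m : 'X_{1..n < (N - q).+1}) := ~~ (mlead A <= m)%MM.
pose J : finType := ('X_{1..n < (N - p).+1} + {m : 'X_{1..n < (N - q).+1} | ok m})%type.
pose psi (j : J) := match j with inl m => A * 'X_[m] | inr m => B * 'X_[val m] end.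
have cJ : (simplex_count n (N0 + q) + simplex_count n (N0 + p)
     - simplex_count n N0 <= #|J|)%N.
  have Np : (N - p = N0 + q)%N by rewrite /N; lia.
  have Nq : (N - q = N0 + p)%N by rewrite /N; lia.
  rewrite card_sum card_sig card_bmnm {1}Np -/(simplex_count n (N0 + q)).
  rewrite -addnBA; last by apply: simplex_count_mono; rewrite leq_addr.
  rewrite leq_add2l.
  have -> : simplex_count n (N0 + p) = #|{: 'X_{1..n < (N - q).+1}}| by rewrite card_bmnm Nq.
  rewrite leq_subLR -(cardC ok) addnC leq_add2r.
  rewrite /simplex_count -card_bmnm.
  (* Division by the leading monomial of [A], of degree [p], maps the excluded monomials injectively
     into degree at most N - q - p = [N0]. *)
  pose sub (m : 'X_{1..n < (N - q).+1}) : 'X_{1..n < N0.+1} := insubd bm0 (m - mlead A)%MM.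
  have subE m : m \in [predC ok] -> (sub m : 'X_{1..n}) = (m - mlead A)%MM.
    rewrite inE /= negbK => le; rewrite /sub val_insubd ifT //.
    have hm := bmdeg m; have [hl] : (mdeg (mlead A)).+1 = p.+1 by rewrite -sA mlead_deg.
    have hd : mdeg m = (mdeg (m - mlead A) + p)%N by rewrite -hl -mdegD submK.
    by move: hm; rewrite hd; move: (mdeg (m - mlead A)) => x; lia.
  rewrite -(card_in_imset (f := sub) (D := [predC ok])); first exact: max_card.
  move=> m1 m2 h1 h2 e; apply: val_inj.
  move: (congr1 (fun m : 'X_{1..n < N0.+1} => (m : 'X_{1..n})) e); rewrite !subE //.
  move: h1 h2; rewrite !inE /= !negbK => h1 h2 e'.
  by rewrite -(submK h1) e' submK.
exists N, J, psi; split.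
- move=> a e.
  pose PA := \sum_(m : 'X_{1..n < (N - p).+1}) a (inl m) *: 'X_[m] : {mpoly F[n]}.
  pose PB := \sum_(m : {m | ok m}) a (inr m) *: 'X_[val m] : {mpoly F[n]}.
  have e1 : A * PA + B * PB = 0.
    rewrite -[RHS]e big_sumType /= !mulr_sumr.
    by congr (_ + _); apply: eq_bigr => m _; rewrite -scalerAr.
  have coefB (m : {m | ok m}) : PB@_(val m) = a (inr m).
    rewrite raddf_sum (bigD1 m) //= mcoeffZ mcoeffX eqxx mulr1 big1 ?addr0 // => m' ne.
    rewrite mcoeffZ mcoeffX (_ : (_ == _) = false) ?mulr0 //.
    by apply: contraNF ne => /eqP h; apply/eqP; do 2!apply: val_inj.
  have coefA (m : 'X_{1..n < (N - p).+1}) : PA@_m = a (inl m).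
    rewrite raddf_sum (bigD1 m) //= mcoeffZ mcoeffX eqxx mulr1 big1 ?addr0 // => m' ne.
    rewrite mcoeffZ mcoeffX (_ : (_ == _) = false) ?mulr0 //.
    by apply: contraNF ne => /eqP h; apply/eqP; apply: val_inj.
  have PB0 : PB = 0.
    apply/eqP; apply: contraT => nz.
    have [|Q eQ] := @mcoprime_divides _ _ A B PB cop A0.
      by exists (- PA); apply/eqP; rewrite mulrN -addr_eq0 mulrC addrC e1.
    have Q0 : Q != 0 by apply: contraNneq nz => h; rewrite eQ h mulr0.
    have := mlead_supp nz; rewrite mcoeff_msupp.
    suff h m : PB@_m != 0 -> ~~ (mlead A <= m)%MM.
      by move/h; rewrite eQ mleadM // lem_addr.
    rewrite raddf_sum /=; apply: contraNN => le; rewrite big1 // => m' _.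
    rewrite mcoeffZ mcoeffX (_ : (_ == _) = false) ?mulr0 //.
    by apply: contraTF le => /eqP <-; apply: (valP m').
  have PA0 : PA = 0.
    by move: e1; rewrite PB0 mulr0 addr0 => /eqP; rewrite mulf_eq0 (negPf A0) => /eqP.
  case=> m; first by rewrite -coefA PA0 mcoeff0.
  by rewrite -coefB PB0 mcoeff0.
- case=> m; first by apply: (@msize_mulX _ _ p); rewrite ?sA ?bmdeg // /N; lia.
  by apply: (@msize_mulX _ _ q); rewrite ?sB ?bmdeg // /N; lia.
- by case=> m; [exists m; left | exists (val m); right].
- rewrite card_bmnm -/(simplex_count n N).
  apply: leq_trans (leq_trans hN cJ); rewrite leq_mul2l leq_sub2l ?orbT //.
- exact: leq_trans pos cJ.
Qed.

End IdealFamily.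

(** * Relations between units *)

Section UnitRelations.
Variables (k : closedFieldType) (K : fieldType) (iota : {rmorphism k -> K}).
Local Notation place := (place iota).

(** In a relation of minimal support, omitting any one term leaves an independent family, so that
    all the Wronskians of these subfamilies are nonzero. *)
Lemma min_relation (I : finType) (w : I -> K) : ~ kfree iota w ->
  exists (r : nat) (s : 'I_r.+1 -> I) (c : 'I_r.+1 -> k),
  [/\ injective s, \sum_j iota (c j) * w (s j) = 0, forall j, c j != 0
    & forall j, kfree iota (w \o s \o lift j)].
Proof.
move=> nf.
pose supp (c : I -> k) := [pred i | c i != 0].
pose rel n := `[< exists c : I -> k, [/\ \sum_i iota (c i) * w i = 0,
  exists i, c i != 0 & #|supp c| = n] >].
have ex : exists n, rel n.
  apply: contrapT => no; apply: nf => c e i; apply: contrapT => /eqP ci.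
  by apply: no; exists #|supp c|; apply/asboolP; exists c; split=> //; exists i.
case: (ex_minnP ex) => n /asboolP[c [e [i0 ci0] cn]] cmin.
have [r er] : exists r, #|supp c| = r.+1.
  have : (0 < #|supp c|)%N by apply/card_gt0P; exists i0; rewrite inE.
  by case: #|_| => // r _; exists r.
pose s (j : 'I_r.+1) : I := enum_val (cast_ord (esym er) j).
have sinj : injective s by move=> j j' /enum_val_inj/cast_ord_inj.
have ssupp j : c (s j) != 0 by have := enum_valP (cast_ord (esym er) j); rewrite inE.
exists r, s, (c \o s); split=> //.
  rewrite -[RHS]e [RHS](bigID (fun i => i \in supp c)) /= [X in _ + X]big1 ?addr0; last first.
    by move=> i; rewrite inE negbK => /eqP ->; rewrite rmorph0 mul0r.
  rewrite [RHS]big_enum_val /=.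
  rewrite (reindex (cast_ord er)) /=; last by exists (cast_ord (esym er)) => j _; rewrite ?cast_ordK ?cast_ordKV.
  by apply: eq_bigr => j _; rewrite /s cast_ordK.
move=> j d ed; pose c' i := \sum_(x | s (lift j x) == i) d x.
have e' : \sum_i iota (c' i) * w i = 0.
  rewrite -[RHS]ed [RHS](partition_big (s \o lift j) xpredT) //=.
  apply: eq_bigr => i _; rewrite /c' rmorph_sum mulr_suml.
  by apply: eq_bigr => x /eqP <-.
have c'E x : c' (s (lift j x)) = d x.
  rewrite /c' (big_pred1 x) // => y; rewrite (inj_eq sinj).
  by rewrite (inj_eq (@lift_inj _ j)).
have lt : (#|supp c'| < #|supp c|)%N.
  apply: proper_card; apply/properP; split.
    apply/fintype.subsetP => i; rewrite !inE; apply: contraNneq => ci.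
    rewrite /c' big1 // => x /eqP sx; have := ssupp (lift j x).
    by rewrite sx ci eqxx.
  exists (s j); rewrite !inE //= negbK /c' big1 // => x.
  by rewrite (inj_eq sinj) eq_sym (negPf (neq_lift j x)).
move=> x; rewrite -c'E; apply: contrapT => /eqP nz.
have : rel #|supp c'| by apply/asboolP; exists c'; split=> //; exists (s (lift j x)).
by move/cmin; rewrite -cn leqNgt lt.
Qed.

Hypothesis HK : function_field_one_var iota.
Variables (genus : nat).
Hypothesis Hgenus : is_genus iota genus.
Variable D : K -> K.
Hypothesis DD : forall x y, D (x + y) = D x + D y.
Hypothesis DM : forall x y, D (x * y) = D x * y + x * D y.
Hypothesis Dc : forall c, D (iota c) = 0.
Hypothesis Dker : forall z, D z = 0 -> is_const iota z.
Variable lam : place -> int.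
Hypothesis hlam : divisor lam.
Hypothesis lam0 : forall p, 0 <= lam p.
Hypothesis hreg : forall f p i, vge p f 0 -> vge p (iter i D f) (- (i%:Z * lam p)).
Hypothesis hder : forall f p r i, vge p f r -> vge p (iter i D f) (r - i%:Z * (1 + lam p)).

Lemma sum_abs_ord x : deg (fun p : place => `|ord p x|) = 2 * height iota x.
Proof.
have -> : (fun p : place => `|ord p x|) = fun p => vpos (ord p x) + vpos (- ord p x).
  by apply/funext => p; rewrite /vpos; lia.
rewrite degD ?(height_zeros HK Hgenus); first by rewrite -[deg _]/(height iota x); lia.
  by apply: divisor_vpos; apply: divisor_ord HK _ Hgenus _.
exact: divisor_pole HK _ Hgenus _.
Qed.

Lemma divisor_abs x : divisor (fun p : place => `|ord p x|).
Proof. by apply: (divisor_comp (f := fun a => `|a|)) => //; apply: divisor_ord HK _ Hgenus _. Qed.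

(* Independence fails only through a relation of small height: in a minimal
   relation among functions with few zeros and poles all ratios have few poles. *)
Lemma height_ratio_le (I : finType) (w : I -> K) (Z : place -> int) :
  (forall i, w i != 0) -> divisor Z -> (forall p, lam p <= Z p) ->
  (forall p i, Z p = 0 -> ord p (w i) = 0) ->
  ~ kfree iota w -> exists (J : {pred I}) (c : I -> k),
  [/\ \sum_(i in J) iota (c i) * w i = 0, exists i, i \in J, forall i, i \in J -> c i != 0
    & forall i j, i \in J -> j \in J ->
      height iota (w i / w j) <= (2 * #|I| ^ 2)%:Z * deg Z].
Proof.
move=> w0 hZ lamZ wZ nf.
have Z0 p : 0 <= Z p by apply: le_trans (lam0 p) (lamZ p).
have [r [s [c [sinj e c0 free]]]] := min_relation nf.
pose f := w \o s.
pose W (j : 'I_r.+1) := wr D (f \o lift j).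
have Wn j : W j != 0 by apply: (wr_neq0 DD DM Dc Dker); apply: free.
have comb (j x : 'I_r.+1) : exists d : 'I_r -> k,
    f x = \sum_y iota (d y) * f (lift j y).
  have [y ->|->] := unliftP j x.
    exists (fun z => (z == y)%:R); rewrite (bigD1 y) //= eqxx rmorph1 mul1r big1 ?addr0 // => z.
    by move/negPf ->; rewrite rmorph0 mul0r.
  have cj0 : iota (c j) != 0 by rewrite fmorph_eq0.
  exists (fun y => - c (lift j y) / c j); apply: (mulfI cj0); rewrite mulr_sumr.
  apply/eqP; rewrite -subr_eq0 -sumrN -[X in _ == X]e (bigD1_ord j) //=; apply/eqP.
  congr (_ + _); apply: eq_bigr => y _.
  by rewrite mulrA -rmorphM [c j * _]mulrC divfK // rmorphN mulNr opprK.
have ordW (p : place) j j' : ord p (W j) = ord p (W j').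
  have [|_ ->//] := ord_wr_comb DD DM Dc (f := f \o lift j') p (Wn j).
  by move=> x; apply: comb.
(* All the [W j] have the same order at [p], and that of [W j] is at least the sum of the orders of
   the functions other than [f j], up to derivation losses. Hence one divisor [E] bounds the poles
   of every [f j], and its degree is known from the product formula. *)
pose E (p : place) := ord p (W ord0) - \sum_j ord p (f j) + (2 * #|I| ^ 2)%:Z * Z p.
have rI : (r.+1 <= #|I|)%N by rewrite -[r.+1]card_ord; apply: leq_card sinj.
have hE p j : - ord p (f j) <= E p.
  have [Zp|Zp] := eqVneq (Z p) 0.
    have f0 i : ord p (f i) = 0 by apply: wZ.
    rewrite /E Zp mulr0 addr0 f0 oppr0 big1 ?subr0 //.
    have lam00 : lam p = 0 by apply/eqP; rewrite eq_le lam0 -{1}Zp lamZ.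
    have := wr_vge_min DD DM Dc lam0 hreg (f := f \o lift ord0) (p := p) (e := 0).
    rewrite lam00 !mulr0 subr0 => h; apply: (vgeP (Wn ord0)); apply: h => x.
    by right; rewrite /= f0.
  have := wr_vge_sum lam0 hder (fun x => vge_ord p ((f \o lift j) x)).
  move/(vgeP (Wn j)); rewrite -/(W j) (ordW p j ord0) => h.
  rewrite /E (bigD1_ord j) //=.
  have : (r * r)%:Z * (1 + lam p) <= (2 * #|I| ^ 2)%:Z * Z p.
    have h1 : 1 <= Z p by rewrite -gtz0_ge1 lt_def Zp Z0.
    have : (r * r)%:Z * (1 + lam p) <= (#|I| * #|I|)%:Z * (2 * Z p).
      apply: ler_pM => //; [by have := lam0 p; lia | by rewrite lez_nat leq_mul // ltnW | by have := lamZ p; lia].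
    by rewrite -mulnn !PoszM; lia.
  have h' : \sum_x ord p (f (lift j x)) - (r * r)%:Z * (1 + lam p) <= ord p (W ord0) := h.
  move: h' => {}h.
  move: (\sum_x ord p (f (lift j x))) ((r * r)%:Z * (1 + lam p)) ((2 * #|I| ^ 2)%:Z * Z p) h.
  by move=> a b c' h1 h2; lia.
have hEd : divisor E.
  apply: divisorD; last exact: divisorZ.
  apply: divisorD; first exact: divisor_ord HK _ Hgenus _.
  by apply: divisorN; apply: divisor_sum => j; apply: divisor_ord HK _ Hgenus _.
have degE : deg E = (2 * #|I| ^ 2)%:Z * deg Z.
  rewrite /E degD ?degZ ?degB ?deg_sum ?(deg_ord HK Hgenus) //; first 1 last.
  - by move=> j; apply: divisor_ord HK _ Hgenus _.
  - exact: divisor_ord HK _ Hgenus _.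
  - by apply: divisor_sum => j; apply: divisor_ord HK _ Hgenus _.
  - apply: divisorD; first exact: divisor_ord HK _ Hgenus _.
    by apply: divisorN; apply: divisor_sum => j; apply: divisor_ord HK _ Hgenus _.
  - exact: divisorZ.
  by rewrite big1 ?subr0 ?add0r // => j _; rewrite (deg_ord HK Hgenus).
exists (fun i => i \in codom s).
exists (fun i => if [pick j | s j == i] is Some j then c j else 0).
have pickE j : [pick j' | s j' == s j] = Some j.
  case: pickP => [j' /eqP/sinj ->//|/(_ j)]; by rewrite eqxx.
split.
- rewrite -[RHS]e (eq_bigl (fun i => i \in imset s (mem (fun _ : 'I_r.+1 => true)))).
    by rewrite big_imset /= => [|x y _ _ /sinj//]; apply: eq_bigr => j _; rewrite pickE.
  move=> i; apply/codomP/imsetP => [[j ->]|[j _ ->]]; by exists j.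
- by exists (s ord0); apply: codom_f.
- by move=> i /codomP[j ->]; rewrite pickE.
move=> i j /codomP[x ->] /codomP[y ->].
(* The poles of [f x / f y] are bounded by E + div (f y), a divisor of the same degree as [E]; it is
   effective because [E] also bounds the poles of [f y]. *)
rewrite -degE -[X in _ <= X]addr0 -[X in _ <= _ + X](deg_ord HK Hgenus (f y)) -degD //.
  apply: deg_le => [||p]; first exact: divisor_pole HK _ Hgenus _.
    by apply: divisorD => //; apply: divisor_ord HK _ Hgenus _.
  rewrite ordM ?invr_eq0 // ordV.
  by have := hE p x; have := hE p y; rewrite /vpos /f /=; lia.
exact: divisor_ord HK _ Hgenus _.
Qed.

End UnitRelations.

(** * Independence of the terms, or a multiplicative relation *)

Section Dichotomy.
Variables (k : closedFieldType) (K : fieldType) (iota : {rmorphism k -> K}).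
Local Notation place := (place iota).
Hypothesis HK : function_field_one_var iota.
Variables (genus : nat).
Hypothesis Hgenus : is_genus iota genus.

(** [e] and [e'] are bases of L(D1) and L(D1 + Q). By equality in Riemann's theorem the dimensions
    differ by the degree of [Q], however large [D1] is made by adding multiples of a point. *)
Lemma moving_spaces (Q : place -> int) : divisor Q -> (forall p, 0 <= Q p) ->
  exists d1 : nat, forall B : nat, exists (d : nat) (e : 'I_d -> K) (e' : 'I_(d + d1) -> K),
  [/\ (B <= d)%N, kfree iota e, kfree iota e'
    & forall i x, (forall p, vge p x (- Q p)) -> exists c, e i * x = \sum_j iota (c j) * e' j].
Proof.
move=> hQ Q0; have [D0 hD0 eq0] := riemann_eq HK Hgenus.
have [P _] := place_exists HK Hgenus.
exists (absz (deg Q)) => B.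
pose b := (B + genus + absz (deg D0))%N.
pose D1 (p : place) := D0 p + dseq (nseq b P) p.
pose D2 (p : place) := D1 p + Q p.
have dseq0 s (p : place) : 0 <= dseq s p by [].
have hD1 : divisor D1 by apply: divisorD => //; apply: dseq_divisor.
have hD2 : divisor D2 by apply: divisorD.
have dimE E : divisor E -> (forall p, D0 p <= E p) -> exists N,
    ldim E N /\ N%:Z = deg E + 1 - genus%:Z.
  move=> hE le; have [N hN] := ldim_finite HK Hgenus hE; exists N; split=> //.
  have [_ ub] := eq0 E hE le; have h1 := ub N (proj1 hN).
  have [h _] := Hgenus; have := h E N hE hN; lia.
have [|d [hd ed]] := (dimE D1 hD1); first by move=> p; rewrite /D1 lerDl.
have [|d' [hd' ed']] := (dimE D2 hD2).
  by move=> p; rewrite /D2 /D1 -addrA lerDl addr_ge0.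
have degD1 : deg D1 = deg D0 + b%:Z.
  by rewrite /D1 degD ?deg_dseq ?size_nseq //; apply: dseq_divisor.
have degD2 : deg D2 = deg D1 + deg Q by rewrite /D2 degD.
have degQ : 0 <= deg Q by apply: deg_nneg.
have e_d' : d' = (d + absz (deg Q))%N by lia.
subst d'; have [e [he fe _]] := ldim_basis hd.
have [e' [he' fe' spans]] := ldim_basis hd'.
exists d, e, e'; split=> //; first by move: ed; rewrite degD1 /b; lia.
move=> i x hx; apply: spans; apply/in_LDP => p; rewrite opprD.
by apply: vgeM => //; move/in_LDP: (he i); apply.
Qed.

Section Family.
Variables (n : nat).

Definition mval (u : 'I_n -> K) (m : 'X_{1..n}) : K := \prod_i u i ^+ m i.

Lemma mval_neq0 u m : (forall i, u i != 0) -> mval u m != 0.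
Proof. by move=> u0; apply/prodf_neq0 => i _; rewrite expf_neq0. Qed.

Lemma ord_mval (p : place) u m : (forall i, u i != 0) ->
  ord p (mval u m) = \sum_i ord p (u i) *+ m i.
Proof.
move=> u0; rewrite ord_prod; last by move=> i; rewrite expf_neq0.
by apply: eq_bigr => i _; rewrite ordX.
Qed.

Lemma meval_mval (A : {mpoly K[n]}) u : A.@[u] = \sum_(m <- msupp A) A@_m * mval u m.
Proof. exact: mevalE. Qed.

Lemma meval_mulX (A : {mpoly K[n]}) a u : (A * 'X_[a]).@[u] = A.@[u] * mval u a.
Proof. by rewrite mevalM mevalX. Qed.

Lemma meval_wide (A : {mpoly K[n]}) u N : (msize A <= N)%N ->
  A.@[u] = \sum_(m : 'X_{1..n < N}) A@_m * mval u m.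
Proof.
move=> le; rewrite {1}(mpolywE le) raddf_sum /=; apply: eq_bigr => m _.
by rewrite mevalZ mevalX.
Qed.

(** The support of this divisor is [S]. Its degree bounds the number of points of [S] by the heights
    of the [g j], not of their powers. *)
Definition gsupp (g : 'I_n -> K) (p : place) : int := \sum_j `|ord p (g j)|.

Lemma gsupp_ge0 g p : 0 <= gsupp g p. Proof. exact: sumr_ge0. Qed.

Lemma gsupp0 g p : gsupp g p = 0 -> forall j, ord p (g j) = 0.
Proof.
move=> /eqP; rewrite psumr_eq0 // => /allP h j.
by have := h j (mem_index_enum _); rewrite normr_eq0 => /eqP.
Qed.

Lemma divisor_gsupp g : divisor (gsupp g).
Proof. by apply: divisor_sum => j; apply: divisor_abs HK _ Hgenus _. Qed.

Definition hmax (g : 'I_n -> K) : int := \big[Num.max/0]_(i < n) height iota (g i).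

Lemma height_le_hmax g i : height iota (g i) <= hmax g.
Proof. exact: (le_bigmax_seq 0 i predT (fun i => height iota (g i)) (mem_index_enum i)). Qed.

Lemma hmax_ge0 g : 0 <= hmax g. Proof. exact: bigmax_ge_id. Qed.

Lemma sum_height_le g : \sum_i height iota (g i) <= n%:Z * hmax g.
Proof.
apply: (@le_trans _ _ (\sum_(i < n) hmax g)); first by apply: ler_sum => i _; apply: height_le_hmax.
by rewrite sumr_const card_ord -mulr_natl natz.
Qed.

Lemma deg_gsupp_le g : deg (gsupp g) <= 2 * (n%:Z * hmax g).
Proof.
rewrite deg_sum; last by move=> j; apply: divisor_abs HK _ Hgenus _.
under eq_bigr do rewrite (sum_abs_ord HK Hgenus).
by rewrite -mulr_sumr ler_wpM2l // sum_height_le.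
Qed.

Lemma hmax_nonconst g : (exists i, ~ is_const iota (g i)) -> 1 <= n%:Z * hmax g.
Proof.
move=> [i hi]; have h1 : 1 <= hmax g.
  apply: le_trans (height_le_hmax g i); rewrite leNgt; apply/negP => h.
  by apply: hi; apply: height_lt1 HK _ Hgenus _ h.
have n1 : 1 <= n%:Z by rewrite lez_nat; case: (n) i {hi} => // -[].
by rewrite -[1]mulr1 ler_pM.
Qed.

Variable D : K -> K.
Hypothesis DD : forall x y, D (x + y) = D x + D y.
Hypothesis DM : forall x y, D (x * y) = D x * y + x * D y.
Hypothesis Dc : forall c, D (iota c) = 0.
Hypothesis Dker : forall z, D z = 0 -> is_const iota z.
Variable lam : place -> int.
Hypothesis hlam : divisor lam.
Hypothesis lam0 : forall p, 0 <= lam p.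
Hypothesis hreg : forall f p i, vge p f 0 -> vge p (iter i D f) (- (i%:Z * lam p)).
Hypothesis hder : forall f p r i, vge p f r -> vge p (iter i D f) (r - i%:Z * (1 + lam p)).

Definition csupp (I : finType) (a : I -> K) (p : place) : int := \sum_i `|ord p (a i)|.

Lemma csupp_ge0 (I : finType) (a : I -> K) p : 0 <= csupp a p. Proof. exact: sumr_ge0. Qed.

Lemma csupp_ge (I : finType) (a : I -> K) p i : `|ord p (a i)| <= csupp a p.
Proof. by rewrite /csupp (bigD1 i) //= lerDl sumr_ge0. Qed.

Lemma divisor_csupp (I : finType) (a : I -> K) : divisor (csupp a).
Proof. by apply: divisor_sum => j; apply: divisor_abs HK _ Hgenus _. Qed.

(** In a relation two terms have different exponents, and their ratio is, up to coefficients, the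
    [l]-th power of a monomial [y] in the [g i]. The height of the ratio is bounded independently of
    [l], so for large [l] that of [y] is below 1 and [y] is constant. *)
Lemma dichotomy (I : finType) (a : I -> K) (e : I -> 'X_{1..n}) (N : nat) :
  (forall i, a i != 0) -> (forall i, (mdeg (e i) <= N)%N) ->
  (forall c : I -> k, (forall x, \sum_(i | e i == x) iota (c i) * a i = 0) -> forall i, c i = 0) ->
  exists C : nat, forall (g : 'I_n -> K) (l : nat), (forall i, g i != 0) ->
    (exists i, ~ is_const iota (g i)) -> C%:Z * (n%:Z * hmax g) < l%:Z ->
    kfree iota (fun i => a i * mval (fun j => g j ^+ l) (e i)) \/
    exists x : 'I_n -> int, [/\ exists i, x i != 0, \sum_i `|x i| <= (2 * N)%:Z
      & is_const iota (\prod_i g i ^ x i)].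
Proof.
move=> a0 eN indep.
(* The first term comes from [height_ratio_le], the degree of [Z] being at most 2 + deg lam + deg
   (csupp a) times n max h(g_i); the double sum accounts for removing the coefficients from the
   ratio. *)
pose c1 : int := (2 * #|I| ^ 2)%:Z * (2 + deg lam + deg (csupp a))
  + \sum_i \sum_j height iota (a j / a i).
have hlamdeg : 0 <= deg lam by apply: deg_nneg.
have hcdeg : 0 <= deg (csupp a) by apply: deg_nneg; [apply: divisor_csupp | apply: csupp_ge0].
have hge0 x : 0 <= height iota x by apply: height_ge0 HK _ Hgenus _.
have c10 : 0 <= c1.
  by rewrite /c1 addr_ge0 // ?mulr_ge0 // ?sumr_ge0 // => [|i _]; [lia | apply: sumr_ge0].
exists (absz c1) => g l g0 gnc; rewrite gez0_abs // => hl.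
set u := fun j => g j ^+ l; set w := fun i => _.
have u0 j : u j != 0 by rewrite expf_neq0.
have w0 i : w i != 0 by rewrite mulf_neq0 ?mval_neq0.
have [|nf] := pselect (kfree iota w); first by left.
right.
pose Z (p : place) := gsupp g p + lam p + csupp a p.
have hZ : divisor Z.
  apply: divisorD; last exact: divisor_csupp.
  by apply: divisorD => //; apply: divisor_gsupp.
have lamZ p : lam p <= Z p.
  by rewrite /Z; have := gsupp_ge0 g p; have := csupp_ge0 a p; lia.
have wZ p i : Z p = 0 -> ord p (w i) = 0.
  move=> Zp; have h1 := gsupp_ge0 g p; have h2 := csupp_ge0 a p; have h3 := lam0 p.
  have h4 : gsupp g p = 0 by move: Zp; rewrite /Z; lia.
  have h5 : csupp a p = 0 by move: Zp; rewrite /Z; lia.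
  rewrite ordM ?mval_neq0 // ord_mval // big1 => [|j _].
    by have := csupp_ge a p i; rewrite h5; lia.
  by rewrite ordX (gsupp0 h4) mul0rn mul0rn.
have [J [c [rel [i0 Ji0] cJ hJ]]] :=
  height_ratio_le HK Hgenus DD DM Dc Dker lam0 hreg hder w0 hZ lamZ wZ nf.
(* If all exponents agreed, the common monomial could be factored out, leaving a relation among the
   [a i] that [indep] forbids. *)
have [i Ji ne] : exists2 i, i \in J & e i != e i0.
  apply: contrapT => no; have same i : i \in J -> e i = e i0.
    by move=> Ji; apply: contrapT => /eqP ne; apply: no; exists i.
  have := cJ i0 Ji0; suff : (if i0 \in J then c i0 else 0) = 0 by rewrite Ji0 => ->; rewrite eqxx.
  move: i0 {Ji0 no} same => i1 same.
  apply: (indep (fun i => if i \in J then c i else 0)) => x.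
  have [->|xe] := eqVneq x (e i1); last first.
    rewrite big1 // => i /eqP ex; case: ifP => [/same ei|_]; last by rewrite rmorph0 mul0r.
    by rewrite -ex ei eqxx in xe.
  have U0 := mval_neq0 (e i1) u0.
  apply: (mulfI U0); rewrite mulr0 -[RHS]rel mulr_sumr big_mkcond [RHS]big_mkcond /=.
  apply: eq_bigr => i _; case: (boolP (i \in J)) => [Ji|_]; last first.
    by rewrite rmorph0 mul0r mulr0 if_same.
  by rewrite (same _ Ji) eqxx /w (same _ Ji); ring.
(* A difference of two exponents of degree at most [N]: hence the bound 2N on the sum of absolute
   values. *)
pose x t := (e i t)%:Z - (e i0 t)%:Z.
exists x; split.
- apply: contrapT => no; case/eqP: ne; apply/mnmP => t.
  by apply: contrapT => h; apply: no; exists t; rewrite /x; lia.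
- apply: (@le_trans _ _ (\sum_t ((e i t)%:Z + (e i0 t)%:Z))).
    by apply: ler_sum => t _; rewrite /x; lia.
  rewrite big_split /= -!(big_morph Posz PoszD (erefl (Posz 0))) -!mdegE.
  by have := eN i; have := eN i0; lia.
set y := \prod_t _.
have y0 : y != 0 by apply/prodf_neq0 => t _; rewrite expfz_eq0 negb_and g0 orbT.
have yl : y ^+ l = (w i / w i0) * (a i0 / a i).
  have -> : w i / w i0 * (a i0 / a i) = mval u (e i) / mval u (e i0).
    by rewrite /w; have h1 := mval_neq0 (e i0) u0; have h2 := a0 i; have h3 := a0 i0;
      field; rewrite h1 h2 h3.
  rewrite /y /mval -prodrXl -prodf_div; apply: eq_bigr => t _.
  rewrite /x expfzDr ?g0 // -exprnP -exprnN expr_div_n /u -!exprM.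
  by rewrite ![(l * _)%N]mulnC.
apply: height_lt1 HK _ Hgenus _ _; rewrite ltNge; apply/negP => hy.
have h1 := hJ i i0 Ji Ji0.
have h2 : height iota (y ^+ l) <= height iota (w i / w i0) + height iota (a i0 / a i).
  by rewrite yl; apply: heightM HK _ Hgenus _ _ _ _; rewrite mulf_neq0 ?invr_eq0.
rewrite (heightX HK Hgenus) in h2.
have h3 : height iota (a i0 / a i) <= \sum_i \sum_j height iota (a j / a i).
  rewrite (bigD1 i) //= (bigD1 i0) //= -addrA lerDl addr_ge0 ?sumr_ge0 // => j _.
  exact: sumr_ge0.
have h4 := hmax_nonconst gnc.
have h5 : deg Z <= (2 + deg lam + deg (csupp a)) * (n%:Z * hmax g).
  have hgl : divisor (fun p => gsupp g p + lam p) by apply: divisorD => //; apply: divisor_gsupp.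
  rewrite /Z (degD hgl (divisor_csupp a)) (degD (divisor_gsupp g) hlam).
  rewrite mulrDl [(2 + _) * _]mulrDl.
  apply: lerD; last by rewrite ler_peMr.
  by apply: lerD; [apply: deg_gsupp_le | rewrite ler_peMr].
have : l%:Z <= c1 * (n%:Z * hmax g).
  apply: (@le_trans _ _ (l%:Z * height iota y)); first by rewrite ler_peMr.
  apply: le_trans h2 _; rewrite /c1 mulrDl; apply: lerD.
    apply: le_trans h1 _; rewrite -mulrA; apply: ler_wpM2l => //.
  apply: le_trans h3 _; rewrite ler_peMr // sumr_ge0 // => j _; exact: sumr_ge0.
by rewrite leNgt hl.
Qed.

End Family.
End Dichotomy.

(** * Gcd estimates *)

Section Estimates.
Variables (k : closedFieldType) (K : fieldType) (iota : {rmorphism k -> K}).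
Local Notation place := (place iota).
Hypothesis HK : function_field_one_var iota.
Variables (genus : nat).
Hypothesis Hgenus : is_genus iota genus.
Variable D : K -> K.
Hypothesis DD : forall x y, D (x + y) = D x + D y.
Hypothesis DM : forall x y, D (x * y) = D x * y + x * D y.
Hypothesis Dc : forall c, D (iota c) = 0.
Hypothesis Dker : forall z, D z = 0 -> is_const iota z.
Variable lam : place -> int.
Hypothesis hlam : divisor lam.
Hypothesis lam0 : forall p, 0 <= lam p.
Hypothesis hreg : forall f p i, vge p f 0 -> vge p (iter i D f) (- (i%:Z * lam p)).
Hypothesis hder : forall f p r i, vge p f r -> vge p (iter i D f) (r - i%:Z * (1 + lam p)).
Variable n : nat.
Local Notation gsupp := (gsupp (iota := iota)).
Local Notation csupp := (csupp (iota := iota)).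
Implicit Types (g u : 'I_n -> K) (A B : {mpoly K[n]}).

Let divord := divisor_ord HK Hgenus.

Definition mon A (i : 'I_(size (msupp A))) : 'X_{1..n} := nth 0%MM (msupp A) i.
Definition mco A (i : 'I_(size (msupp A))) : K := A@_(mon i).

Lemma mco_neq0 A i : mco (A := A) i != 0.
Proof. by rewrite -mcoeff_msupp mem_nth. Qed.

Lemma mon_inj A : injective (@mon A).
Proof.
move=> i j /eqP; rewrite nth_uniq ?msupp_uniq // => /eqP e.
exact: val_inj.
Qed.

Lemma meval_mon A u : A.@[u] = \sum_i mco i * mval u (mon (A := A) i).
Proof. by rewrite meval_mval (big_nth 0%MM) big_mkord. Qed.

Lemma mco_indep A (c : 'I_(size (msupp A)) -> k) :
  (forall x, \sum_(i | mon i == x) iota (c i) * mco i = 0) -> forall i, c i = 0.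
Proof.
move=> h i; have := h (mon i); rewrite (big_pred1 i) => [/eqP|j]; last first.
  by rewrite (inj_eq (@mon_inj A)).
by rewrite mulf_eq0 (negPf (mco_neq0 i)) orbF fmorph_eq0 => /eqP.
Qed.

Lemma kfree_sum_neq0 (I : finType) (w : I -> K) (i0 : I) : kfree iota w -> \sum_i w i != 0.
Proof.
move=> fw; apply/eqP => e; have /eqP : (1 : k) = 0.
  apply: (fw (fun=> 1) _ i0); rewrite -[RHS]e.
  by apply: eq_bigr => i _; rewrite rmorph1 mul1r.
by rewrite oner_eq0.
Qed.

Lemma meval_neq0 A g l : A != 0 ->
  kfree iota (fun i : 'I_(size (msupp A)) => mco i * mval (fun j => g j ^+ l) (mon i)) ->
  A.@[fun j => g j ^+ l] != 0.
Proof.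
rewrite -msupp_eq0 => A0 fw; rewrite meval_mon; apply: kfree_sum_neq0 fw.
by apply: (@Ordinal _ 0); case: (msupp A) A0.
Qed.

Lemma ord_powX_eq0 g l (p : place) : gsupp g p = 0 -> forall j, ord p (g j ^+ l) = 0.
Proof. by move=> h j; rewrite ordX (gsupp0 h) mul0rn. Qed.

Lemma ord_mval_eq0 g l m (p : place) : (forall j, g j != 0) -> gsupp g p = 0 ->
  ord p (mval (fun j => g j ^+ l) m) = 0.
Proof.
move=> g0 h; rewrite ord_mval; last by move=> j; rewrite expf_neq0.
by rewrite big1 // => j _; rewrite (ord_powX_eq0 _ h) mul0rn.
Qed.

(* Replacing the constant term of [A] by [A(u)] does not change the span, so the
   zeros of [A(u)] on the support of [u] contribute to the Wronskian. *)
Lemma proximity A g l : A@_0%MM != 0 -> (forall j, g j != 0) ->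
  let u := fun j => g j ^+ l in
  kfree iota (fun i : 'I_(size (msupp A)) => mco i * mval u (mon i)) ->
  deg (fun p : place => if gsupp g p == 0 then 0 else vpos (ord p A.@[u])) <=
  (2 * size (msupp A) ^ 2 + 1)%:Z * (deg (gsupp g) + deg lam + deg (csupp (@mco A))).
Proof.
move=> A0 g0 u fw; set M := size (msupp A).
set w := fun i => _ in fw.
have u0 j : u j != 0 by rewrite expf_neq0.
have w0 i : w i != 0 by rewrite mulf_neq0 ?mco_neq0 ?mval_neq0.
have m0 : 0%MM \in msupp A by rewrite mcoeff_msupp.
pose i0 : 'I_M := Ordinal (introT idP (eq_ind _ is_true m0 _ (esym (index_mem 0%MM (msupp A))))).
have mon0 : mon i0 = 0%MM by rewrite /mon nth_index.
have wi0 : w i0 = mco i0.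
  by rewrite /w mon0 /mval big1 ?mulr1 // => j _; rewrite mnm0E expr0.
pose fu := A.@[u]; have fuE : fu = \sum_i w i by rewrite /fu meval_mon.
have fu0 : fu != 0 by rewrite fuE; apply: kfree_sum_neq0 i0 fw.
have W0 : wr D w != 0 by exact: (wr_neq0 DD DM Dc Dker fw).
pose Z (p : place) := gsupp g p + lam p + csupp (@mco A) p.
have hZ : divisor Z.
  apply: divisorD; last exact: divisor_csupp HK _ Hgenus _ _.
  by apply: divisorD => //; apply: divisor_gsupp HK _ Hgenus _ _.
(* The right side has degree (2 M^2 + 1) deg Z by the product formula. The 2 M^2 pays for the
   derivations, as 1 + lam <= 2 Z on the support of [Z]; the extra 1 pays for the order of the
   replaced constant term. *)
have pt (p : place) : (if gsupp g p == 0 then 0 else vpos (ord p fu)) <=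
    ord p (wr D w) - \sum_i ord p (w i) + (2 * M ^ 2 + 1)%:Z * Z p.
  have h1 := gsupp_ge0 g p; have h2 := lam0 p; have h3 := csupp_ge0 (@mco A) p.
  have [Zp|Zp] := eqVneq (Z p) 0.
    have gp : gsupp g p = 0 by move: Zp; rewrite /Z; lia.
    have lp : lam p = 0 by move: Zp; rewrite /Z; lia.
    have cp : csupp (@mco A) p = 0 by move: Zp; rewrite /Z; lia.
    have ow i : ord p (w i) = 0.
      rewrite ordM ?mco_neq0 ?mval_neq0 // ord_mval_eq0 // addr0.
      by have := csupp_ge (@mco A) p i; rewrite cp; lia.
    rewrite gp eqxx Zp mulr0 addr0 big1 // subr0.
    have := wr_vge_min DD DM Dc lam0 hreg (f := w) (p := p) (e := 0).
    rewrite lp !mulr0 subr0 => h; apply: (vgeP W0); apply: h => x.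
    by right; rewrite ow.
  have Z1 : 1 <= Z p by move: Zp; rewrite /Z; lia.
  have loss : (M * M)%:Z * (1 + lam p) <= (2 * M ^ 2)%:Z * Z p.
    have -> : (2 * M ^ 2)%:Z * Z p = (M * M)%:Z * (2 * Z p) by rewrite -mulnn !PoszM; ring.
    by apply: ler_wpM2l => //; move: Z1; rewrite /Z; lia.
  have b1 := vgeP W0 (wr_vge_sum lam0 hder (fun x => vge_ord p (w x))).
  rewrite PoszD mulrDl mul1r.
  case: ifP => _; first by move: b1 loss; lia.
  have [ofu|ofu] := leP (ord p fu) 0.
    have -> : vpos (ord p fu) = 0 by rewrite /vpos; lia.
    by move: b1 loss; lia.
  pose f' i := if i == i0 then fu else w i.
  have [|Wf' oW] := ord_wr_comb DD DM Dc (f := f') (f' := w) p W0.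
    move=> i; have [->|ni] := eqVneq i i0; last first.
      exists (fun x => (x == i)%:R); rewrite (bigD1 i) //= eqxx rmorph1 mul1r big1 ?addr0.
        by rewrite /f' (negPf ni).
      by move=> x /negPf ->; rewrite rmorph0 mul0r.
    exists (fun x => if x == i0 then 1 else -1).
    rewrite (bigD1 i0) //= eqxx rmorph1 mul1r /f' eqxx fuE (bigD1 i0) //= -addrA.
    rewrite -big_split /= big1 ?addr0 // => x /negPf xi0.
    by rewrite xi0 rmorphN rmorph1 mulN1r addrN.
  have := vgeP Wf' (wr_vge_sum lam0 hder (fun x => vge_ord p (f' x))).
  rewrite oW (bigD1 i0) //= {1}/f' eqxx [\sum_i ord p (w i)](bigD1 i0) //= wi0.
  have -> : \sum_(i | i != i0) ord p (f' i) = \sum_(i | i != i0) ord p (w i).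
    by apply: eq_bigr => i /negPf ni; rewrite /f' ni.
  have := csupp_ge (@mco A) p i0; rewrite -/M => h4 h5.
  have -> : vpos (ord p fu) = ord p fu by rewrite /vpos; lia.
  have h6 : csupp (@mco A) p <= Z p by rewrite /Z; lia.
  have {}h5 : ord p fu + \sum_(i < M | i != i0) ord p (w i) - (M * M)%:Z * (1 + lam p)
    <= ord p (wr D w) := h5.
  have arith (f o s' W c z x y : int) : `|o| <= c -> f + s' - x <= W -> c <= z -> x <= y ->
    f <= W - (o + s') + (y + z) by lia.
  exact: arith h4 h5 h6 loss.
have dW : divisor (fun p : place => ord p (wr D w) - \sum_i ord p (w i)).
  by apply: divisorD; [apply: divord | apply: divisorN; apply: divisor_sum => i; apply: divord].
have degZE : deg Z = deg (gsupp g) + deg lam + deg (csupp (@mco A)).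
  have dg : divisor (gsupp g) by apply: divisor_gsupp HK _ Hgenus _ _.
  have dc : divisor (csupp (@mco A)) by apply: divisor_csupp HK _ Hgenus _ _.
  by rewrite /Z (degD (divisorD dg hlam) dc) (degD dg hlam).
rewrite -degZE -degZ //.
have -> : deg (fun p => (2 * M ^ 2 + 1)%:Z * Z p) =
    deg (fun p : place => ord p (wr D w) - \sum_i ord p (w i) + (2 * M ^ 2 + 1)%:Z * Z p).
  rewrite (degD dW (divisorZ _ hZ)) degB; try exact: divord; last first.
    by apply: divisor_sum => i; apply: divord.
  rewrite (deg_ord HK Hgenus) deg_sum; last by move=> i; apply: divord.
  by rewrite big1 ?subr0 ?add0r // => i _; rewrite (deg_ord HK Hgenus).
apply: deg_le pt; last by apply: divisorD => //; apply: divisorZ.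
have [T _ hT] := divisor_supp (divisor_vpos (divord fu)).
by apply: (@supp_divisor _ _ _ T) => p pT; rewrite hT // if_same.
Qed.

Section IdealValues.
Variables (A B : {mpoly K[n]}) (N : nat) (J : finType) (psi : J -> {mpoly K[n]}).
Hypothesis psi_free : mfree psi.
Hypothesis psi_size : forall j, (msize (psi j) <= N.+1)%N.
Hypothesis psiE : forall j, exists a, psi j = A * 'X_[a] \/ psi j = B * 'X_[a].

Definition coef_supp (p : place) : int := csupp (@mco A) p + csupp (@mco B) p.

Lemma divisor_coef_supp : divisor coef_supp.
Proof. by apply: divisorD; apply: divisor_csupp HK _ Hgenus _ _. Qed.

Lemma coef_supp_ge0 p : 0 <= coef_supp p.
Proof. by rewrite addr_ge0 ?csupp_ge0. Qed.

Lemma vge_mcoeff (P : {mpoly K[n]}) m (p : place) : vge p P@_m (- csupp (@mco P) p).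
Proof.
have [->|Pm] := eqVneq P@_m 0; first by left.
have hm : (index m (msupp P) < size (msupp P))%N by rewrite index_mem mcoeff_msupp.
right; have := csupp_ge (@mco P) p (Ordinal hm).
rewrite /mco /mon /= nth_index ?mcoeff_msupp //; lia.
Qed.

(** Monomial multiples of [A] and [B] have the same coefficients as [A] and [B]: a divisor
    independent of [N] serves for all [psi j]. *)
Lemma vge_psi_coef j m (p : place) : vge p (psi j)@_m (- coef_supp p).
Proof.
have [->|h] := eqVneq (psi j)@_m 0; first by left.
have c1 := csupp_ge0 (@mco A) p; have c2 := csupp_ge0 (@mco B) p.
have [a [e|e]] := psiE j; rewrite e in h *; have [m' ->] := mcoeff_mulX h.
  by apply: vgeW (vge_mcoeff A m' p); rewrite /coef_supp; lia.
by apply: vgeW (vge_mcoeff B m' p); rewrite /coef_supp; lia.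
Qed.

Variables (d d' : nat) (e : 'I_d -> K) (e' : 'I_d' -> K).
Hypothesis e_free : kfree iota e.
Hypothesis e_span : forall i x, (forall p, vge p x (- coef_supp p)) ->
  exists c, e i * x = \sum_j iota (c j) * e' j.

Local Notation I := ('I_d' * 'X_{1..n < N.+1})%type.
Let w u (i : I) : K := e' i.1 * mval u i.2.
Let f u (x : 'I_d * J) : K := e x.1 * (psi x.2).@[u].

(** Here the coefficients in [K] are traded for constants: each coefficient times [e] expands over
    [k] in [e'], and the constants [q] do not depend on [u]. *)
Lemma combination_coef : exists q : 'I_d * J -> I -> k,
  (forall x m, e x.1 * (psi x.2)@_(bmnm m) = \sum_b iota (q x (b, m)) * e' b) /\
  forall u x, f u x = \sum_i iota (q x i) * w u i.
Proof.
have /choice[q hq] (y : ('I_d * J) * 'X_{1..n < N.+1}) : exists c : 'I_d' -> k,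
    e y.1.1 * (psi y.1.2)@_y.2 = \sum_b iota (c b) * e' b.
  by apply: e_span => p; apply: vge_psi_coef.
exists (fun x i => q (x, i.2) i.1); split=> [x m|u x]; first exact: (hq (x, m)).
rewrite /f (meval_wide u (psi_size x.2)) mulr_sumr.
under eq_bigr => m _ do rewrite mulrA (hq (x, m)) mulr_suml.
rewrite exchange_big pair_big_dep /=; apply: eq_bigr => -[b m] _ /=.
by rewrite /w mulrA.
Qed.

(** By independence of the [w u i], a relation among the values already holds between the
    polynomials. Freeness of [psi] over [K] and then of [e] over [k] kills its coefficients. *)
Lemma kfree_combination u : kfree iota (w u) -> kfree iota (f u).
Proof.
move=> fw c ec; have [q [hq fE]] := combination_coef.
have q0 i : \sum_x c x * q x i = 0.
  apply: (fw (fun i => \sum_x c x * q x i)); rewrite -[RHS]ec.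
  under eq_bigr do rewrite rmorph_sum mulr_suml.
  rewrite exchange_big /=; apply: eq_bigr => x _; rewrite fE mulr_sumr.
  by apply: eq_bigr => i' _; rewrite rmorphM mulrA.
have psi0 : \sum_j (\sum_a iota (c (a, j)) * e a) *: psi j = 0.
  apply/mpolyP => m; rewrite mcoeff0 raddf_sum /=.
  have [hm|hm] := ltnP (mdeg m) N.+1; last first.
    rewrite big1 // => j _; rewrite mcoeffZ [(psi j)@_m]memN_msupp_eq0 ?mulr0 //.
    by apply: msize_mdeg_ge; apply: leq_trans (psi_size j) hm.
  pose m' := BMultinom hm; rewrite -[m]/(bmnm m').
  transitivity (\sum_x iota (c x) * (e x.1 * (psi x.2)@_m')).
    rewrite [RHS](eq_bigr (fun x => iota (c (x.1, x.2)) * (e x.1 * (psi x.2)@_m'))); last by case.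
    rewrite -(pair_bigA _ (fun a j => iota (c (a, j)) * (e a * (psi j)@_m'))) /= exchange_big /=.
    by apply: eq_bigr => j _; rewrite mcoeffZ mulr_suml; apply: eq_bigr => a _; rewrite mulrA.
  under eq_bigr do rewrite hq mulr_sumr.
  rewrite exchange_big big1 //= => b _.
  transitivity (iota (\sum_x c x * q x (b, m')) * e' b); last by rewrite q0 rmorph0 mul0r.
  by rewrite rmorph_sum mulr_suml; apply: eq_bigr => x _; rewrite rmorphM mulrA.
by case=> a j; apply: (e_free (c := fun a => c (a, j))); apply: (psi_free (a := fun j => _) psi0).
Qed.

Hypothesis e'_neq0 : forall i, e' i != 0.

Let M : nat := #|{: 'I_d * J}|.
Let codim : nat := (#|{: I}| - M)%N.
(** The terms pay, in order, for the derivations, for the poles of [e] and of the coefficients off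
    [S], for the orders of [e'] off [S] over all monomials, and for [e'] in the omitted functions on
    [S]. *)
Definition gcd_const : nat := (2 * M ^ 2 + M + #|{: 'X_{1..n < N.+1}}| + codim)%N.

Lemma ord_eval_ge (P : {mpoly K[n]}) g l (p : place) : (forall j, g j != 0) -> gsupp g p = 0 ->
  vge p P.@[fun j => g j ^+ l] (- csupp (@mco P) p).
Proof.
move=> g0 gp; rewrite meval_mval; apply: vge_sum => m _; apply: vgeMr; first exact: vge_mcoeff.
by right; rewrite ord_mval_eq0.
Qed.

(* Off the support of [g] the Wronskian of the [f u x] vanishes to order about
   [M * mingcd]; on the support its order is bounded below by that of all the [w u i], up to
   [codim] omitted terms. *)
Lemma gcd_bound g l : (forall j, g j != 0) -> let u := fun j => g j ^+ l in
  kfree iota (w u) -> A.@[u] != 0 -> B.@[u] != 0 ->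
  M%:Z * deg (fun p : place => if gsupp g p == 0 then mingcd p A.@[u] B.@[u] else 0) <=
  (codim * N)%:Z * \sum_t height iota (u t) +
  gcd_const%:Z * (deg (gsupp g) + deg lam + deg coef_supp + deg (csupp e) + deg (csupp e')).
Proof.
move=> g0 u fw A0 B0.
have u0 j : u j != 0 by rewrite expf_neq0.
have w0 i : w u i != 0 by rewrite mulf_neq0 ?mval_neq0.
pose h (y : 'I_M) := f u (enum_val y).
have fh : kfree iota h by apply: (kfree_inj (@enum_val_inj _ _)) (kfree_combination fw).
have W0 : wr D h != 0 by exact: (wr_neq0 DD DM Dc Dker fh).
pose Z (p : place) := gsupp g p + lam p + coef_supp p + csupp e p + csupp e' p.
pose U (p : place) := \sum_t vpos (ord p (u t)).
pose L (p : place) := if gsupp g p == 0 then mingcd p A.@[u] B.@[u] else 0.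
have dg : divisor (gsupp g) by apply: divisor_gsupp HK _ Hgenus _ _.
have dce : divisor (csupp e) by apply: divisor_csupp HK _ Hgenus _ _.
have dce' : divisor (csupp e') by apply: divisor_csupp HK _ Hgenus _ _.
have dcs := divisor_coef_supp.
have hZ : divisor Z by do 3!(apply: divisorD => //); apply: divisorD.
have hU : divisor U by apply: divisor_sum => t; apply: divisor_vpos; apply: divord.
have hL : divisor L.
  have [T _ hT] := divisor_supp (divord A.@[u]).
  apply: (@supp_divisor _ _ _ T) => p pT; rewrite /L /mingcd (negPf A0) (negPf B0) hT //.
  by case: ifP => // _; rewrite /vpos; lia.
have pt (p : place) : M%:Z * L p <= ord p (wr D h) - \sum_i ord p (w u i)
    + (codim * N)%:Z * U p + gcd_const%:Z * Z p.
  have h1 := gsupp_ge0 g p; have h2 := lam0 p; have h3 := coef_supp_ge0 p.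
  have h4 := csupp_ge0 e p; have h5 := csupp_ge0 e' p.
  have U0 : 0 <= U p by apply: sumr_ge0 => t _; apply: vpos_ge0.
  have Z0 : 0 <= Z p by rewrite /Z; lia.
  have kZ : gcd_const%:Z * Z p = (2 * M ^ 2)%:Z * Z p + M%:Z * Z p
      + #|{: 'X_{1..n < N.+1}}|%:Z * Z p + codim%:Z * Z p.
    by rewrite /gcd_const !PoszD; ring.
  rewrite /L; case: eqP => [gp|gp].
    have bl x : vge p (f u x) (mingcd p A.@[u] B.@[u] - coef_supp p - csupp e p).
      have he : vge p (e x.1) (- csupp e p) by right; have := csupp_ge e p x.1; lia.
      have := vgeP A0 (ord_eval_ge A l g0 gp); have := vgeP B0 (ord_eval_ge B l g0 gp).
      rewrite -/u => hb ha.
      have c1 := csupp_ge0 (@mco A) p; have c2 := csupp_ge0 (@mco B) p.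
      have mA : mingcd p A.@[u] B.@[u] - coef_supp p <= ord p A.@[u].
        by rewrite /mingcd (negPf A0) (negPf B0) /vpos /coef_supp; lia.
      have mB : mingcd p A.@[u] B.@[u] - coef_supp p <= ord p B.@[u].
        by rewrite /mingcd (negPf A0) (negPf B0) /vpos /coef_supp; lia.
      have um a : vge p (mval u a) 0 by right; rewrite ord_mval_eq0.
      rewrite addrC; apply: vgeM => //.
      have [a [ea|ea]] := psiE x.2; rewrite ea meval_mulX; apply: vgeMr => //; by right.
    have := vgeP W0 (wr_vge_min DD DM Dc lam0 hreg (fun y => bl (enum_val y))).
    have : \sum_i ord p (w u i) <= #|{: 'X_{1..n < N.+1}}|%:Z * csupp e' p.
      rewrite -(pair_bigA _ (fun b m => ord p (e' b * mval u (bmnm m)))) /= /csupp mulr_sumr.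
      apply: ler_sum => b _; apply: (@le_trans _ _ (\sum_(m : 'X_{1..n < N.+1}) `|ord p (e' b)|)).
        apply: ler_sum => m _; rewrite ordM ?mval_neq0 // ord_mval_eq0 // addr0; exact: ler_norm.
      by rewrite sumr_const -mulr_natl natz.
    have hm : #|{: 'X_{1..n < N.+1}}|%:Z * csupp e' p <= #|{: 'X_{1..n < N.+1}}|%:Z * Z p.
      by apply: ler_wpM2l => //; rewrite /Z; lia.
    have hM : M%:Z * (coef_supp p + csupp e p) <= M%:Z * Z p.
      by apply: ler_wpM2l => //; rewrite /Z; lia.
    have hM2 : (M * M)%:Z * lam p <= (2 * M ^ 2)%:Z * Z p.
      have -> : (2 * M ^ 2)%:Z * Z p = (M * M)%:Z * (2 * Z p) by rewrite -mulnn !PoszM; ring.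
      by apply: ler_wpM2l => //; rewrite /Z; lia.
    have hc : 0 <= codim%:Z * Z p by rewrite mulr_ge0.
    have hcU : 0 <= (codim * N)%:Z * U p by rewrite mulr_ge0.
    rewrite kZ => s1 s2.
    have arith (m x c1 c2 L2 Wp S a1 a2 a3 a4 a5 a6 : int) : S <= a1 -> a1 <= a2 ->
        x * (c1 + c2) <= a3 -> L2 <= a4 -> 0 <= a5 -> 0 <= a6 ->
        x * (m - c1 - c2) - L2 <= Wp -> x * m <= Wp - S + a6 + (a4 + a3 + a2 + a5).
      by rewrite !mulrBr mulrDr; lia.
    exact: arith s1 hm hM hM2 hc hcU s2.
  rewrite mulr0.
  have Zp1 : 1 <= gsupp g p by move: gp h1; lia.
  (* On [S] an omitted function loses at most the order of its [e'] plus [N] times the zeros of the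
     [u t], since the monomials have degree at most [N]. *)
  pose mu := csupp e' p + N%:Z * U p.
  have mu0 : 0 <= mu by rewrite addr_ge0 // mulr_ge0.
  have hmu i : ord p (w u i) <= mu.
    rewrite ordM ?mval_neq0 // ord_mval // lerD //.
      by apply: le_trans (csupp_ge e' p i.1); apply: ler_norm.
    rewrite /U mulr_sumr; apply: ler_sum => t _.
    apply: (@le_trans _ _ (vpos (ord p (u t)) *+ i.2 t)).
      by rewrite lerMn2r; apply/orP; right; rewrite /vpos; lia.
    rewrite -mulr_natl natz ler_wpM2r ?vpos_ge0 // lez_nat.
    by apply: leq_trans (_ : (mdeg i.2 <= N)%N); [rewrite mdegE (bigD1 t) //= leq_addr | have := bmdeg i.2].
  have [q [_ fE]] := combination_coef.
  have := vgeP W0 (wr_vge_comb DD DM Dc lam0 hder (w := w u) (f := h) (p := p) _ w0 mu0 hmu).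
  have hspan y : exists Q : I -> k, h y = \sum_i iota (Q i) * w u i.
    by exists (q (enum_val y)); rewrite /h fE.
  move=> /(_ hspan).
  have hM2 : (M * M)%:Z * (1 + lam p) <= (2 * M ^ 2)%:Z * Z p.
    have -> : (2 * M ^ 2)%:Z * Z p = (M * M)%:Z * (2 * Z p) by rewrite -mulnn !PoszM; ring.
    by apply: ler_wpM2l => //; rewrite /Z; lia.
  have hc : codim%:Z * csupp e' p <= codim%:Z * Z p by apply: ler_wpM2l => //; rewrite /Z; lia.
  have hM : 0 <= M%:Z * Z p by rewrite mulr_ge0.
  have hm : 0 <= #|{: 'X_{1..n < N.+1}}|%:Z * Z p by rewrite mulr_ge0.
  rewrite kZ -[(_ - M)%N]/codim /mu mulrDr mulrA -PoszM => s1.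
  have arith (S c v L2 Wp a1 a2 a3 a4 : int) : S - (c + v) - L2 <= Wp -> L2 <= a4 -> c <= a1 ->
      0 <= a2 -> 0 <= a3 -> 0 <= Wp - S + v + (a4 + a3 + a2 + a1) by lia.
  exact: arith s1 hM2 hc hm hM.
have dW : divisor (fun p : place => ord p (wr D h) - \sum_i ord p (w u i)).
  by apply: divisorD; [apply: divord | apply: divisorN; apply: divisor_sum => i; apply: divord].
have degWE : deg (fun p : place => ord p (wr D h) - \sum_i ord p (w u i)) = 0.
  rewrite degB; try exact: divord; last by apply: divisor_sum => i; apply: divord.
  rewrite (deg_ord HK Hgenus) deg_sum; last by move=> i; apply: divord.
  by rewrite big1 ?subr0 // => i _; rewrite (deg_ord HK Hgenus).
have degUE : deg U = \sum_t height iota (u t).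
  rewrite deg_sum; last by move=> t; apply: divisor_vpos; apply: divord.
  by apply: eq_bigr => t _; rewrite (height_zeros HK Hgenus).
have degZE : deg Z = deg (gsupp g) + deg lam + deg coef_supp + deg (csupp e) + deg (csupp e').
  have d1 := divisorD dg hlam; have d2 := divisorD d1 dcs; have d3 := divisorD d2 dce.
  by rewrite /Z (degD d3 dce') (degD d2 dce) (degD d1 dcs) (degD dg hlam).
have dUZ := divisorZ (codim * N)%:Z hU; have dZZ := divisorZ gcd_const%:Z hZ.
have tot : deg (fun p : place => ord p (wr D h) - \sum_i ord p (w u i) +
    ((codim * N)%:Z * U p + gcd_const%:Z * Z p)) =
    (codim * N)%:Z * deg U + gcd_const%:Z * deg Z.
  by rewrite (degD dW (divisorD dUZ dZZ)) degWE add0r (degD dUZ dZZ) !degZ.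
rewrite -degZE -degUE -tot -degZ //.
apply: deg_le => [||p]; first exact: divisorZ.
  by apply: divisorD => //; apply: divisorD.
by rewrite addrA; apply: pt.
Qed.

End IdealValues.

Section Smallness.
Variable R : realType.

Definition mult_dependent g (m : nat) : Prop := exists x : 'I_n -> int,
  [/\ exists i, x i != 0, \sum_i `|x i| <= (2 * m)%:Z & is_const iota (\prod_i g i ^ x i)].

Lemma mult_dependentW g m m' : (m <= m')%N -> mult_dependent g m -> mult_dependent g m'.
Proof. by move=> le [x [h1 h2 h3]]; exists x; split=> //; apply: le_trans h2 _; lia. Qed.

Local Notation hmax := (hmax iota).

Lemma hmax_ge1 g : (exists i, ~ is_const iota (g i)) -> 1 <= hmax g.
Proof.
move=> /(hmax_nonconst HK Hgenus); have := hmax_ge0 iota g.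
move: (hmax g) => h h0 h1; rewrite leNgt; apply/negP => hlt.
have h00 : h = 0 by lia.
by move: h1; rewrite h00 mulr0.
Qed.

Lemma lt_const_height (C c2 : R) (X : int) (l : nat) : 0 <= X -> C <= c2 ->
  c2 * X%:~R < l%:R -> C * X%:~R < l%:R.
Proof. by move=> X0 le; apply: le_lt_trans; rewrite ler_wpM2r // ler0z. Qed.

Lemma lt_nat_height (C : nat) (c2 : R) (X : int) (l : nat) : 0 <= X -> C%:R <= c2 ->
  c2 * X%:~R < l%:R -> C%:Z * X < l%:Z.
Proof.
move=> X0 le /(lt_const_height X0 le); rewrite -(ltr_int R) intrM.
by rewrite -!pmulrn.
Qed.

(** The error is at most kappa (2 + c0) X, which does not involve [l]; the threshold on [l] makes
    this smaller than eps l. *)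
Lemma absorb (eps : R) (kappa c0 X h q : int) (l : nat) : 0 < eps -> 0 <= kappa -> 0 <= c0 ->
  1 <= X -> 1 <= h -> q <= 2 * X ->
  (kappa * (2 + c0))%:~R / eps * X%:~R < l%:R ->
  (kappa * (q + c0))%:~R <= eps * (l%:R * h%:~R).
Proof.
move=> e0 k0 c00 X1 h1 hq hl.
apply: (@le_trans _ _ (kappa * (2 + c0) * X)%:~R).
  rewrite ler_int -mulrA ler_wpM2l // mulrDl lerD //.
  by rewrite -[X in X <= _]mulr1 ler_wpM2l.
rewrite intrM; apply: (@le_trans _ _ (eps * l%:R)).
  by rewrite -ler_pdivrMl // mulrA [eps^-1 * _]mulrC ltW.
rewrite ler_wpM2l ?(ltW e0) // ler_peMr // -[1]/(1%:~R) ler_int //.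
Qed.

Lemma mon_dichotomy A : A != 0 -> exists C : nat, forall g (l : nat), (forall i, g i != 0) ->
  (exists i, ~ is_const iota (g i)) -> C%:Z * (n%:Z * hmax g) < l%:Z ->
  kfree iota (fun i : 'I_(size (msupp A)) => mco i * mval (fun j => g j ^+ l) (mon i)) \/
  mult_dependent g (msize A).
Proof.
move=> A0; apply: (dichotomy HK Hgenus DD DM Dc Dker hlam lam0 hreg hder).
- exact: mco_neq0.
- by move=> i; apply: ltnW; apply: msize_mdeg_lt; apply: mem_nth.
- exact: mco_indep.
Qed.

(** The nonvanishing of the value is asserted whatever the constant term, because [gcd_small] takes
    it as a premise. *)
Lemma proximity_small A (eps : R) : 0 < eps -> A != 0 ->
  exists (m : nat) (c : R), forall g (l : nat), (forall i, g i != 0) ->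
    (exists i, ~ is_const iota (g i)) -> c * (n%:Z * hmax g)%:~R < l%:R ->
    mult_dependent g m \/ (A.@[fun j => g j ^+ l] != 0 /\ (A@_0%MM != 0 ->
      (deg (fun p : place => if gsupp g p == 0 then 0 else vpos (ord p A.@[fun j => g j ^+ l])))%:~R
      <= eps * (l%:R * (hmax g)%:~R))).
Proof.
move=> e0 A0; have [C hC] := mon_dichotomy A0.
pose kappa := (2 * size (msupp A) ^ 2 + 1)%:Z.
pose c0 : int := deg lam + deg (csupp (@mco A)).
have dl : 0 <= deg lam by apply: deg_nneg.
have dc : 0 <= deg (csupp (@mco A)).
  by apply: deg_nneg; [apply: divisor_csupp HK _ Hgenus _ _ | apply: csupp_ge0].
have c00 : 0 <= c0 by rewrite addr_ge0.
have kc0 : 0 <= (kappa * (2 + c0))%:~R / eps :> R.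
  by rewrite divr_ge0 ?(ltW e0) // ler0z mulr_ge0 // addr_ge0.
exists (msize A), (C%:R + (kappa * (2 + c0))%:~R / eps) => g l g0 gnc hl.
have X1 := hmax_nonconst HK Hgenus gnc; have X0 : 0 <= n%:Z * hmax g by apply: le_trans X1.
have hCl : C%:Z * (n%:Z * hmax g) < l%:Z by apply: lt_nat_height hl; rewrite ?lerDl.
have [fw|h] := hC g l g0 gnc hCl; last by left.
right; split; first exact: meval_neq0 fw.
move=> A00; have := proximity A00 g0 fw.
rewrite -(ler_int R) -addrA => h; apply: le_trans h _.
apply: (absorb (X := n%:Z * hmax g)) => //.
- exact: hmax_ge1 gnc.
- exact: deg_gsupp_le HK _ Hgenus _ _.
- by apply: lt_const_height hl => //; rewrite lerDr.
Qed.

Lemma gcd_small A B (eps : R) : 0 < eps -> A != 0 -> B != 0 -> mcoprime A B ->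
  exists (m : nat) (c : R), forall g (l : nat), (forall i, g i != 0) ->
    (exists i, ~ is_const iota (g i)) -> c * (n%:Z * hmax g)%:~R < l%:R ->
    let u := fun j => g j ^+ l in A.@[u] != 0 -> B.@[u] != 0 ->
    mult_dependent g m \/
      (deg (fun p : place => if gsupp g p == 0 then mingcd p A.@[u] B.@[u] else 0))%:~R
      <= eps * (l%:R * (hmax g)%:~R).
Proof.
move=> e0 A0 B0 cop.
(* The main term will be n codim N / M times l max h(g_i), and codim N / M <= 2 / C; this [C] makes
   it at most eps / 2. *)
pose C := (Num.truncn (4 * n%:R / eps)).+1.
have hCe : 4 * n%:R <= eps * C%:R.
  rewrite -ler_pdivrMl // mulrC; apply: ltW; rewrite /C; apply: truncnS_gt.
have [N [J [psi [pfree psize pE hN J0]]]] := ideal_family cop A0 B0 (isT : 0 < C)%N.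
have [d1 hd1] := moving_spaces HK Hgenus (divisor_coef_supp A B) (coef_supp_ge0 A B).
pose b := #|{: 'X_{1..n < N.+1}}|.
(* The [d1] additional functions, times all monomials, contribute C b N d1 to C N codim. This is
   less than [d], hence at most [M]; the contribution of the missing polynomials is also at most
   [M]. *)
have [d [e [e' [hd fe fe' hspan]]]] := hd1 (C * b * N * d1 + 1)%N.
have e'_neq0 i : e' i != 0 by apply: kfree_neq0 fe'.
pose I := ('I_(d + d1) * 'X_{1..n < N.+1})%type.
have [|||C1 hC1] := dichotomy HK Hgenus DD DM Dc Dker hlam lam0 hreg hder
  (a := fun i : I => e' i.1) (e := fun i : I => bmnm i.2) (N := N).
- by move=> i; apply: e'_neq0.
- by move=> i; have := bmdeg i.2.
- move=> c hc [a m]; apply: (fe' (fun a => c (a, m))).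
  rewrite -[RHS](hc (bmnm m)) [RHS]big_mkcond /=.
  rewrite [RHS](eq_bigr (fun i : I => if bmnm i.2 == bmnm m
    then iota (c (i.1, i.2)) * e' i.1 else 0)); last by case.
  rewrite -(pair_bigA _ (fun a (m' : 'X_{1..n < N.+1}) => if bmnm m' == bmnm m
    then iota (c (a, m')) * e' a else 0)) /=.
  by apply: eq_bigr => a' _; rewrite -big_mkcond (big_pred1 m).
pose M := #|{: 'I_d * J}|; pose codim := (#|{: I}| - M)%N.
have hcodim : (C * (codim * N) <= 2 * M)%N.
  rewrite /codim /M !card_prod !card_ord -/b; set j := #|J| in J0 hN *.
  have h1 : ((d + d1) * b - d * j <= d * (b - j) + d1 * b)%N.
    by rewrite mulnDl mulnBr; lia.
  have h2 : (d * (C * N * (b - j)) <= d * j)%N by rewrite leq_mul2l hN orbT.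
  have h3 : (d <= d * j)%N by rewrite leq_pmulr.
  apply: (@leq_trans (C * ((d * (b - j) + d1 * b) * N))%N).
    by rewrite leq_mul2l leq_mul2r h1 !orbT.
  have -> : (C * ((d * (b - j) + d1 * b) * N) = d * (C * N * (b - j)) + C * b * N * d1)%N by ring.
  by lia.
have M0 : (0 < M)%N by rewrite /M card_prod card_ord muln_gt0 J0 andbT; lia.
pose kappa := (gcd_const N J d (d + d1))%:Z.
pose c0 : int := deg lam + deg (coef_supp A B) + deg (csupp e) + deg (csupp e').
have dl : 0 <= deg lam by apply: deg_nneg.
have dcs (I' : finType) (a : I' -> K) : 0 <= deg (csupp a).
  by apply: deg_nneg; [apply: divisor_csupp HK _ Hgenus _ _ | apply: csupp_ge0].
have dco : 0 <= deg (coef_supp A B).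
  by apply: deg_nneg; [exact: (divisor_coef_supp A B) | exact: coef_supp_ge0].
have c00 : 0 <= c0 by rewrite /c0 !addr_ge0.
have e20 : 0 < eps / 2 by rewrite divr_gt0.
have kc0 : 0 <= (kappa * (2 + c0))%:~R / (eps / 2) :> R.
  by rewrite divr_ge0 ?(ltW e20) // ler0z mulr_ge0 // addr_ge0.
exists N, (C1%:R + (kappa * (2 + c0))%:~R / (eps / 2)) => g l g0 gnc hl u fA fB.
have X1 := hmax_nonconst HK Hgenus gnc; have X0 : 0 <= n%:Z * hmax g by apply: le_trans X1.
have hC1l : C1%:Z * (n%:Z * hmax g) < l%:Z by apply: lt_nat_height hl; rewrite ?lerDl.
have [fw|h] := hC1 g l g0 gnc hC1l; last by left.
right; have := gcd_bound pfree psize pE fe hspan e'_neq0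
  g0 fw fA fB.
set NS := deg _; rewrite -/M -/codim -!addrA => hb.
have hsum : \sum_t height iota (u t) <= l%:Z * (n%:Z * hmax g).
  under eq_bigr do rewrite /u (heightX HK Hgenus).
  by rewrite -mulr_sumr ler_wpM2l // sum_height_le.
have small : (kappa * (deg (gsupp g) + c0))%:~R <= eps / 2 * (l%:R * (hmax g)%:~R).
  apply: (absorb (X := n%:Z * hmax g)) => //.
  - exact: hmax_ge1 gnc.
  - exact: deg_gsupp_le HK _ Hgenus _ _.
  - by apply: lt_const_height hl => //; rewrite lerDr.
have hM : M%:R * NS%:~R <= (codim * N)%:R * (l%:R * (n%:R * (hmax g)%:~R))
    + (kappa * (deg (gsupp g) + c0))%:~R :> R.
  apply: (@le_trans _ _ ((codim * N)%:Z * (l%:Z * (n%:Z * hmax g))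
    + kappa * (deg (gsupp g) + c0))%:~R).
    rewrite [X in X * _ <= _]pmulrn -intrM ler_int; apply: le_trans hb _.
    by rewrite /c0 -!addrA lerD2r ler_wpM2l.
  by rewrite intrD !intrM -!pmulrn.
set LH := l%:R * (hmax g)%:~R in small *.
have LH0 : 0 <= LH by rewrite mulr_ge0 // ler0z hmax_ge0.
have M0r : 0 < M%:R :> R by rewrite ltr0n.
rewrite -(ler_pM2l M0r); apply: le_trans hM _.
have hmain : (codim * N)%:R * n%:R <= M%:R * (eps / 2) :> R.
  have hc : (C * (codim * N))%:R <= (2 * M)%:R :> R by rewrite ler_nat.
  rewrite !natrM in hc *.
  have q0 : 0 <= codim%:R * N%:R :> R by rewrite mulr_ge0.
  have : (4 * n%:R) * (codim%:R * N%:R) <= eps * C%:R * (codim%:R * N%:R) :> R.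
    by rewrite ler_wpM2r.
  have : eps * (C%:R * (codim%:R * N%:R)) <= eps * (2 * M%:R) by rewrite ler_wpM2l // ltW.
  by lra.
have -> : M%:R * (eps * LH) = M%:R * (eps / 2) * LH + M%:R * (eps / 2 * LH).
  by field.
apply: lerD.
  have -> : (codim * N)%:R * (l%:R * (n%:R * (hmax g)%:~R)) = (codim * N)%:R * n%:R * LH.
    by rewrite /LH; ring.
  by rewrite ler_wpM2r.
apply: le_trans small _; rewrite ler_peMl ?ler1n // mulr_ge0 // ltW //.
Qed.

End Smallness.

End Estimates.

(** * From degrees to the sums of the statement *)

Section Sums.
Variables (k : closedFieldType) (K : fieldType) (iota : {rmorphism k -> K}).
Local Notation place := (place iota).

Lemma psum_deg (S : set place) (phi : place -> int) :
  psum S phi = deg (fun p => if p \in S then phi p else 0).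
Proof. by rewrite /deg /psum fsbig_mkcond. Qed.

Lemma gsupp_eq0 n (g : 'I_n -> K) (p : place) :
  (p \in ~` ((fun q => exists i, ord q (g i) != 0) : set place)) = (gsupp g p == 0).
Proof.
apply/idP/eqP => [|h].
  rewrite in_setE => no; apply: big1 => i _; apply/eqP; rewrite normr_eq0.
  by apply: contrapT => /negP h; apply: no; exists i.
by rewrite in_setE => -[i]; rewrite (gsupp0 h) eqxx.
Qed.

Lemma hmaxX n (g : 'I_n -> K) (l : nat) : function_field_one_var iota ->
  forall genus, is_genus iota genus ->
  hmax iota (fun i => g i ^+ l) = l%:Z * hmax iota g.
Proof.
move=> HK genus Hg; rewrite /hmax (big_morph (fun x => l%:Z * x) (id1 := 0) (op1 := Num.max)).
- by apply: eq_bigr => i _; rewrite (heightX HK Hg).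
- by move=> x y; rewrite maxr_pMr.
- by rewrite mulr0.
Qed.

Lemma meval_at0 n (A : {mpoly K[n]}) : A.@[fun _ => 0] != 0 -> A@_0%MM != 0.
Proof.
apply: contraNneq => A0; rewrite mevalE big1_seq // => m /andP[_ hm].
have [i mi] : exists i, m i != 0%N.
  apply: contrapT => /forallNP h; move: hm; rewrite mcoeff_msupp => /eqP[].
  suff -> : m = 0%MM by [].
  by apply/mnmP => i; rewrite mnm0E; apply/eqP; apply: contrapT => /negP; apply: h.
by rewrite (bigD1 i) //= expr0n (negPf mi) mul0r mulr0.
Qed.

Lemma mingcd_le (p : place) x y : x != 0 -> y != 0 ->
  mingcd p x y <= vpos (ord p x) /\ mingcd p x y <= vpos (ord p y).
Proof. by move=> /negPf x0 /negPf y0; rewrite /mingcd x0 y0; lia. Qed.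

Lemma divisor_mingcd x y : function_field_one_var iota ->
  forall genus, is_genus iota genus -> x != 0 -> y != 0 ->
  divisor (fun p : place => mingcd p x y).
Proof.
move=> HK genus Hg /negPf x0 /negPf y0.
have [T _ hT] := divisor_supp (divisor_ord HK Hg x).
apply: (@supp_divisor _ _ _ T) => p pT; rewrite /mingcd x0 y0 hT //.
by rewrite /vpos; lia.
Qed.

End Sums.

Local Close Scope classical_set_scope.

Theorem theorem1p6 (R : realType) (k : closedFieldType) (Hk : [pchar k] =i pred0)
  (K : fieldType) (iota : {rmorphism k -> K}) (HK : function_field_one_var iota)
  (genus : nat) (Hgenus : is_genus iota genus)
  (n : nat) (F G : {mpoly K[n]})
  (HF : ~ mconst F) (HG : ~ mconst G) (HFG : mcoprime F G)
  (eps : R) (Heps : 0 < eps) :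
  exists (m : nat) (c1 c2 : R),
    forall g : 'I_n -> K,
      (forall i, g i != 0) ->
      (exists i, ~ is_const iota (g i)) ->
      let S : set (place iota) := fun p => exists i, ord p (g i) != 0 in
      forall l : nat, (0 < l)%N ->
        c1 * (htilde iota F + htilde iota G)%:~R
          + c2 * (genus%:R + n%:R * (\big[Num.max/0]_(i < n) height iota (g i))%:~R)
          < l%:R ->
        (exists e : 'I_n -> int,
            [/\ exists i, e i != 0,
                \sum_i `|e i| <= (2 * m)%:Z
              & is_const iota (\prod_i g i ^ e i)])
        \/
        (let f1 := F.@[fun i => g i ^+ l] in
         let f2 := G.@[fun i => g i ^+ l] in
         let H : R := (\big[Num.max/0]_(i < n) height iota (g i ^+ l))%:~R in
         NSgcd_le S f1 f2 (eps * H)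
         /\ ((F.@[fun _ => 0] != 0 \/ G.@[fun _ => 0] != 0) ->
             hgcd_le iota f1 f2 (eps * H))).
Proof.
have F0 : F != 0 by apply/eqP => e; apply: HF; exists 0; rewrite e mpolyC0.
have G0 : G != 0 by apply/eqP => e; apply: HG; exists 0; rewrite e mpolyC0.
have [D [DD DM Dc Dker]] := derivation_exists Hk HK.
have [lam [hlam lam0 hreg hder]] := der_iter_bound HK Hgenus DD DM Dc.
(* One half for the places outside [S], the other for those in [S]. *)
have e2 : 0 < eps / 2 by rewrite divr_gt0.
have [mF [cF hF]] := proximity_small HK Hgenus DD DM Dc Dker hlam lam0 hreg hder e2 F0.
have [mG [cG hG]] := proximity_small HK Hgenus DD DM Dc Dker hlam lam0 hreg hder e2 G0.
have [mN [cN hN]] := gcd_small HK Hgenus DD DM Dc Dker hlam lam0 hreg hder e2 F0 G0 HFG.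
pose c2 : R := `|cF| + `|cG| + `|cN|.
have nF := normr_ge0 cF; have nG := normr_ge0 cG; have nN := normr_ge0 cN.
have lF : cF <= c2 by apply: le_trans (ler_norm _) _; rewrite /c2; lra.
have lG : cG <= c2 by apply: le_trans (ler_norm _) _; rewrite /c2; lra.
have lN : cN <= c2 by apply: le_trans (ler_norm _) _; rewrite /c2; lra.
have c20 : 0 <= c2 by rewrite /c2; lra.
(* The constants may depend on [F] and [G], so no multiple of their heights is needed. *)
exists (mF + mG + mN)%N, 0, c2 => g g0 gnc S l l0.
rewrite mul0r add0r -/(hmax iota g) => hl.
have X1 := hmax_nonconst HK Hgenus gnc; have X0 : 0 <= n%:Z * hmax iota g by apply: le_trans X1.
have {}hl : c2 * (n%:Z * hmax iota g)%:~R < l%:R.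
  apply: le_lt_trans hl; rewrite mulrDr intrM -pmulrn lerDr mulr_ge0 //.
have dep m : (m <= mF + mG + mN)%N -> mult_dependent iota g m -> exists e : 'I_n -> int,
    [/\ exists i, e i != 0, \sum_i `|e i| <= (2 * (mF + mG + mN))%:Z
      & is_const iota (\prod_i g i ^ e i)].
  exact: mult_dependentW.
have hlF := lt_const_height X0 lF hl.
have [h|[f10 pF]] := hF g l g0 gnc hlF.
  by left; apply: dep h; rewrite -addnA leq_addr.
have hlG := lt_const_height X0 lG hl.
have [h|[f20 pG]] := hG g l g0 gnc hlG.
  by left; apply: dep h; rewrite addnAC leq_addl.
have hlN := lt_const_height X0 lN hl.
have [h|hmain] := hN g l g0 gnc hlN f10 f20.
  by left; apply: dep h; rewrite leq_addl.
right=> f1 f2 H; rewrite -/f1 in f10 pF hmain; rewrite -/f2 in f20 pG hmain.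
have HE : H = l%:R * (hmax iota g)%:~R.
  by rewrite /H -/(hmax iota (fun i => g i ^+ l)) (hmaxX g l HK Hgenus) intrM -pmulrn.
rewrite -HE in pF pG hmain.
have H0 : 0 <= H by rewrite HE mulr_ge0 // ler0z hmax_ge0.
have nz : ~ (f1 = 0 /\ f2 = 0) by case=> e; rewrite e eqxx in f10.
split; first split=> //.
  rewrite psum_deg; under eq_fun do rewrite gsupp_eq0.
  apply: le_trans hmain _; rewrite ler_wpM2r //; lra.
move=> h0; split=> //.
have dming := divisor_mingcd HK Hgenus f10 f20.
have dif (b : place iota -> bool) (phi : place iota -> int) : divisor phi ->
    divisor (fun p => if b p then phi p else 0) /\ divisor (fun p => if b p then 0 else phi p).
  move=> /divisor_supp[T _ hT].
  by split; apply: (@supp_divisor _ _ _ T) => p pT; rewrite hT // if_same.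
(* On [S] the gcd is bounded by the zeros of whichever of [f1], [f2] comes from a polynomial with
   nonzero constant term; outside, [hmain] applies. *)
have fin (f : K) : (forall p : place iota, mingcd p f1 f2 <= vpos (ord p f)) ->
    (deg (fun p : place iota => if gsupp g p == 0 then 0 else vpos (ord p f)))%:~R <= eps / 2 * H ->
    (psum [set: place iota] (fun p => mingcd p f1 f2))%:~R <= eps * H.
  move=> le hb; have [d1 _] := dif (fun p => gsupp g p == 0) _ dming.
  have [_ d2] := dif (fun p => gsupp g p == 0) _ (divisor_vpos (divisor_ord HK Hgenus f)).
  have : (psum [set: place iota] (fun p => mingcd p f1 f2)) <=
      deg (fun p : place iota => if gsupp g p == 0 then mingcd p f1 f2 else 0)
      + deg (fun p : place iota => if gsupp g p == 0 then 0 else vpos (ord p f)).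
    rewrite -degD //; apply: deg_le => //; first exact: divisorD.
    by move=> p; case: ifP => _; rewrite ?addr0 ?add0r.
  rewrite -(ler_int R) intrD => /le_trans; apply.
  have -> : eps * H = eps / 2 * H + eps / 2 * H by field.
  exact: lerD.
case: h0 => /meval_at0 h0; [apply: fin (pF h0) | apply: fin (pG h0)] => p; by case: (mingcd_le p f10 f20).
Qed.
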